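(* Let $\eta>0$ be smaller than a sufficiently small absolute constant. There is a polynomial-time $\eta$-robust estimator such that, for all $\mu\in\mathbb{R}^d$, given an $\eta$-corruption of $n$ i.i.d. samples from $\mathcal N(\mu,\mathrm{Id}_d)$ whose uncorrupted samples have empirical mean $\bar x$, the estimator outputs $\hat x$ with $\|\hat x-\bar x\|_2\le\alpha$ except with probability at most $\beta$, where $$\alpha\le O\Bigg(\eta\sqrt{\log(1/\eta)}+\sqrt{\eta\sqrt{\frac{d+\log(1/\beta)}{n}}}\Bigg).$$
   Context: Strong contamination model: $x_1,\dots,x_n$ are drawn i.i.d.; an adversary who sees all samples may replace any $\eta n$ of them by arbitrary points. An $\eta$-robust estimator of the empirical mean receives the corrupted dataset and must estimate $\bar x=\frac1n\sum_i x_i$ of the original uncorrupted samples.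
   Formalization: The bound is proved when d+log(1/β) ≤ Kn, for every constant K>0, with the O-constant depending on K; without such a condition the claim is false, since resampling ηn points moves the empirical mean by about √(ηd/n), undetectably. *)

(* Defs.v *)
From HB Require Import structures.
From mathcomp Require Import all_boot all_order all_algebra.
From mathcomp Require Import all_classical all_reals all_analysis.

Set Implicit Arguments.
Unset Strict Implicit.
Unset Printing Implicit Defensive.

Import Order.TTheory GRing.Theory Num.Theory.
Import numFieldNormedType.Exports.

Local Open Scope classical_set_scope.
Local Open Scope ring_scope.

(** * Real RAM

    The model of computation is the real RAM: integer registers, and arrays of
    reals with exact arithmetic and comparisons at unit cost.  There is no
    rounding from reals to integers, no integer multiplication (so that a run
    of length [t] only builds integers of [O(t)] bits) and no real constant
    other than the (casts of) natural numbers written in the program. *)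

Inductive nexp : Type :=
| NLit of nat
| NVar of nat
| NAdd of nexp & nexp
| NSub of nexp & nexp.

(* [RGet a i j] reads the entry [(i, j)] of the array named [a]. *)
Inductive rexp : Type :=
| RGet of nat & nexp & nexp
| RNat of nexp
| RAdd of rexp & rexp
| RSub of rexp & rexp
| RMul of rexp & rexp
| RDiv of rexp & rexp.

Inductive test : Type :=
| NLe of nexp & nexp
| RLe of rexp & rexp
| TNot of test.

Inductive cmd : Type :=
| Skip
| NSet of nat & nexp
| RSet of nat & nexp & nexp & rexp
| Seq of cmd & cmd
| If of test & cmd & cmd
| While of test & cmd.

Record state (R : realType) := State {
  nreg : nat -> nat;
  rmem : nat -> nat -> nat -> R }.

Fixpoint neval (R : realType) (s : state R) (e : nexp) : nat :=
  match e with
  | NLit k => k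
  | NVar x => nreg s x
  | NAdd e1 e2 => (neval s e1 + neval s e2)%N
  | NSub e1 e2 => (neval s e1 - neval s e2)%N
  end.

Fixpoint reval (R : realType) (s : state R) (e : rexp) : R :=
  match e with
  | RGet a i j => rmem s a (neval s i) (neval s j)
  | RNat k => (neval s k)%:R
  | RAdd e1 e2 => reval s e1 + reval s e2
  | RSub e1 e2 => reval s e1 - reval s e2
  | RMul e1 e2 => reval s e1 * reval s e2
  | RDiv e1 e2 => reval s e1 / reval s e2
  end.

Fixpoint teval (R : realType) (s : state R) (b : test) : bool :=
  match b with
  | NLe e1 e2 => (neval s e1 <= neval s e2)%N
  | RLe e1 e2 => reval s e1 <= reval s e2
  | TNot b1 => ~~ teval s b1
  end.

Definition nset (R : realType) (s : state R) (x v : nat) : state R :=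
  State (fun y => if y == x then v else nreg s y) (rmem s).

Definition rset (R : realType) (s : state R) (a i j : nat) (v : R) : state R :=
  State (nreg s) (fun a' i' j' =>
    if [&& a' == a, i' == i & j' == j] then v else rmem s a' i' j').

(* [exec c s t s']: started in [s], the program [c] halts in [s'] after [t]
   steps.  A step is an assignment or a test: the size of the expressions in it
   is bounded by the program, so that it amounts to [O(1)] operations. *)
Inductive exec (R : realType) : cmd -> state R -> nat -> state R -> Prop :=
| exec_skip s : exec Skip s 1 s
| exec_nset s x e : exec (NSet x e) s 1 (nset s x (neval s e))
| exec_rset s a i j e :
    exec (RSet a i j e) s 1 (rset s a (neval s i) (neval s j) (reval s e))
| exec_seq s s1 s2 t1 t2 c1 c2 :
    exec c1 s t1 s1 -> exec c2 s1 t2 s2 -> exec (Seq c1 c2) s (t1 + t2)%N s2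
| exec_if s s1 t b c1 c2 :
    exec (if teval s b then c1 else c2) s t s1 -> exec (If b c1 c2) s t.+1 s1
| exec_while_stop s b c : ~~ teval s b -> exec (While b c) s 1 s
| exec_while_loop s s1 s2 t1 t2 b c :
    teval s b -> exec c s t1 s1 -> exec (While b c) s1 t2 s2 ->
    exec (While b c) s (t1 + t2).+1 s2.

(** * Estimators *)

(* A dataset of [n] points of R^d is an [n x d] matrix, one point per row.  An
   estimator knows the corruption level and the dataset, and nothing else. *)
Definition estimator (R : realType) :=
  forall n d : nat, R -> 'M[R]_(n, d) -> 'rV[R]_d.

Definition entry (R : realType) (n d : nat) (Y : 'M[R]_(n, d)) (i j : nat) : R :=
  match (insub i : option 'I_n), (insub j : option 'I_d) with
  | Some i', Some j' => Y i' j'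
  | _, _ => 0
  end.

(* Input: [n] and [d] in integer registers 0 and 1, the dataset in array 0, the
   corruption level in the cell [(0, 0)] of array 1; everything else is 0. *)
Definition init (R : realType) (n d : nat) (eta : R) (Y : 'M[R]_(n, d)) : state R :=
  State
    (fun x => if x == 0%N then n else if x == 1%N then d else 0%N)
    (fun a i j =>
       if a == 0%N then entry Y i j
       else if [&& a == 1%N, i == 0%N & j == 0%N] then eta
       else 0).

(* A single program serves all dimensions, sample sizes and corruption levels;
   the output is read in row 0 of array 2. *)
Definition polynomial_time (R : realType) (est : estimator R) : Prop :=
  exists (c : cmd) (k : nat), forall (n d : nat) (eta : R) (Y : 'M[R]_(n, d)),
    exists (t : nat) (s : state R),
      [/\ exec c (init eta Y) t s,
          (t <= k * (n + d) ^ k + k)%N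
        & forall j : 'I_d, est n d eta Y ord0 j = rmem s 2 0 j].

(** * Samples and corruptions *)

Definition l2norm (R : realType) (d : nat) (v : 'rV[R]_d) : R :=
  Num.sqrt (\sum_(j < d) v ord0 j ^+ 2).

Definition empirical_mean (R : realType) (n d : nat) (X : 'M[R]_(n, d)) : 'rV[R]_d :=
  n%:R^-1 *: \sum_(i < n) row i X.

(* [Y] is obtained from [X] by replacing at most [eta * n] points. *)
Definition corruption (R : realType) (n d : nat) (eta : R) (X Y : 'M[R]_(n, d)) : Prop :=
  #|[set i : 'I_n | row i X != row i Y]%SET|%:R <= eta * n%:R.

(* [Z ~ N(mu, Id_d)], that is, the law of [Z] is the product of the [N(mu_j, 1)]. *)
Definition normal_vector (R : realType) (disp : measure_display)
    (T : measurableType disp) (P : probability T R) (d : nat) (mu : 'rV[R]_d)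
    (Z : T -> d.-tuple R) : Prop :=
  measurable_fun setT Z /\
  forall B : 'I_d -> set R, (forall j, measurable (B j)) ->
    P [set w | forall j, B j (tnth (Z w) j)] =
    (\prod_(j < d) normal_prob (mu ord0 j) 1 (B j))%E.

(* Taking some of the [A i] equal to [setT] gives the product rule for every
   subfamily. *)
Definition independent (R : realType) (disp : measure_display)
    (T : measurableType disp) (P : probability T R) (n d : nat)
    (X : 'I_n -> T -> d.-tuple R) : Prop :=
  forall A : 'I_n -> set (d.-tuple R), (forall i, measurable (A i)) ->
    P [set w | forall i, A i (X i w)] = (\prod_(i < n) P (X i @^-1` A i))%E.

Definition dataset (R : realType) (T : Type) (n d : nat)
    (X : 'I_n -> T -> d.-tuple R) (w : T) : 'M[R]_(n, d) :=
  \matrix_(i < n, j < d) tnth (X i w) j.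

(* The outer probability of [A] is at most [b]; for a measurable [A] this is
   [P A <= b]. *)
Definition prob_at_most (R : realType) (disp : measure_display)
    (T : measurableType disp) (P : probability T R) (A : set T) (b : R) : Prop :=
  exists E : set T, [/\ measurable E, A `<=` E & (P E <= b%:E)%E].

(* This rate is attainable only where [(d + ln (1 / beta)) / n] is bounded: an
   adversary who resamples [eta * n] of the points moves the empirical mean by
   about [sqrt (eta * d / n)], undetectably, and this exceeds any constant times
   the rate when [d / n] is large. *)
Definition error_rate (R : realType) (n d : nat) (eta beta : R) : R :=
  eta * Num.sqrt (ln eta^-1) +
  Num.sqrt (eta * Num.sqrt ((d%:R + ln beta^-1) / n%:R)).

(* Main.v *)
Require Import Defs.
From HB Require Import structures.
From mathcomp Require Import all_boot all_order all_algebra.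
From mathcomp Require Import all_classical all_reals all_analysis.
From mathcomp Require Import measurable_realfun.
From mathcomp Require Import ring lra zify.

(* The estimator is a weighted filter.  Give the points equal weights; compute their weighted
   mean and covariance A, the power B = A^(nd+1), and the scores |B (y_i - mean)|^2; reduce the
   weight of the points in proportion to their scores, but only among the at most 2 eta n points
   of largest score, so that some weight becomes zero; repeat n times, and output the weighted
   mean of the round with the smallest tr(A B^2) / tr(B^2) among those that keep a mass of at
   least 1 - 2 eta.  This ratio is the top eigenvalue of A up to a factor 1 + 1/n, so neither a
   threshold nor beta has to be known.

   Put rho = sqrt ((d + log (1/beta)) / n) and kappa = C (eta log (1/eta) + rho).  With
   probability 1 - beta the clean sample is stable: in every direction its empirical variance is
   within kappa of 1, and weights of total mass O(eta) carry at most kappa of it.  This follows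
   from Chernoff bounds for the moments of order one and two and for the excess of the squares
   over 16 log (1/eta), and from a union bound over a lattice net of the unit ball.

   On a stable sample, as long as the ratio exceeds 1 + 20 kappa the corrupted points carry more
   than half of the trimmed score, hence they lose more mass than the clean ones.  The mass of
   the corrupted points being at most eta, some round has ratio at most 1 + 20 kappa and mass at
   least 1 - 2 eta, and for any such round |mean - clean mean|^2 = O(eta kappa). *)

Set Implicit Arguments.
Unset Strict Implicit.
Unset Printing Implicit Defensive.

Import Order.TTheory GRing.Theory Num.Theory.
Import numFieldNormedType.Exports.

Local Open Scope classical_set_scope.
Local Open Scope ring_scope.

(** * Inequalities and suprema *)

(** The target is the empirical mean of the clean points themselves. Uniform weights have zero first
    moment about it, so only weights of mass O(eta), removed or corrupted, shift the estimate, and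
    Cauchy-Schwarz bounds the shift by the root of eta times an excess of variance O(kappa). The
    error of order rho made in estimating [mu] never enters.

    Without trimming the comparison of scores fails: the clean points have total score about
    tr(B^2), far above what corrupted points add when the ratio is 1 + O(kappa). On clean weights of
    mass O(eta) the score is only O(kappa) tr(B^2), up to the error of the current mean.

    The machine has field operations and comparisons only, hence no eigenvectors. A power of A is a
    rational function of the data, and its rows serve as a family of directions, to each of which
    stability applies.

    The bound K on rho^2 enters through concentration: squares of Gaussians are only subexponential,
    so the Chernoff parameter, proportional to rho, must stay below a constant. It also turns rho^2
    into O(rho). *)

Lemma discriminant_le0 (R : realFieldType) (a b c : R) :
  0 <= c -> (forall t, 0 <= a - 2 * t * b + t ^+ 2 * c) -> b ^+ 2 <= a * c.
Proof.
move=> c0 h.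
have [c_eq0|c_neq0] := eqVneq c 0.
  have [->|b0] := eqVneq b 0; first by rewrite c_eq0 mulr0 expr0n.
  have := h ((a + 1) / (2 * b)); rewrite c_eq0 mulr0 addr0.
  have -> : a - 2 * ((a + 1) / (2 * b)) * b = -1 by field.
  by lra.
have cp : 0 < c by rewrite lt_def c_neq0.
have := h (b / c).
have -> : a - 2 * (b / c) * b + (b / c) ^+ 2 * c = (a * c - b ^+ 2) / c by field.
by rewrite pmulr_lge0 ?invr_gt0// subr_ge0.
Qed.

Section weighted_cauchy_schwarz.
Variables (R : realFieldType) (I : finType).
Implicit Types w a b : I -> R.

Lemma weighted_cauchy_schwarz w a b : (forall i, 0 <= w i) ->
  (\sum_i w i * a i * b i) ^+ 2 <= (\sum_i w i * a i ^+ 2) * (\sum_i w i * b i ^+ 2).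
Proof.
move=> w0; apply: discriminant_le0 => [|t].
  by apply: sumr_ge0 => i _; rewrite mulr_ge0// sqr_ge0.
have -> : \sum_i w i * a i ^+ 2 - 2 * t * (\sum_i w i * a i * b i) +
   t ^+ 2 * (\sum_i w i * b i ^+ 2) = \sum_i w i * (a i - t * b i) ^+ 2.
  rewrite !mulr_sumr -sumrB -big_split/=; apply: eq_bigr => i _; ring.
by apply: sumr_ge0 => i _; rewrite mulr_ge0// sqr_ge0.
Qed.

Lemma cauchy_schwarz a b :
  (\sum_i a i * b i) ^+ 2 <= (\sum_i a i ^+ 2) * (\sum_i b i ^+ 2).
Proof.
have := @weighted_cauchy_schwarz (fun _ => 1) a b (fun _ => ler01).
by under eq_bigr do rewrite mul1r; under [X in _ <= X * _]eq_bigr do rewrite mul1r;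
  under [X in _ <= _ * X]eq_bigr do rewrite mul1r.
Qed.

End weighted_cauchy_schwarz.

(** The supremum [S] is itself an admissible [q], so [S <= a + c * S]. The crude bound [b] serves
    only to make [S] finite, which allows [c * S] to be moved to the left. *)
Lemma sup_contraction (R : realType) (T : Type) (D : T -> Prop) (F : T -> R) (a c : R) :
  c < 1 -> (exists b, forall x, D x -> F x <= b) ->
  (forall q, (forall x, D x -> F x <= q) -> forall x, D x -> F x <= a + c * q) ->
  forall x, D x -> F x <= a / (1 - c).
Proof.
move=> c1 [b Fb] step x Dx; pose S := [set F y | y in D].
have hS : has_sup S by split; [exists (F x), x|exists b => _ [y Dy <-]; exact: Fb].
have le_sup y : D y -> F y <= sup S.
  by move=> Dy; apply: sup_upper_bound => //; exists y.
have : sup S <= a + c * sup S.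
  by apply: ge_sup; [exact: hS.1|move=> _ [y Dy <-]; exact: step].
have := le_sup x Dx; rewrite ler_pdivlMr ?subr_gt0//; nra.
Qed.

(** * Expectations of products and Gaussian moments *)

Lemma measurable_fun_bigprod (R : realType) (d : measure_display) (T : measurableType d)
    (I : Type) (r : seq I) (Q : pred I) (f : I -> T -> R) :
  (forall i, measurable_fun setT (f i)) ->
  measurable_fun setT (fun x => \prod_(i <- r | Q i) f i x).
Proof.
move=> mf; elim: r => [|i r IH].
  by rewrite (_ : (fun _ => _) = cst 1)//; apply/funext => x; rewrite big_nil.
under eq_fun do rewrite big_cons.
by case: (Q i) => //; apply: measurable_funM.
Qed.

Lemma measurable_fun_bigsum (R : realType) (d : measure_display) (T : measurableType d)
    (I : Type) (r : seq I) (Q : pred I) (f : I -> T -> R) :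
  (forall i, measurable_fun setT (f i)) ->
  measurable_fun setT (fun x => \sum_(i <- r | Q i) f i x).
Proof.
move=> mf; elim: r => [|i r IH].
  by rewrite (_ : (fun _ => _) = cst 0)//; apply/funext => x; rewrite big_nil.
under eq_fun do rewrite big_cons.
by case: (Q i) => //; apply: measurable_funD.
Qed.

Section weighted_pushforward.
Context (R : realType) (dT dS : measure_display) (T : measurableType dT)
  (S : measurableType dS) (P : {measure set T -> \bar R}) (nu : {measure set S -> \bar R}).
Variables (X : T -> S) (H : T -> \bar R).
Hypothesis mX : measurable_fun setT X.
Hypothesis mH : measurable_fun setT H.
Hypothesis H0 : forall w, (0 <= H w)%E.
Hypothesis Hfin : forall w, H w \is a fin_num.
Hypothesis Hind : forall A, measurable A ->
  (\int[P]_w ((\1_A (X w))%:E * H w) = nu A)%E.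

Import HBNNSimple.

Let integral_weighted_nnsfun (h : {nnsfun S >-> R}) :
  (\int[P]_w ((h (X w))%:E * H w) = \int[nu]_x (h x)%:E)%E.
Proof.
have h0 r w : (0 <= (r * \1_(h @^-1` [set r]) (X w))%:E)%E.
  by rewrite EFinM nnfun_muleindic_ge0.
have mh r : measurable_fun setT (fun w => (\1_(h @^-1` [set r]) (X w) : R)).
  by apply: measurableT_comp => //; exact: measurable_indic.
have mhE r : measurable_fun setT (fun w => (r * \1_(h @^-1` [set r]) (X w))%:E).
  by apply/measurable_EFinP; apply: measurable_funM.
have E x : ((h x)%:E = \sum_(r \in range h)
   (r * \1_(h @^-1` [set r]) x)%:E)%E by rewrite fimfunE -fsumEFin.
under eq_integral => w _.
  rewrite E ge0_mule_fsuml; last by move=> r; exact: h0.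
  over.
rewrite ge0_integral_fsum//; last 2 first.
  - by move=> r; apply: emeasurable_funM.
  - by move=> r w _; rewrite mule_ge0.
under [in RHS]eq_integral => w _ do rewrite E.
rewrite ge0_integral_fsum//; last 2 first.
  - by move=> r; apply/measurable_EFinP; apply: measurable_funM.
  - by move=> r w _; rewrite EFinM nnfun_muleindic_ge0.
apply: eq_fsbigr => r /set_mem [s _ hs].
have r0 : 0 <= r by rewrite -hs.
under eq_integral => w _ do rewrite EFinM -muleA.
rewrite ge0_integralZl//; last 2 first.
  - by apply: emeasurable_funM => //; apply/measurable_EFinP.
  - by move=> w _; rewrite mule_ge0// lee_fin.
under [in RHS]eq_integral => w _ do rewrite EFinM.
rewrite ge0_integralZl//; last exact/measurable_EFinP/measurable_indic.
by rewrite Hind// integral_indic// setIT.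
Qed.

(** Change of variables for a law known through its values on sets: simple functions, then monotone
    convergence. The weight [H] is in turn a product of independent factors, a density, and the
    constant 1. *)
Lemma integral_weighted (f : S -> \bar R) :
  measurable_fun setT f -> (forall x, (0 <= f x)%E) ->
  (\int[P]_w (f (X w) * H w) = \int[nu]_x f x)%E.
Proof.
move=> mf f0; pose f_ := nnsfun_approx measurableT mf.
have ndf x : {homo (fun n => (f_ n x)%:E) : n m / (n <= m)%N >-> (n <= m)%E}.
  by move=> n m nm; rewrite lee_fin; exact/lefP/nd_nnsfun_approx.
have cf x : (f_ n x)%:E @[n --> \oo] --> f x.
  by apply: cvg_nnsfun_approx.
have mfX n : measurable_fun setT (fun w => (f_ n (X w))%:E).
  by apply/measurable_EFinP; apply: measurableT_comp.
have lim1 x : limn (fun n => (f_ n x)%:E) = f x by exact/cvg_lim.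
transitivity (limn (fun n => \int[P]_w ((f_ n (X w))%:E * H w))%E).
  rewrite -monotone_convergence//.
  - apply: eq_integral => w _; apply/esym/cvg_lim => //.
    by apply: cvgeZr.
  - by move=> n; apply: emeasurable_funM.
  - by move=> n w _; apply: mule_ge0 => //; rewrite lee_fin.
  - by move=> w _ n m nm; apply: lee_wpmul2r => //; exact: ndf.
under eq_fun do rewrite integral_weighted_nnsfun.
apply/cvg_lim => //.
under [in X in _ --> X]eq_integral => x _ do rewrite -lim1.
apply: cvg_monotone_convergence => //.
  by move=> n; exact/measurable_EFinP.
by move=> n x _; rewrite lee_fin.
Qed.
End weighted_pushforward.

(* Replaces the indicators in the product rule by the [f i] one index at a time: for indices
   [>= k] the factor is still an indicator. *)
Lemma expectation_prod_indep (R : realType) (dT dS : measure_display) (T : measurableType dT)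
    (S : measurableType dS) (P : probability T R) (n : nat) (X : 'I_n -> T -> S)
    (f : 'I_n -> S -> R) :
  (forall i, measurable_fun setT (X i)) ->
  (forall A : 'I_n -> set S, (forall i, measurable (A i)) ->
    P [set w | forall i, A i (X i w)] = (\prod_(i < n) P (X i @^-1` A i))%E) ->
  (forall i, measurable_fun setT (f i)) -> (forall i x, 0 <= f i x) ->
  (forall i, (\int[P]_w (f i (X i w))%:E < +oo)%E) ->
  (\int[P]_w (\prod_(i < n) f i (X i w))%:E = \prod_(i < n) \int[P]_w (f i (X i w))%:E)%E.
Proof.
move=> mX indep.
have mXA i A : measurable A -> measurable (X i @^-1` A).
  by move=> mA; rewrite -[X in measurable X]setTI; exact: mX.
suff main k : (k <= n)%N -> forall g : 'I_n -> S -> R,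
    (forall i, measurable_fun setT (g i)) -> (forall i x, 0 <= g i x) ->
    (forall i, (\int[P]_w (g i (X i w))%:E < +oo)%E) ->
    (forall i : 'I_n, (k <= i)%N -> exists2 A, measurable A & g i = \1_A) ->
  (\int[P]_w (\prod_(i < n) g i (X i w))%:E = \prod_(i < n) \int[P]_w (g i (X i w))%:E)%E.
  move=> mf f0 foo; apply: (main n) => // i; by rewrite leqNgt ltn_ord.
elim: k => [_ g mg g0 goo gA|k IH kn g mg g0 goo gA].
  have {gA} /choice[A gA] : forall i, exists A, measurable A /\ g i = \1_A.
    by move=> i; have [A] := gA i isT; exists A.
  transitivity (P [set w | forall i, A i (X i w)]).
    have mA : measurable [set w | forall i, A i (X i w)].
      have -> : [set w | forall i, A i (X i w)] = \bigcap_(i in setT) (X i @^-1` A i).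
        by apply/seteqP; split=> w /= h i; [move=> _; exact: h|exact: (h i I)].
      by apply: fin_bigcap_measurable => // i _; apply: mXA; have [] := gA i.
    have := integral_indic P measurableT mA; rewrite setIT => <-.
    apply: eq_integral => w _; congr EFin; rewrite indicE.
    case: (boolP (w \in _)) => [/set_mem /= h|/negP h].
      by rewrite big1// => i _; have [_ ->] := gA i; rewrite indicE mem_set.
    have [//|/prodf_neq0 h'] := eqVneq (\prod_(i < n) g i (X i w)) 0.
    case: h; apply/mem_set => /= i; have := h' i isT.
    by have [_ ->] := gA i; rewrite indicE pnatr_eq0 eqb0 negbK => /set_mem.
  rewrite indep; last by move=> i; have [] := gA i.
  apply: eq_bigr => i _; have [mA ->] := gA i.
  by rewrite (integral_indic P measurableT (mXA i _ mA)) setIT.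
pose ik := Ordinal kn.
have E (h : 'I_n -> S -> R) w : \prod_(i < n) h i (X i w) =
   h ik (X ik w) * \prod_(i < n | i != ik) h i (X i w) by rewrite (bigD1 ik).
pose H w := (\prod_(i < n | i != ik) g i (X i w))%:E.
pose c := (\prod_(i < n | i != ik) \int[P]_w (g i (X i w))%:E)%E.
have i0 i : (0 <= \int[P]_w (g i (X i w))%:E)%E.
  by apply: integral_ge0 => w _; rewrite lee_fin.
under eq_integral => w _ do rewrite E EFinM -/(H w).
have cfin : c \is a fin_num.
  rewrite /c; elim/big_rec: _ => // i x _ xf; apply: fin_numM => //.
  by rewrite ge0_fin_numE.
have c0 : 0 <= fine c by apply: fine_ge0; exact: prode_ge0.
pose Xk : {mfun T >-> S} := HB.pack (X ik) (isMeasurableFun.Build _ _ _ _ _ (mX ik)).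
have mgE : measurable_fun setT (EFin \o g ik) by apply/measurable_EFinP.
rewrite (bigD1 ik)//= -/c muleC -(fineK cfin).
transitivity (\int[mscale (NngNum c0) (distribution P Xk)]_x (g ik x)%:E)%E; last first.
  by rewrite ge0_integral_mscale//= ?ge0_integral_distribution//= => x *; rewrite lee_fin.
apply: (integral_weighted (mX ik) _ _ _ _ mgE) => //.
- apply/measurable_EFinP; rewrite /H.
  by apply: measurable_fun_bigprod => i; apply: measurableT_comp.
- by move=> w; rewrite lee_fin prodr_ge0.
(* The family [h] has an indicator at index [k] too, so the induction hypothesis applies to it:
   weighted by [H], the law of [X ik] is [c] times its law under [P]. *)
- move=> A mA; pose h i := if i == ik then \1_A else g i.
  have hk : h ik = \1_A by rewrite /h eqxx.
  have hi i : i != ik -> h i = g i by rewrite /h => /negbTE ->.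
  have Pfin B : measurable B -> (P B < +oo)%E.
    by move=> mB; apply: le_lt_trans (probability_le1 P mB) _; rewrite ltry.
  have intA : (\int[P]_w (\1_A (X ik w))%:E = P (X ik @^-1` A))%E.
    by have := integral_indic P measurableT (mXA ik _ mA); rewrite setIT => <-.
  rewrite /= -[RHS]/((fine c)%:E * P (X ik @^-1` A))%E fineK//; have := IH (ltnW kn) h; rewrite (bigD1 ik)//= hk intA muleC.
  rewrite (eq_bigr (fun i => \int[P]_w (g i (X i w))%:E)%E); last by move=> i /hi ->.
  rewrite -/c => <-.
  + apply: eq_integral => w _; rewrite E hk -EFinM.
    by congr (_ * _)%:E; apply: eq_bigr => i /hi ->.
  + move=> i; have [->|/hi ->//] := eqVneq i ik; rewrite hk.
    exact: measurable_indic.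
  + by move=> i x; have [->|/hi ->//] := eqVneq i ik; rewrite hk indicE.
  + by move=> i; have [->|/hi ->//] := eqVneq i ik; rewrite hk intA Pfin//; exact: mXA.
  + move=> i; rewrite leq_eqVlt => /predU1P[ki|ki].
      by exists A => //; rewrite -hk; congr h; apply/val_inj.
    rewrite hi; first exact: gA.
    by apply: contraTneq ki => ->; rewrite ltnn.
- by move=> x; rewrite lee_fin.
Qed.

(** * Exponential moments of the Gaussian law *)

Lemma ge0_integral_normal_prob (R : realType) (m s : R) (f : R -> \bar R) :
  measurable_fun setT f -> (forall x, (0 <= f x)%E) ->
  (\int[normal_prob m s]_x f x =
   \int[@lebesgue_measure R]_x (f x * (normal_pdf m s x)%:E))%E.
Proof.
move=> mf f0; apply/esym.
apply: (@integral_weighted R _ _ _ _ _ (normal_prob m s) id (fun x => (normal_pdf m s x)%:E)) => //.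
- by apply/measurable_EFinP; exact: measurable_normal_pdf.
- by move=> x; rewrite lee_fin normal_pdf_ge0.
- move=> A mA; rewrite /normal_prob/= [RHS]integral_mkcond.
  apply: eq_integral => x _; rewrite patchE indicE.
  by case: (x \in A); rewrite ?mul1e ?mul0e.
Qed.

Lemma normal_prob_mgf (R : realType) (m l : R) :
  (\int[normal_prob m 1]_x (expR (l * (x - m)))%:E = (expR (l ^+ 2 / 2))%:E)%E.
Proof.
have mexp : measurable_fun setT (fun x : R => (expR (l * (x - m)))%:E).
  apply/measurable_EFinP; apply: measurableT_comp => //.
  by apply: measurable_funM => //; apply: measurable_funB.
rewrite ge0_integral_normal_prob//.
under eq_integral => x _.
  (* Completing the square: tilting the density of N(m, 1) gives a multiple of that of N(m + l, 1),
     whose integral is 1. *)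
  rewrite (_ : (_ * _)%E = ((expR (l ^+ 2 / 2))%:E * (normal_pdf (m + l) 1 x)%:E)%E); last first.
    rewrite -!EFinM !normal_pdfE ?oner_neq0// /normal_fun; congr EFin.
    rewrite [LHS]mulrCA [RHS]mulrCA; congr (_ * _); rewrite -!expRD; congr expR.
    by rewrite expr1n; field.
  over.
rewrite ge0_integralZl//; last 2 first.
- by apply/measurable_EFinP; exact: measurable_normal_pdf.
- by move=> x _; rewrite lee_fin normal_pdf_ge0.
by rewrite integral_normal_pdf mule1.
Qed.

(** For [a <= 1 / 4] the exponent [a x^2 - x^2 / 2] is at most [- x^2 / 4], that of N(0, 2); the
    peaks of the two densities differ by a factor [sqrt 2 <= 2]. *)
Lemma normal_prob_exp_sqr (R : realType) (a : R) : 0 <= a <= 1 / 4 ->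
  (\int[normal_prob 0 1]_x (expR (a * x ^+ 2))%:E <= 2%:E)%E.
Proof.
move=> /andP[a0 a4].
have s2 : Num.sqrt 2 != 0 :> R by rewrite sqrtr_eq0 -ltNge.
have mexp : measurable_fun setT (fun x : R => (expR (a * x ^+ 2))%:E).
  apply/measurable_EFinP; apply: measurableT_comp => //.
  by apply: measurable_funM.
rewrite ge0_integral_normal_prob//.
have mpdf : measurable_fun setT (fun x => (normal_pdf 0 (Num.sqrt 2) x)%:E : \bar R).
  by apply/measurable_EFinP; exact: measurable_normal_pdf.
apply: (@le_trans _ _ (\int[@lebesgue_measure R]_x (2%:E * (normal_pdf 0 (Num.sqrt 2) x)%:E))%E).
  apply: ge0_le_integral => //.
  - by move=> x _; rewrite mule_ge0// lee_fin ?expR_ge0 ?normal_pdf_ge0.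
  - apply: emeasurable_funM => //.
    by apply/measurable_EFinP; exact: measurable_normal_pdf.
  - by apply: emeasurable_funM.
  - move=> x _; rewrite -!EFinM lee_fin !normal_pdfE ?oner_neq0// /normal_fun.
    have peak : normal_peak 1 <= 2 * normal_peak (Num.sqrt 2) :> R.
      have p0 := pi_gt0 R.
      rewrite /normal_peak expr1n sqr_sqrtr// ler_pdivlMr; last first.
        by rewrite sqrtr_gt0; lra.
      rewrite ler_pdivrMl; last by rewrite sqrtr_gt0; lra.
      rewrite -(@ler_pXn2r _ 2) ?nnegrE ?mulr_ge0 ?sqrtr_ge0//.
      by rewrite exprMn !sqr_sqrtr; lra.
    have e : expR (a * x ^+ 2) * expR (- (x - 0) ^+ 2 / (1 ^+ 2 *+ 2)) <=
             expR (- (x - 0) ^+ 2 / (Num.sqrt 2 ^+ 2 *+ 2)).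
      rewrite -expRD ler_expR subr0 expr1n sqr_sqrtr//.
      have -> : - x ^+ 2 / (1 *+ 2) = - (1 / 2) * x ^+ 2 by field.
      have -> : - x ^+ 2 / (2 *+ 2) = - (1 / 4) * x ^+ 2 by field.
      by rewrite -mulrDl ler_wpM2r ?sqr_ge0//; lra.
    rewrite mulrCA [leRHS]mulrA; apply: ler_pM => //.
    exact: normal_peak_ge0.
rewrite ge0_integralZl//; last first.
  by move=> x _; rewrite lee_fin normal_pdf_ge0.
by rewrite integral_normal_pdf mule1.
Qed.

Section gaussian_vector.
Context (R : realType) (disp : measure_display) (T : measurableType disp)
  (P : probability T R) (d : nat) (mu : 'rV[R]_d) (Z : T -> d.-tuple R).
Hypothesis gaussZ : normal_vector P mu Z.
Implicit Types v : 'I_d -> R.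

Definition centered_dot v (z : d.-tuple R) := \sum_(j < d) v j * (tnth z j - mu ord0 j).

Lemma measurable_centered_dot v : measurable_fun setT (centered_dot v).
Proof.
apply: measurable_fun_bigsum => j; apply: measurable_funM => //.
by apply: measurable_funB => //; exact: measurable_tnth.
Qed.

Lemma measurable_centered_dotZ v : measurable_fun setT (centered_dot v \o Z).
Proof.
by apply: measurableT_comp; [exact: measurable_centered_dot|exact: gaussZ.1].
Qed.

Let mZ j : measurable_fun setT (fun w => tnth (Z w) j).
Proof.
exact: (measurableT_comp (measurable_tnth j) gaussZ.1).
Qed.

Lemma normal_vector_marginal j (A : set R) : measurable A ->
  P ((fun w => tnth (Z w) j) @^-1` A) = normal_prob (mu ord0 j) 1 A.
Proof.
move=> mA; pose B i := if i == j then A else setT.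
have mB i : measurable (B i) by rewrite /B; case: ifP.
have := gaussZ.2 B mB; rewrite (bigD1 j)//= big1 ?mule1; last first.
  by move=> i /negbTE ij; rewrite /B ij; exact: probability_setT.
rewrite {2}/B eqxx => <-; congr (P _).
apply/seteqP; split=> w /=; last by move=> /(_ j); rewrite /B eqxx.
by move=> Aw i; rewrite /B; case: eqVneq => [->|].
Qed.

Lemma normal_vector_mgf v (l : R) :
  (\int[P]_w (expR (l * centered_dot v (Z w)))%:E =
   (expR (l ^+ 2 * (\sum_(j < d) v j ^+ 2) / 2))%:E)%E.
Proof.
pose f j x := expR (l * v j * (x - mu ord0 j)).
have mf j : measurable_fun setT (f j).
  apply: measurableT_comp => //; apply: measurable_funM => //.
  exact: measurable_funB.
have If j : (\int[P]_w (f j (tnth (Z w) j))%:E = (expR ((l * v j) ^+ 2 / 2))%:E)%E.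
  rewrite -(normal_prob_mgf (mu ord0 j)).
  rewrite -(@integral_weighted _ _ _ _ _ P (normal_prob (mu ord0 j) 1) _ (cst 1%E) (mZ j))//.
  - by apply: eq_integral => w _; rewrite mule1.
  - move=> A mA; apply: etrans (normal_vector_marginal j mA).
    under eq_integral => w _ do rewrite mule1.
    have mA' : measurable ((fun w => tnth (Z w) j) @^-1` A).
      by rewrite -[X in measurable X]setTI; exact: mZ.
    by have := integral_indic P measurableT mA'; rewrite setIT.
  - by apply/measurable_EFinP; exact: mf.
transitivity (\int[P]_w (\prod_(j < d) f j (tnth (Z w) j))%:E)%E.
  apply: eq_integral => w _; congr EFin; rewrite /f /centered_dot mulr_sumr expR_sum.
  by apply: eq_bigr => j _; rewrite mulrA.
rewrite (expectation_prod_indep mZ)//.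
- rewrite (eq_bigr (fun j => (expR ((l * v j) ^+ 2 / 2))%:E)) => [|j _]; last exact: If.
  rewrite prodEFin -expR_sum; congr (expR _)%:E.
  by rewrite mulr_sumr mulr_suml; apply: eq_bigr => j _; rewrite exprMn.
- move=> A mA; rewrite gaussZ.2//; apply: eq_bigr => j _.
  by rewrite normal_vector_marginal.
- by move=> j x; rewrite expR_ge0.
- by move=> j; rewrite If ltry.
Qed.

(* [exp (s W^2)] is the mean of [exp (sqrt (2 s) x W)] over an independent standard normal
   [x], and the two integrals are exchanged. *)
Lemma normal_vector_exp_sqr v (s : R) : 0 <= s -> s * (\sum_(j < d) v j ^+ 2) <= 1 / 4 ->
  (\int[P]_w (expR (s * centered_dot v (Z w) ^+ 2))%:E <= 2%:E)%E.
Proof.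
move=> s0 sv; pose V := \sum_(j < d) v j ^+ 2.
have V0 : 0 <= V by apply: sumr_ge0 => j _; exact: sqr_ge0.
pose r := Num.sqrt (2 * s).
have r2 : r ^+ 2 = 2 * s by rewrite sqr_sqrtr// mulr_ge0.
pose F (wx : T * measurableTypeR R) := (expR (r * centered_dot v (Z wx.1) * wx.2))%:E.
have mF : measurable_fun setT F.
  apply/measurable_EFinP; apply: measurableT_comp => //; apply: measurable_funM => //.
  apply: measurable_funM => //.
  exact: (measurableT_comp (measurable_centered_dotZ v) measurable_fst).
have F0 wx : (0 <= F wx)%E by rewrite lee_fin expR_ge0.
have E w : (expR (s * centered_dot v (Z w) ^+ 2))%:E =
    (\int[normal_prob (0 : R) 1]_x F (w, x))%E.
  have := normal_prob_mgf 0 (r * centered_dot v (Z w)).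
  under eq_integral => x _ do rewrite subr0.
  move=> ->; congr (expR _)%:E; rewrite exprMn r2; by field.
under eq_integral => w _ do rewrite E.
rewrite (fubini_tonelli F mF F0).
apply: le_trans (normal_prob_exp_sqr (a := s * V) _); last by rewrite sv mulr_ge0.
rewrite le_eqVlt; apply/orP; left; apply/eqP; apply: eq_integral => x _.
rewrite /F/=.
under eq_integral => w _ do rewrite mulrAC.
rewrite normal_vector_mgf exprMn r2; congr (expR _)%:E.
by rewrite -/V; field.
Qed.
End gaussian_vector.

Section exponential_inequalities.
Variable R : realType.
Implicit Types x y : R.

(** The inequalities of this section are chained by differentiation: [sinh_ge] gives the sign of the
    derivative in [cosh_ge_pos], and [sinh_le] the one in [cosh_le_pos]. *)
Lemma derive_ge0_le (f f' : R -> R) x : f 0 = 0 -> (forall y, is_derive y 1 f (f' y)) ->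
  (forall y, 0 <= y -> 0 <= f' y) -> 0 <= x -> 0 <= f x.
Proof.
move=> f00 df f'0 x0.
have cf : {within `[0, x], continuous f}.
  by apply: derivable_within_continuous => y _; have [] := df y.
have [c] := MVT_segment x0 (fun y _ => df y) cf.
rewrite in_itv/= subr0 => /andP[c0 _] fx.
have -> : f x = f x - f 0 by rewrite f00 subr0.
by rewrite fx mulr_ge0// f'0.
Qed.

Lemma expR_le_quad x : 0 <= x -> expR x <= 1 + x + x ^+ 2 / 2 * expR x.
Proof.
move=> x0; suff : 1 <= (1 + x) * expR (- x) + x ^+ 2 / 2.
  move/(ler_wpM2r (expR_ge0 x)).
  have FE : expR (- x) * expR x = 1 by rewrite -expRD addNr expR0.
  rewrite [leRHS](_ : _ = (1 + x) * (expR (- x) * expR x) + x ^+ 2 / 2 * expR x).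
    by rewrite FE mul1r mulr1.
  by ring.
rewrite -subr_ge0.
have := @derive_ge0_le (fun x => (1 + x) * expR (- x) + x ^+ 2 / 2 - 1)
   (fun x => x * (1 - expR (- x))) x.
apply => //; first by rewrite ?mul0r ?oppr0 expR0; field.
  move=> y; apply: is_derive_eq.
  by rewrite /GRing.scale/=; field.
by move=> y y0; rewrite mulr_ge0// subr_ge0 -expR0 ler_expR oppr_le0.
Qed.

Lemma expRN_le_quad x : 0 <= x -> expR (- x) <= 1 - x + x ^+ 2 / 2.
Proof.
have h1 y : 0 <= y -> 0 <= expR (- y) - (1 - y).
  by move=> y0; have := expR_ge1Dx (- y); lra.
move=> x0; rewrite -subr_ge0.
have := @derive_ge0_le (fun x => 1 - x + x ^+ 2 / 2 - expR (- x))
   (fun x => expR (- x) - (1 - x)) x.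
apply => //; first by rewrite ?mul0r ?oppr0 expR0; field.
move=> y; apply: is_derive_eq.
by rewrite /GRing.scale/=; field.
Qed.

Lemma sinh_ge x : 0 <= x -> 2 * x <= expR x - expR (- x).
Proof.
move=> x0; rewrite -subr_ge0.
have := @derive_ge0_le (fun x => expR x - expR (- x) - 2 * x)
   (fun x => expR x + expR (- x) - 2) x.
apply => //; first by rewrite ?mul0r ?oppr0 expR0; field.
  move=> y; apply: is_derive_eq.
  by rewrite /GRing.scale/=; field.
move=> y y0; have := expR_ge1Dx y; have := expR_ge1Dx (- y); lra.
Qed.

Lemma cosh_ge_pos x : 0 <= x -> 2 + x ^+ 2 <= expR x + expR (- x).
Proof.
move=> x0; rewrite -subr_ge0.
have := @derive_ge0_le (fun x => expR x + expR (- x) - (2 + x ^+ 2))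
   (fun x => expR x - expR (- x) - 2 * x) x.
apply => //; first by rewrite ?mul0r ?oppr0 expR0; field.
  move=> y; apply: is_derive_eq.
  by rewrite /GRing.scale/=; field.
by move=> y y0; rewrite subr_ge0 sinh_ge.
Qed.

Lemma cosh_ge x : 2 + x ^+ 2 <= expR x + expR (- x).
Proof.
have [x0|/ltW x0] := leP 0 x; first exact: cosh_ge_pos.
by have := @cosh_ge_pos (- x); rewrite oppr_ge0 opprK sqrrN => /(_ x0); lra.
Qed.

Lemma sinh_le x : 0 <= x -> expR x - expR (- x) <= x * (expR x + expR (- x)).
Proof.
move=> x0; rewrite -subr_ge0.
have := @derive_ge0_le (fun x => x * (expR x + expR (- x)) - (expR x - expR (- x)))
   (fun x => x * (expR x - expR (- x))) x.
apply => //; first by rewrite ?mul0r ?oppr0 expR0; field.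
  move=> y; apply: is_derive_eq.
  by rewrite /GRing.scale/=; field.
by move=> y y0; rewrite mulr_ge0// subr_ge0 ler_expR ge0_cp.
Qed.

Lemma cosh_le_pos x : 0 <= x -> expR x + expR (- x) <= 2 * expR (x ^+ 2 / 2).
Proof.
move=> x0; suff : (expR x + expR (- x)) * expR (- (x ^+ 2 / 2)) <= 2.
  by rewrite [X in _ * X]expRN ler_pdivrMr ?expR_gt0.
rewrite -subr_ge0.
have := @derive_ge0_le (fun x => 2 - ((expR x + expR (- x)) * expR (- (x ^+ 2 / 2))))
   (fun x => (x * (expR x + expR (- x)) - (expR x - expR (- x))) * expR (- (x ^+ 2 / 2))) x.
apply => //; first by rewrite expr0n/= mul0r oppr0 expR0; ring.
  move=> y; apply: is_derive_eq.
  by rewrite /GRing.scale/=; field.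
by move=> y y0; rewrite mulr_ge0 ?expR_ge0// subr_ge0 sinh_le.
Qed.

Lemma cosh_le x : expR x + expR (- x) <= 2 * expR (x ^+ 2 / 2).
Proof.
have [x0|/ltW x0] := leP 0 x; first exact: cosh_le_pos.
by have := @cosh_le_pos (- x); rewrite oppr_ge0 opprK sqrrN => /(_ x0); lra.
Qed.

End exponential_inequalities.

Lemma sqr_le_expR (R : realType) (y : R) : 0 <= y -> y ^+ 2 <= expR y.
Proof.
move=> y0; have := cosh_ge y; have : expR (- y) <= 1.
  by rewrite -expR0 ler_expR oppr_le0.
lra.
Qed.

(** One half of the exponent [W^2 / 8] pays for the factor [W^4], the other for [exp (s W^2)]. The
    right side has a bounded mean as long as [W] has variance at most 2. *)
Lemma expR_sqr_remainder (R : realType) (s W : R) : 0 <= s -> s <= 1 / 16 ->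
  (s * W ^+ 2) ^+ 2 * expR (s * W ^+ 2) <= 256 * s ^+ 2 * expR (W ^+ 2 / 8).
Proof.
move=> s0 s1; have W0 := sqr_ge0 W.
have -> : W ^+ 2 / 8 = W ^+ 2 / 16 + W ^+ 2 / 16 by field.
have h1 := @sqr_le_expR R (W ^+ 2 / 16) (ltac:(lra)).
have h2 : expR (s * W ^+ 2) <= expR (W ^+ 2 / 16).
  by rewrite ler_expR mulrC ler_wpM2l//; lra.
have -> : (s * W ^+ 2) ^+ 2 = 256 * s ^+ 2 * (W ^+ 2 / 16) ^+ 2 by field.
have c0 : 0 <= 256 * s ^+ 2 by rewrite mulr_ge0 ?sqr_ge0.
rewrite expRD mulrA; apply: ler_pM => //; last exact: ler_wpM2l.
by rewrite mulr_ge0 ?sqr_ge0.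
Qed.

Lemma integral_cst_probability (R : realType) (disp : measure_display)
  (T : measurableType disp) (P : probability T R) (c : R) : (\int[P]__ c%:E = c%:E)%E.
Proof.
rewrite (integral_cst P measurableT) -[RHS]mule1; congr (_ * _)%E.
exact: probability_setT.
Qed.

(** * Exponential moments of squared projections *)

Section sample_moments.
Context (R : realType) (disp : measure_display) (T : measurableType disp)
  (P : probability T R) (d : nat) (mu : 'rV[R]_d) (Z : T -> d.-tuple R).
Hypothesis gaussZ : normal_vector P mu Z.
Variables (v : 'I_d -> R).
Let V := \sum_(j < d) v j ^+ 2.
Let W w := centered_dot mu v (Z w).

Let V0 : 0 <= V.
Proof. by apply: sumr_ge0 => j _; exact: sqr_ge0. Qed.

Let mW : measurable_fun setT W.
Proof. exact: measurable_centered_dotZ gaussZ v. Qed.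

Let mexp (c : R) : measurable_fun setT (fun w => (expR (c * W w))%:E).
Proof.
by apply/measurable_EFinP; apply: measurableT_comp => //; apply: measurable_funM.
Qed.

Let mexp2 (c : R) : measurable_fun setT (fun w => (expR (c * W w ^+ 2))%:E).
Proof.
apply/measurable_EFinP; apply: measurableT_comp => //; apply: measurable_funM => //.
exact: measurable_funX.
Qed.

Let cosh_moment (s : R) : 0 <= s ->
  (\int[P]_w ((expR (Num.sqrt (2 * s) * W w))%:E + (expR (- Num.sqrt (2 * s) * W w))%:E) =
   (2 * expR (s * V))%:E)%E.
Proof.
move=> s0; rewrite ge0_integralD//; [|by move=> w _; rewrite lee_fin expR_ge0..].
rewrite !(normal_vector_mgf gaussZ) sqrrN sqr_sqrtr ?mulr_ge0// -EFinD; congr EFin.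
have -> : 2 * s * V / 2 = s * V by field.
by ring.
Qed.

(** The second moment of [W] is never integrated: the Taylor part [1 + s W^2] is at most
    [cosh (sqrt (2 s) W)], whose mean is [exp (s V)] by the moment generating function. The
    remainder costs at most [256 s^2]. *)
Lemma expectation_exp_sqr_upper (s : R) : 0 <= s -> s <= 1 / 16 -> V <= 2 ->
  (\int[P]_w (expR (s * W w ^+ 2))%:E <= (expR (s * V + 1024 * s ^+ 2))%:E)%E.
Proof.
move=> s0 s1 V2; set r := Num.sqrt (2 * s).
have r2 : r ^+ 2 = 2 * s by rewrite sqr_sqrtr// mulr_ge0.
pose F w := ((1 / 2)%:E * ((expR (r * W w))%:E + (expR (- r * W w))%:E) +
   (128 * s ^+ 2)%:E * (expR (1 / 8 * W w ^+ 2))%:E)%E.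
have s20 := sqr_ge0 s.
apply: (@le_trans _ _ (\int[P]_w F w)%E).
  apply: ge0_le_integral => //.
  - by apply: emeasurable_funD; apply: emeasurable_funM => //; apply: emeasurable_funD.
  - move=> w _; rewrite /F -!EFinD lee_fin.
    have x0 : 0 <= s * W w ^+ 2 by rewrite mulr_ge0 ?sqr_ge0.
    have := expR_le_quad x0; have := expR_sqr_remainder (W w) s0 s1.
    have := cosh_ge (r * W w); rewrite exprMn r2 mulNr.
    have -> : 1 / 8 * W w ^+ 2 = W w ^+ 2 / 8 by field.
    lra.
rewrite /F ge0_integralD//; last 4 first.
- by move=> w _; rewrite -EFinD -EFinM lee_fin mulr_ge0// addr_ge0 ?expR_ge0.
- by apply: emeasurable_funM => //; apply: emeasurable_funD.
- by move=> w _; rewrite -EFinM lee_fin mulr_ge0 ?expR_ge0 ?mulr_ge0.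
- by apply: emeasurable_funM.
rewrite !ge0_integralZl//; last 3 first.
- by rewrite lee_fin mulr_ge0.
- by apply: emeasurable_funD.
- by move=> w _; rewrite -EFinD lee_fin addr_ge0 ?expR_ge0.
rewrite cosh_moment//.
have h : (\int[P]_w (expR (1 / 8 * W w ^+ 2))%:E <= 2%:E)%E.
  by apply: (normal_vector_exp_sqr gaussZ) => //; rewrite -/V; lra.
apply: (@le_trans _ _ ((1 / 2)%:E * (2 * expR (s * V))%:E + (128 * s ^+ 2)%:E * 2%:E)%E).
  by rewrite leeD2l// lee_wpmul2l// lee_fin mulr_ge0.
rewrite -!EFinM -EFinD lee_fin expRD.
have := expR_ge1Dx (1024 * s ^+ 2).
have : 1 <= expR (s * V) by rewrite -expR0 ler_expR mulr_ge0.
nra.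
Qed.

(** With [x = s W^2] and [cosh (sqrt (2 s) W) <= exp x], the linear terms cancel in [exp (- x) +
    cosh (sqrt (2 s) W) <= 2 + x^2 exp x]. The mean [exp (s V) >= 1 + s V] of the cosh is then moved
    to the right. *)
Lemma expectation_exp_sqr_lower (s : R) : 0 <= s -> s <= 1 / 16 -> V <= 2 ->
  (\int[P]_w (expR (- s * W w ^+ 2))%:E <= (expR (- s * V + 1024 * s ^+ 2))%:E)%E.
Proof.
move=> s0 s1 V2; set r := Num.sqrt (2 * s).
have r2 : r ^+ 2 = 2 * s by rewrite sqr_sqrtr// mulr_ge0.
pose C w := ((1 / 2)%:E * ((expR (r * W w))%:E + (expR (- r * W w))%:E))%E.
have s20 := sqr_ge0 s.
have mC : measurable_fun setT C.
  by apply: emeasurable_funM => //; apply: emeasurable_funD.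
have C0 w : (0 <= C w)%E.
  by rewrite /C -EFinD -EFinM lee_fin mulr_ge0// addr_ge0 ?expR_ge0.
have IC : (\int[P]_w C w = (expR (s * V))%:E)%E.
  rewrite /C ge0_integralZl//; last 2 first.
  - by apply: emeasurable_funD.
  - by move=> w _; rewrite -EFinD lee_fin addr_ge0 ?expR_ge0.
  by rewrite cosh_moment// -EFinM; congr EFin; field.
have h : (\int[P]_w (expR (1 / 8 * W w ^+ 2))%:E <= 2%:E)%E.
  by apply: (normal_vector_exp_sqr gaussZ) => //; rewrite -/V; lra.
have main : (\int[P]_w (expR (- s * W w ^+ 2))%:E + (expR (s * V))%:E <=
    2%:E + (256 * s ^+ 2)%:E * 2%:E)%E.
  rewrite -IC -ge0_integralD//.
  apply: (@le_trans _ _ (\int[P]_w (2%:E +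
      (256 * s ^+ 2)%:E * (expR (1 / 8 * W w ^+ 2))%:E))%E).
    apply: ge0_le_integral => //.
    - by move=> w _; rewrite adde_ge0// lee_fin expR_ge0.
    - by apply: emeasurable_funD.
    - by apply: emeasurable_funD => //; apply: emeasurable_funM.
    - move=> w _; rewrite /C -!EFinD lee_fin.
      have x0 : 0 <= s * W w ^+ 2 by rewrite mulr_ge0 ?sqr_ge0.
      have := expR_le_quad x0; have := expRN_le_quad x0.
      have := expR_sqr_remainder (W w) s0 s1.
      have := cosh_le (r * W w).
      have -> : (r * W w) ^+ 2 / 2 = s * W w ^+ 2 by rewrite exprMn r2; field.
      have : 1 <= expR (s * W w ^+ 2) by rewrite -expR0 ler_expR.
      move/(ler_wpM2l (sqr_ge0 (s * W w ^+ 2))).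
      have -> : 1 / 8 * W w ^+ 2 = W w ^+ 2 / 8 by field.
      rewrite !mulNr; lra.
  rewrite ge0_integralD//; last 2 first.
  - by move=> w _; rewrite -EFinM lee_fin mulr_ge0 ?expR_ge0 ?mulr_ge0.
  - by apply: emeasurable_funM.
  rewrite integral_cst_probability leeD2l// ge0_integralZl//.
    by rewrite lee_wpmul2l// lee_fin mulr_ge0.
  by rewrite lee_fin mulr_ge0.
rewrite -EFinM -EFinD in main.
have : (\int[P]_w (expR (- s * W w ^+ 2))%:E <=
   (2 + 256 * s ^+ 2 * 2 - expR (s * V))%:E)%E.
  by rewrite EFinB leeBrDr.
move=> /le_trans; apply; rewrite lee_fin.
have := expR_ge1Dx (s * V); have := expR_ge1Dx (- s * V + 1024 * s ^+ 2).
rewrite !mulNr; lra.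
Qed.

(** Pointwise [exp (s max (0, u)) <= 1 + exp (s u)], so the logarithm of the moment is of order
    [exp (- s th)]. A threshold [th] proportional to log(1/eta) makes it O(eta). *)
Lemma expectation_exp_tail (s th : R) : 0 <= s -> s * V <= 1 / 4 ->
  (\int[P]_w (expR (s * Num.max 0 (W w ^+ 2 - th)))%:E <=
   (expR (2 * expR (- (s * th))))%:E)%E.
Proof.
move=> s0 sV.
apply: (@le_trans _ _ (\int[P]_w (1%:E + (expR (- (s * th)))%:E * (expR (s * W w ^+ 2))%:E))%E).
  apply: ge0_le_integral => //.
  - apply/measurable_EFinP; apply: measurableT_comp => //; apply: measurable_funM => //.
    apply: measurable_maxr => //; apply: measurable_funB => //.
    exact: measurable_funX.
  - by apply: emeasurable_funD => //; apply: emeasurable_funM.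
  - move=> w _; rewrite -EFinM -EFinD -expRD lee_fin.
    have [h|h] := leP (W w ^+ 2 - th) 0.
      by rewrite mulr0 expR0 lerDl expR_ge0.
    have -> : s * (W w ^+ 2 - th) = - (s * th) + s * W w ^+ 2 by ring.
    by rewrite lerDr.
rewrite ge0_integralD//; last 1 first.
- by apply: emeasurable_funM.
rewrite integral_cst_probability ge0_integralZl//.
apply: (@le_trans _ _ (1%:E + (expR (- (s * th)))%:E * 2%:E)%E).
  rewrite leeD2l// lee_wpmul2l ?lee_fin ?expR_ge0//.
  exact: normal_vector_exp_sqr.
by rewrite -EFinM -EFinD lee_fin mulrC expR_ge1Dx.
Qed.

End sample_moments.

Lemma chernoff_sum (R : realType) (disp : measure_display) (T : measurableType disp)
    (P : probability T R) (n d : nat) (X : 'I_n -> T -> d.-tuple R)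
    (phi : d.-tuple R -> R) (b t : R) :
  (forall i, measurable_fun setT (X i)) -> independent P X -> measurable_fun setT phi ->
  (forall i, (\int[P]_w (expR (phi (X i w)))%:E <= (expR b)%:E)%E) ->
  measurable [set w | t <= \sum_(i < n) phi (X i w)] /\
  (P [set w | (t <= \sum_(i < n) phi (X i w))%R] <= (expR (n%:R * b - t))%:E)%E.
Proof.
move=> mX iX mphi hb; set A := [set w | _].
have mS : measurable_fun setT (fun w => \sum_(i < n) phi (X i w)).
  by apply: measurable_fun_bigsum => i; exact: measurableT_comp.
have mA : measurable A.
  have -> : A = (fun w => \sum_(i < n) phi (X i w)) @^-1` `[t, +oo[.
    by apply/seteqP; split=> w; rewrite /A/= in_itv/= andbT.
  by rewrite -[X in measurable X]setTI; exact: mS.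
split => //.
have E : (\int[P]_w (expR (\sum_(i < n) phi (X i w)))%:E <= (expR (n%:R * b))%:E)%E.
  under eq_integral => w _ do rewrite expR_sum.
  rewrite (@expectation_prod_indep _ _ _ _ _ P n X (fun _ x => expR (phi x)))//.
  - have -> : n%:R * b = \sum_(i < n) b by rewrite sumr_const card_ord mulr_natl.
    rewrite expR_sum -prodEFin.
    suff [_ h] : ((0 <= \prod_(i < n) \int[P]_w (expR (phi (X i w)))%:E)%E /\
      (\prod_(i < n) \int[P]_w (expR (phi (X i w)))%:E <= \prod_(i < n) (expR b)%:E)%E) by exact: h.
    elim/big_ind2: _ => [|x1 x2 y1 y2 [x10 x12] [y10 y12]|i _]; first by rewrite lexx lee01.
      by split; [exact: mule_ge0|exact: lee_pmul].
    by split; [apply: integral_ge0 => w _; rewrite lee_fin expR_ge0|exact: hb].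
  - by move=> i; apply: measurableT_comp.
  - by move=> i; apply: le_lt_trans (hb i) _; rewrite ltry.
have I := integral_indic P measurableT mA; rewrite setIT in I.
rewrite -I -(@lee_pmul2l _ (expR t)%:E) ?lte_fin ?expR_gt0//.
rewrite -ge0_integralZl//; last by apply/measurable_EFinP; exact: measurable_indic.
rewrite -EFinM -expRD.
have -> : t + (n%:R * b - t) = n%:R * b by ring.
apply: le_trans E; apply: ge0_le_integral => //.
- by apply: emeasurable_funM => //; apply/measurable_EFinP; exact: measurable_indic.
- by apply/measurable_EFinP; apply: measurableT_comp.
- move=> w _; rewrite -EFinM lee_fin indicE.
  case: (boolP (w \in A)) => [/set_mem wA|_]; last by rewrite mulr0 expR_ge0.
  by rewrite mulr1 ler_expR.
Qed.

(** * Concentration over the unit ball *)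

Lemma geometric_half_le2 (R : realType) (m : nat) : \sum_(k < m) (1 / 2 : R) ^+ k <= 2.
Proof.
suff -> : \sum_(k < m) (1 / 2 : R) ^+ k = 2 - 2 * (1 / 2) ^+ m.
  by rewrite gerBl mulr_ge0// exprn_ge0.
elim: m => [|m IH]; first by rewrite big_ord0 expr0; ring.
by rewrite big_ord_recr/= IH exprS; field.
Qed.

(* The points of the net are [z / (16 sqrt d)] with [z] integral and [|z|^2 <= 256 d]; giving
   [z] the weight [prod_j 2^(- |z_j|) >= 2^(- 256 d)] bounds their number by [2^(256 d) * 4^d].
   A coordinate of [z] is a sign and an absolute value. *)
Lemma lattice_net (R : realType) (d : nat) : (0 < d)%N ->
  exists (I : finType) (u : I -> 'I_d -> R),
  [/\ (#|I|%:R <= 2 ^+ (258 * d) :> R),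
      forall i, \sum_j u i j ^+ 2 <= 1
    & forall v : 'I_d -> R, \sum_j v j ^+ 2 <= 1 ->
      exists i, \sum_j (v j - u i j) ^+ 2 <= 1 / 256].
Proof.
move=> d0; pose N := (16 * d).+1.
pose S := {ffun 'I_d -> bool * 'I_N}.
pose small (z : S) := (\sum_j (z j).2 ^ 2 <= 256 * d)%N.
pose I := {z : S | small z}.
pose c : R := 16 * Num.sqrt d%:R.
have d0' : 0 < d%:R :> R by rewrite ltr0n.
have c0 : 0 < c by rewrite mulr_gt0// sqrtr_gt0.
have c2 : c ^+ 2 = 256 * d%:R by rewrite exprMn sqr_sqrtr ?ler0n//; ring.
pose u (z : I) j : R := (-1) ^+ (val z j).1 * ((val z j).2 : nat)%:R / c.
exists I, u; split.
- rewrite card_sig -sum1_card natr_sum.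
  rewrite -[leLHS]mul1r.
  have -> : 2 ^+ (258 * d) = 2 ^+ (256 * d) * 4 ^+ d :> R.
    have -> : (4 : R) = 2 ^+ 2 by rewrite expr2; ring.
    by rewrite -exprM -exprD -mulnDl.
  rewrite -ler_pdivrMl ?exprn_gt0// mul1r.
  apply: (@le_trans _ _ (\sum_(z : S) \prod_j (1 / 2 : R) ^+ (z j).2)).
    rewrite [leRHS](bigID small)/= mulr_sumr -[leLHS]addr0.
    apply: lerD; last by apply: sumr_ge0 => z _; apply: prodr_ge0 => j _; rewrite exprn_ge0.
    apply: ler_sum => z zs; rewrite mulr1 prodrXr -exprVn div1r.
    rewrite ler_wiXn2l ?invr_ge0 ?invf_le1 ?ler1n//.
    apply: leq_trans zs; apply: leq_sum => j _.
    by case: ((z j).2 : nat) => // k; rewrite expnS expn1 leq_pmulr.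
  rewrite -(bigA_distr_bigA (fun (_ : 'I_d) (bk : bool * 'I_N) => (1 / 2 : R) ^+ bk.2)).
  rewrite prodr_const card_ord; apply: lerXn2r; rewrite ?nnegrE//.
    by apply: sumr_ge0 => bk _; rewrite exprn_ge0.
  rewrite -(pair_bigA _ (fun (b : bool) (k : 'I_N) => (1 / 2 : R) ^+ k))/=.
  rewrite big_bool/=; have := @geometric_half_le2 R N; lra.
- move=> [z zs]; rewrite /u/=.
  under eq_bigr => j _ do rewrite !exprMn exprVn c2 -exprM mulnC exprM sqrrN expr1n expr1n mul1r.
  rewrite -mulr_suml ler_pdivrMr ?mulr_gt0// mul1r.
  rewrite (eq_bigr (fun j => ((z j).2 ^ 2)%:R)); last by move=> j _; rewrite natrX.
  by rewrite -natr_sum -natrM ler_nat.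
- move=> v v1; pose a j := c * v j.
  have tr j : (Num.truncn `|a j|)%:R <= `|a j| < (Num.truncn `|a j|).+1%:R.
    exact: truncn_itv.
  have a2 : \sum_j a j ^+ 2 <= 256 * d%:R.
    under eq_bigr => j _ do rewrite exprMn c2.
    by rewrite -mulr_sumr ler_piMr// mulr_ge0.
  have aN j : (Num.truncn `|a j| < N)%N.
    rewrite ltnS -(ler_nat R); have /andP[/le_trans + _] := tr j; apply.
    rewrite -(@ler_pXn2r _ 2) ?nnegrE// real_normK ?num_real//.
    apply: (@le_trans _ _ (\sum_j a j ^+ 2)).
      by rewrite (bigD1 j)//= lerDl sumr_ge0// => i _; exact: sqr_ge0.
    apply: le_trans a2 _; rewrite natrM exprMn.
    have : 1 <= d%:R :> R by rewrite ler1n.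
    have -> : (16%:R : R) ^+ 2 = 256 by ring.
    by move=> h; rewrite ler_wpM2l// expr2 ler_peMr.
  (* Rounding towards zero keeps [z] in the ball of squared radius [256 d]; each coordinate moves by
     at most 1, that is by [1 / c] after scaling, and [d / c^2 = 1 / 256]. *)
  pose z : S := [ffun j => (a j < 0, Ordinal (aN j))].
  have zs : small z.
    rewrite /small -(ler_nat R) natr_sum natrM.
    apply: le_trans a2; apply: ler_sum => j _; rewrite ffunE/= natrX.
    rewrite -(real_normK (num_real (a j))) lerXn2r ?nnegrE//.
    by have /andP[] := tr j.
  exists (exist _ z zs); rewrite /u/=.
  apply: (@le_trans _ _ (\sum_(j < d) (c ^+ 2)^-1)); last first.
    rewrite sumr_const card_ord c2 -[_ *+ d]mulr_natl le_eqVlt; apply/orP; left; apply/eqP.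
    by field; rewrite gt_eqF.
  apply: ler_sum => j _; rewrite ffunE/=.
  have -> : v j = (-1) ^+ (a j < 0)%R * `|a j| / c.
    by rewrite -numEsign /a mulrAC divff ?mul1r// gt_eqF.
  rewrite -mulrBl -mulrBr exprMn exprMn exprVn -exprM mulnC exprM sqrrN expr1n expr1n mul1r.
  rewrite ler_piMl ?invr_ge0 ?sqr_ge0//.
  have /andP[t1] := tr j; rewrite -natr1 => t2.
  by rewrite exprn_ile1 ?subr_ge0//; lra.
Qed.

Definition dot (R : realType) (d : nat) (u v : 'I_d -> R) : R := \sum_j u j * v j.

Definition sqnorm (R : realType) (d : nat) (v : 'I_d -> R) : R := \sum_j v j ^+ 2.

Section dot_theory.
Variables (R : realType) (d : nat).
Implicit Types (u v : 'I_d -> R) (c : R).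

Lemma sqnorm_ge0 v : 0 <= sqnorm v.
Proof. by apply: sumr_ge0 => j _; exact: sqr_ge0. Qed.

Lemma dotD u1 u2 v : dot (fun j => u1 j + u2 j) v = dot u1 v + dot u2 v.
Proof. by rewrite /dot -big_split; apply: eq_bigr => j _; rewrite mulrDl. Qed.

Lemma dotZ c u v : dot (fun j => c * u j) v = c * dot u v.
Proof. by rewrite /dot mulr_sumr; apply: eq_bigr => j _; rewrite mulrA. Qed.

Lemma sqnormZ c v : sqnorm (fun j => c * v j) = c ^+ 2 * sqnorm v.
Proof. by rewrite /sqnorm mulr_sumr; apply: eq_bigr => j _; rewrite exprMn. Qed.

Lemma dot_sqr_le u v : dot u v ^+ 2 <= sqnorm u * sqnorm v.
Proof. exact: cauchy_schwarz. Qed.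

End dot_theory.

(* Every supremum over the unit ball reappears, with a small factor, when the point of the
   ball is written as a point of the net plus a remainder. *)
Section net_to_ball.
Context (R : realType) (n d : nat) (I : finType) (u : I -> 'I_d -> R).
Hypothesis net : forall v : 'I_d -> R, sqnorm v <= 1 ->
  exists i, \sum_j (v j - u i j) ^+ 2 <= 1 / 256.
Variable g : 'I_n -> 'I_d -> R.
Implicit Types v : 'I_d -> R.

Let net_split v : sqnorm v <= 1 ->
  exists i r, v = (fun j => u i j + (1 / 16) * r j) /\ sqnorm r <= 1.
Proof.
move=> /net[i hi]; exists i, (fun j => 16 * (v j - u i j)); split.
  by apply/funext => j; field.
by rewrite (sqnormZ 16 (fun j => v j - u i j)) /sqnorm; lra.
Qed.

Let dot_bounded x v : sqnorm v <= 1 -> dot v x ^+ 2 <= sqnorm x.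
Proof.
move=> v1; apply: le_trans (dot_sqr_le v x) _.
by rewrite ler_piMl// sqnorm_ge0.
Qed.

Lemma linear_net_to_ball (x : 'I_d -> R) t : (forall i, dot (u i) x <= t) ->
  forall v, sqnorm v <= 1 -> dot v x <= 16 / 15 * t.
Proof.
have -> : 16 / 15 * t = t / (1 - 1 / 16) by rewrite (_ : 1 - 1 / 16 = 15 / 16 :> R); field.
move=> ut; apply: sup_contraction; first lra.
  exists (sqnorm x + 1) => v v1; have := dot_bounded x v1; nra.
move=> q hq v /net_split[i [r [-> r1]]]; rewrite dotD dotZ.
have := ut i; have := hq _ r1; lra.
Qed.

(** Since [u + r / 16] is the midpoint of [2 u] and [r / 8], and the excess over [th] is a convex
    function of the projection, half the bound comes from the doubled net point and half from a
    point of the ball. *)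
Lemma tail_net_to_ball th t :
  (forall k, \sum_i Num.max 0 (dot (fun j => 2 * u k j) (g i) ^+ 2 - th) <= t) ->
  forall v, sqnorm v <= 1 -> \sum_i Num.max 0 (dot v (g i) ^+ 2 - th) <= t.
Proof.
move=> ut; have -> : t = (t / 2) / (1 - 1 / 2).
  by rewrite (_ : 1 - 1 / 2 = 1 / 2 :> R); field.
apply: sup_contraction; first lra.
  exists (\sum_i (sqnorm (g i) + `|th|)) => v v1; apply: ler_sum => i _.
  have := dot_bounded (g i) v1; have := sqr_ge0 (dot v (g i)); have := normr_ge0 th.
  have := ler_norm (- th); rewrite normrN; have [] := leP (dot v (g i) ^+ 2 - th) 0; lra.
move=> q hq v /net_split[k [r [-> r1]]].
have r2 : sqnorm (fun j => (1 / 8) * r j) <= 1 by rewrite sqnormZ; lra.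
have h1 := ut k; have h2 := hq _ r2.
have : \sum_i Num.max 0 (dot (fun j => u k j + 1 / 16 * r j) (g i) ^+ 2 - th) <=
   \sum_i (1 / 2 * Num.max 0 (dot (fun j => 2 * u k j) (g i) ^+ 2 - th) +
           1 / 2 * Num.max 0 (dot (fun j => 1 / 8 * r j) (g i) ^+ 2 - th)).
  apply: ler_sum => i _; rewrite dotD !dotZ.
  set a := dot _ _; set b := dot _ _.
  have := sqr_ge0 (2 * a - 1 / 8 * b).
  set p := (2 * a) ^+ 2 - th; set p' := (1 / 8 * b) ^+ 2 - th.
  have m1 : 0 <= Num.max 0 p by rewrite le_max lexx.
  have m2 : 0 <= Num.max 0 p' by rewrite le_max lexx.
  have m3 : p <= Num.max 0 p by rewrite le_max lexx orbT.
  have m4 : p' <= Num.max 0 p' by rewrite le_max lexx orbT.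
  move: m1 m2 m3 m4; rewrite ge_max /p /p' => m1 m2 m3 m4 sq.
  by apply/andP; split; nra.
rewrite big_split/= -!mulr_sumr; lra.
Qed.

Let Q v := \sum_i dot v (g i) ^+ 2 - n%:R * sqnorm v.

Let Q_polar v r : Q (fun j => v j + (1 / 16) * r j) =
  Q v + (1 / 256) * Q r + (1 / 8) * (Q (fun j => (1 / 2) * (v j + r j)) -
                            Q (fun j => (1 / 2) * (v j + - 1 * r j))).
Proof.
have S1 : \sum_i dot (fun j => v j + 1 / 16 * r j) (g i) ^+ 2 =
  \sum_i (dot v (g i) ^+ 2 + 1 / 256 * dot r (g i) ^+ 2 +
   1 / 8 * (dot (fun j => 1 / 2 * (v j + r j)) (g i) ^+ 2
       - dot (fun j => 1 / 2 * (v j + -1 * r j)) (g i) ^+ 2)).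
  by apply: eq_bigr => i _; rewrite !(dotD, dotZ); field.
have S2 : sqnorm (fun j => v j + 1 / 16 * r j) =
   sqnorm v + 1 / 256 * sqnorm r + 1 / 8 * (sqnorm (fun j => 1 / 2 * (v j + r j)) -
      sqnorm (fun j => 1 / 2 * (v j + -1 * r j))).
  rewrite /sqnorm -sumrB !mulr_sumr -!big_split/=.
  by apply: eq_bigr => j _; field.
rewrite /Q S1 S2 !big_split/= -!mulr_sumr sumrB; ring.
Qed.

(** The net point is expanded around [v], and the cross term is polarised into [Q] at the half sum
    and the half difference of [v] and the remainder, which lie in the ball. The resulting factor
    [1 / 256 + 2 / 8] is below 1/2. *)
Lemma quadratic_net_to_ball t : (forall k, `|Q (u k)| <= t) ->
  forall v, sqnorm v <= 1 -> `|\sum_i dot v (g i) ^+ 2 - n%:R * sqnorm v| <= 2 * t.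
Proof.
have -> : 2 * t = t / (1 - 1 / 2) by rewrite (_ : 1 - 1 / 2 = 1 / 2 :> R); field.
move=> ut; apply: sup_contraction; first lra.
  exists (\sum_i sqnorm (g i) + n%:R) => v v1; rewrite ler_norml.
  have h1 : \sum_i dot v (g i) ^+ 2 <= \sum_i sqnorm (g i).
    by apply: ler_sum => i _; exact: dot_bounded.
  have h2 : 0 <= \sum_i dot v (g i) ^+ 2 by apply: sumr_ge0 => i _; exact: sqr_ge0.
  have h3 : n%:R * sqnorm v <= n%:R by rewrite ler_piMr.
  have h4 : 0 <= n%:R * sqnorm v by rewrite mulr_ge0 ?sqnorm_ge0.
  have h5 : 0 <= n%:R :> R by [].
  by apply/andP; split; lra.
move=> q hq v /[dup] v1 /net_split[k [r [E r1]]].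
have uE : u k = (fun j => v j + (1 / 16) * (- 1 * r j)).
  by rewrite E; apply/funext => j; field.
have nr1 : sqnorm (fun j => -1 * r j) <= 1 by rewrite sqnormZ sqrrN expr1n mul1r.
have half (a b : 'I_d -> R) : sqnorm a <= 1 -> sqnorm b <= 1 ->
    sqnorm (fun j => 1 / 2 * (a j + b j)) <= 1.
  move=> a1 b1; rewrite sqnormZ.
  suff : sqnorm (fun j => a j + b j) <= 2 * sqnorm a + 2 * sqnorm b by lra.
  rewrite /sqnorm !mulr_sumr -big_split/=; apply: ler_sum => j _.
  have := sqr_ge0 (a j - b j); nra.
have := Q_polar v (fun j => - 1 * r j).
have := ut k; rewrite uE.
have := hq _ nr1; have := hq _ (half _ _ v1 nr1).
have h3 : sqnorm (fun j => -1 * (-1 * r j)) <= 1.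
  by rewrite sqnormZ sqrrN expr1n mul1r.
have := hq _ (half _ _ v1 h3); rewrite -/(Q _) -/(Q _) -/(Q _) -/(Q _).
rewrite !ler_norml => /andP[? ?] /andP[? ?] /andP[? ?] /andP[? ?] ?.
by apply/andP; split; lra.
Qed.

End net_to_ball.

Lemma probability_bigsetU (R : realType) (disp : measure_display) (T : measurableType disp)
    (P : probability T R) (I : finType) (A : I -> set T) (b : R) :
  (forall i, measurable (A i)) -> (forall i, (P (A i) <= b%:E)%E) ->
  measurable (\big[setU/set0]_i A i) /\ (P (\big[setU/set0]_i A i) <= (#|I|%:R * b)%:E)%E.
Proof.
move=> mA Ab.
suff [mU PU] : measurable (\big[setU/set0]_i A i) /\
    (P (\big[setU/set0]_i A i) <= (\sum_(i : I) b)%:E)%E.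
  by split=> //; apply: le_trans PU _; rewrite sumr_const mulr_natl.
elim/big_ind2: _ => [|A1 x1 A2 x2 [m1 h1] [m2 h2]|i _]; last by split.
  by rewrite measure0; split.
split; first exact: measurableU.
by apply: le_trans (measureU2 _ m1 m2) _; rewrite EFinD leeD.
Qed.

(** Four families of Chernoff events over the net: squares from above and from below, excess of
    squares over [th], linear forms. The summed excess replaces a union bound over subsets of the
    sample, because it controls all weights of small mass at once. The parameters [s1] and [s4] are
    left free, to be tuned to rho. *)
Lemma gaussian_concentration (R : realType) (disp : measure_display) (T : measurableType disp)
    (P : probability T R) (n d : nat) (mu : 'rV[R]_d) (X : 'I_n -> T -> d.-tuple R)
    (s1 s4 th L beta : R) :
  (0 < d)%N -> (forall i, normal_vector P mu (X i)) -> independent P X ->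
  0 < s1 <= 1 / 16 -> 0 < s4 -> 4 * (2 ^+ (258 * d) * expR (- L)) <= beta ->
  exists E : set T, [/\ measurable E, (P E <= beta%:E)%E &
    forall w, ~ E w -> forall v : 'I_d -> R, sqnorm v <= 1 ->
    let g i j := tnth (X i w) j - mu ord0 j in
    [/\ `|\sum_i dot v (g i) ^+ 2 - n%:R * sqnorm v| <= 2 * (n%:R * 1024 * s1 + L / s1),
        \sum_i Num.max 0 (dot v (g i) ^+ 2 - th) <=
          16 * (2 * n%:R * expR (- (1 / 16 * th)) + L)
      & dot v (fun j => \sum_i g i j) <= 16 / 15 * (n%:R * s4 + L / s4)]].
Proof.
move=> d0 gX iX /andP[s10 s1le] s40 Lbeta.
have [I [u [cI u1 net]]] := @lattice_net R d d0.
have mX i : measurable_fun setT (X i) by exact: (gX i).1.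
pose V k := sqnorm (u k).
have V0 k : 0 <= V k by exact: sqnorm_ge0.
have V2 k : V k <= 2 by have := u1 k; rewrite /V /sqnorm; lra.
pose D k (x : d.-tuple R) := centered_dot mu (u k) x.
have mD k : measurable_fun setT (D k) by exact: measurable_centered_dot.
pose phi1 k x := s1 * D k x ^+ 2.
pose phi2 k x := - s1 * D k x ^+ 2.
(* The points are doubled for [tail_net_to_ball]; their squared norm is at most 4, so 1/16 meets the
   condition [s * V <= 1 / 4] of [expectation_exp_tail]. *)
pose phi3 k x := 1 / 16 * Num.max 0 (centered_dot mu (fun j => 2 * u k j) x ^+ 2 - th).
pose phi4 k x := s4 * D k x.
pose b1 k := s1 * V k + 1024 * s1 ^+ 2.
pose b2 k := - s1 * V k + 1024 * s1 ^+ 2.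
pose b3 : R := 2 * expR (- (1 / 16 * th)).
pose b4 := s4 ^+ 2.
have nat_event (phi : I -> d.-tuple R -> R) (b : I -> R) :
  (forall k, measurable_fun setT (phi k)) ->
  (forall k i, (\int[P]_w (expR (phi k (X i w)))%:E <= (expR (b k))%:E)%E) ->
  exists E : set T, [/\ measurable E, (P E <= (2 ^+ (258 * d) * expR (- L))%:E)%E &
    forall w, ~ E w -> forall k, \sum_i phi k (X i w) <= n%:R * b k + L].
  move=> mphi hphi.
  pose A k := [set w | n%:R * b k + L <= \sum_i phi k (X i w)].
  have hA k := chernoff_sum (n%:R * b k + L) mX iX (mphi k) (hphi k).
  have hA' k : (P (A k) <= (expR (- L))%:E)%E.
    by apply: le_trans (hA k).2 _; rewrite lee_fin ler_expR; lra.
  have [mE PE] := probability_bigsetU (fun k => (hA k).1) hA'.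
  exists (\big[setU/set0]_k A k); split => //.
    by apply: le_trans PE _; rewrite lee_fin ler_wpM2r ?expR_ge0.
  move=> w /[dup] nE _ k; rewrite leNgt; apply/negP => /ltW h; apply: nE.
  by rewrite (bigD1 k)//=; left.
have [|k i|E1 [mE1 PE1 hE1]] := nat_event phi1 b1.
- by move=> k; apply: measurable_funM => //; exact: measurable_funX.
- exact: (expectation_exp_sqr_upper (gX i)) (ltW s10) s1le (V2 k).
have [|k i|E2 [mE2 PE2 hE2]] := nat_event phi2 b2.
- by move=> k; apply: measurable_funM => //; exact: measurable_funX.
- exact: (expectation_exp_sqr_lower (gX i)) (ltW s10) s1le (V2 k).
have [|k i|E3 [mE3 PE3 hE3]] := nat_event phi3 (fun _ => b3).
- move=> k; apply: measurable_funM => //; apply: measurable_maxr => //.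
  apply: measurable_funB => //; apply: measurable_funX; exact: measurable_centered_dot.
- apply: (expectation_exp_tail (gX i)) => //.
  by rewrite -/(sqnorm _) sqnormZ; have := u1 k; rewrite -/(sqnorm _); lra.
have [|k i|E4 [mE4 PE4 hE4]] := nat_event phi4 (fun _ => b4).
- by move=> k; exact: measurable_funM.
- rewrite (normal_vector_mgf (gX i)) lee_fin ler_expR -/(sqnorm _) -/(V k).
  by rewrite /b4; have := V2 k; have := sqr_ge0 s4; nra.
exists (E1 `|` E2 `|` (E3 `|` E4)); split.
- by do !apply: measurableU.
- have m12 := measurableU _ _ mE1 mE2; have m34 := measurableU _ _ mE3 mE4.
  apply: le_trans (measureU2 _ m12 m34) _.
  have h12 := le_trans (measureU2 P mE1 mE2) (leeD PE1 PE2).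
  have h34 := le_trans (measureU2 P mE3 mE4) (leeD PE3 PE4).
  apply: le_trans (leeD h12 h34) _; rewrite -!EFinD lee_fin; lra.
move=> w nE v v1 g.
have {}hE1 := hE1 w (fun h => nE (or_introl (or_introl h))).
have {}hE2 := hE2 w (fun h => nE (or_introl (or_intror h))).
have {}hE3 := hE3 w (fun h => nE (or_intror (or_introl h))).
have {}hE4 := hE4 w (fun h => nE (or_intror (or_intror h))).
split.
- apply: le_trans (quadratic_net_to_ball (t := n%:R * 1024 * s1 + L / s1) net _ v1) _ => //.
  move=> k; rewrite ler_norml; apply/andP; split.
    have := hE2 k; rewrite -mulr_sumr /b2 -/(V k) => h.
    rewrite lerNl -(ler_pM2l s10).
    have -> : s1 * (n%:R * 1024 * s1 + L / s1) = n%:R * (1024 * s1 ^+ 2) + L.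
      by field; rewrite gt_eqF.
    rewrite /D /centered_dot /dot in h *; lra.
  have := hE1 k; rewrite -mulr_sumr /b1 -/(V k) => h.
  rewrite -(ler_pM2l s10).
  have -> : s1 * (n%:R * 1024 * s1 + L / s1) = n%:R * (1024 * s1 ^+ 2) + L.
    by field; rewrite gt_eqF.
  rewrite /D /centered_dot /dot in h *; lra.
- apply: le_trans (tail_net_to_ball (t := 16 * (2 * n%:R * expR (- (1 / 16 * th)) + L)) net _ v1) _ => //.
  move=> k; have := hE3 k; rewrite -mulr_sumr /b3 /centered_dot /dot; lra.
- apply: le_trans (linear_net_to_ball (t := n%:R * s4 + L / s4) net _ v1) _.
    move=> k; have := hE4 k; rewrite -mulr_sumr => h.
    rewrite -(ler_pM2l s40).
    have -> : s4 * (n%:R * s4 + L / s4) = n%:R * b4 + L.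
      by rewrite /b4; field; rewrite gt_eqF.
    apply: le_trans h; rewrite ler_pM2l//.
    rewrite /dot /D /centered_dot exchange_big/=.
    by apply: ler_sum => j _; rewrite mulr_sumr.
  by [].
Qed.

(** * Powers of positive semidefinite matrices *)

Section psd_matrices.
Variables (R : realType) (d : nat).
Implicit Types (A M : 'M[R]_d).

(** Testing against rectangular [X] gives one Cauchy-Schwarz inequality for both quadratic forms
    ([X] a row) and traces ([X] the identity). *)
Definition psd M := M^T = M /\ forall p (X : 'M[R]_(p, d)), 0 <= \tr (X *m M *m X^T).

Lemma psd_cauchy_schwarz M p (X Y : 'M[R]_(p, d)) : psd M ->
  \tr (X *m M *m Y^T) ^+ 2 <= \tr (X *m M *m X^T) * \tr (Y *m M *m Y^T).
Proof.
move=> [Msym M0]; apply: discriminant_le0; first exact: M0.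
move=> t; have := M0 _ (X - t *: Y).
have -> : (X - t *: Y)^T = X^T - t *: Y^T by rewrite linearB linearZ.
have YX : \tr (Y *m M *m X^T) = \tr (X *m M *m Y^T).
  by rewrite -mxtrace_tr !trmx_mul trmxK Msym mulmxA.
rewrite !(mulmxBl, mulmxBr) -!(scalemxAl, scalemxAr) !(linearB, linearZ)/= YX.
by rewrite /GRing.scale/=; congr (_ <= _); ring.
Qed.

Lemma mxtrace_mul_trmx p (X : 'M[R]_(p, d)) : \tr (X *m X^T) = \sum_r \sum_j X r j ^+ 2.
Proof.
by apply: eq_bigr => r _; rewrite mxE; apply: eq_bigr => j _; rewrite mxE expr2.
Qed.

Lemma psd1 : psd 1%:M.
Proof.
split=> [|p X]; first exact: trmx1.
rewrite mulmx1 mxtrace_mul_trmx; apply: sumr_ge0 => r _; apply: sumr_ge0 => j _.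
exact: sqr_ge0.
Qed.

Definition mxpow A k := iter k (fun B => B *m A) (1%:M : 'M[R]_d).

Lemma mxpowD A a b : mxpow A (a + b) = mxpow A a *m mxpow A b.
Proof.
elim: b => [|b IH]; first by rewrite addn0 mulmx1.
by rewrite addnS /= -/(mxpow A (a + b)) IH mulmxA.
Qed.

Lemma mxpow1 A : mxpow A 1 = A.
Proof. by rewrite /mxpow/= mul1mx. Qed.

Lemma trmx_mxpow A k : A^T = A -> (mxpow A k)^T = mxpow A k.
Proof.
move=> Asym; elim: k => [|k IH]; first exact: trmx1.
by rewrite [in RHS](mxpowD A 1 k) mxpow1 /= -/(mxpow A k) trmx_mul IH Asym.
Qed.

Variable A : 'M[R]_d.
Hypothesis psdA : psd A.

(** These are the moments of the spectral measure of [A] seen from [V]. Their log-convexity does the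
    work of a diagonalisation. *)
Definition moment p (V : 'M[R]_(p, d)) k := \tr (V *m mxpow A k *m V^T).

Let momentE p (V : 'M[R]_(p, d)) a b c :
  \tr (V *m mxpow A a *m mxpow A b *m (V *m mxpow A c)^T) = moment V (a + b + c).
Proof. by rewrite trmx_mul trmx_mxpow ?psdA.1// /moment !mxpowD !mulmxA. Qed.

Lemma moment_log_convex p (V : 'M[R]_(p, d)) k :
  moment V k.+1 ^+ 2 <= moment V k * moment V k.+2.
Proof.
(* Taking for [b] the parity of [k], only the forms 1 and [A] are needed, and no square root of
   [A]. *)
have [b [l [bE ->]]] : exists b l, psd (mxpow A b) /\ k = (l + b + l)%N.
  exists (odd k), k./2; split.
    by case: (odd k); rewrite /= ?mul1mx; [exact: psdA|exact: psd1].
  by rewrite -[LHS]odd_double_half -addnn; case: (odd k); rewrite /=; lia.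
have := psd_cauchy_schwarz (V *m mxpow A l) (V *m mxpow A l.+1) bE.
rewrite !momentE.
by rewrite (_ : (l + b + l.+1 = (l + b + l).+1)%N) 1?(_ : (l.+1 + b + l.+1 = (l + b + l).+2)%N); lia.
Qed.

Lemma moment_even p (V : 'M[R]_(p, d)) l :
  moment V (l + l) = \sum_r \sum_j (V *m mxpow A l) r j ^+ 2.
Proof. by rewrite -mxtrace_mul_trmx trmx_mul trmx_mxpow ?psdA.1// /moment mxpowD !mulmxA. Qed.

Lemma moment_ge0 p (V : 'M[R]_(p, d)) k : 0 <= moment V k.
Proof.
have [b [l [bE ->]]] : exists b l, psd (mxpow A b) /\ k = (l + b + l)%N.
  exists (odd k), k./2; split.
    by case: (odd k); rewrite /= ?mul1mx; [exact: psdA|exact: psd1].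
  by rewrite -[LHS]odd_double_half -addnn; case: (odd k); rewrite /=; lia.
by rewrite -momentE; exact: bE.2.
Qed.

End psd_matrices.

Section log_convex_sequences.
Variables (R : realType) (s : nat -> R).
Hypothesis s_ge0 : forall k, 0 <= s k.
Hypothesis s_log_convex : forall k, s k.+1 ^+ 2 <= s k * s k.+2.

(** Consecutive ratios of a log-convex sequence increase: the first one bounds growth from below
    here, and the last one bounds it from above in [log_convex_upper]. *)
Lemma log_convex_lower N : 0 < s 0%N -> s 0%N * (s 1%N / s 0%N) ^+ N <= s N.
Proof.
move=> s00; set q := s 1%N / s 0%N; have q0 : 0 <= q by rewrite divr_ge0.
have ratio k : q * s k <= s k.+1.
  elim: k => [|k IH]; first by rewrite /q divfK// gt_eqF.
  have [sk0|sk] := eqVneq (s k) 0.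
    have := s_log_convex k; rewrite sk0 mul0r => h.
    by have -> : s k.+1 = 0; [apply/eqP; rewrite -sqrf_eq0 eq_le h sqr_ge0|rewrite mulr0].
  have skp : 0 < s k by rewrite lt_def sk s_ge0.
  rewrite -(ler_pM2l skp); apply: le_trans (s_log_convex k).
  by rewrite mulrA (mulrC (s k)) expr2 ler_wpM2r.
elim: N => [|N IH]; first by rewrite expr0 mulr1.
by apply: le_trans (ratio N); rewrite exprS mulrCA ler_wpM2l.
Qed.

Lemma log_convex_upper N : 0 < s N -> s N <= s 0%N * (s N.+1 / s N) ^+ N.
Proof.
move=> sN; set r := s N.+1 / s N; have r0 : 0 <= r by rewrite divr_ge0.
have ratio k : (k <= N)%N -> 0 < s (N - k)%N /\ s (N - k).+1 <= r * s (N - k)%N.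
  elim: k => [_|k IH kN]; first by rewrite subn0 /r divfK// gt_eqF.
  have [p h] := IH (ltnW kN).
  have E : (N - k = (N - k.+1).+1)%N by lia.
  rewrite E in p h; have lc := s_log_convex (N - k.+1).
  have p' : 0 < s (N - k.+1)%N.
    rewrite lt_def s_ge0 andbT; apply/eqP => z; move: lc; rewrite z mul0r.
    by rewrite leNgt exprn_gt0.
  split=> //; rewrite -(ler_pM2r p) -expr2; apply: le_trans lc _.
  by rewrite (mulrC r) -mulrA ler_wpM2l.
suff main k : (k <= N)%N -> s k <= s 0%N * r ^+ k by exact: main.
elim: k => [_|k IH kN]; first by rewrite expr0 mulr1.
have [_] := ratio (N - k)%N (leq_subr _ _); rewrite subKn; last exact: ltnW.
move=> h; apply: le_trans h _; rewrite exprS mulrCA ler_wpM2l//.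
exact/IH/ltnW.
Qed.

End log_convex_sequences.

(* With [N = 2 p]: [(v A v^T / |v|^2)^N <= tr (A^N) <= d * rho^N] for the ratio [rho] of traces
   on the right, and [d < (1 + 1/n)^N] by Bernoulli. *)
Lemma rayleigh_le_trace_ratio (R : realType) (n d p : nat) (A : 'M[R]_d) (v : 'rV[R]_d) :
  (0 < n)%N -> (n * d < p)%N -> psd A ->
  \tr (v *m A *m v^T) <= (moment A 1%:M (p + p).+1 / moment A 1%:M (p + p)) *
    (1 + n%:R^-1) * \tr (v *m v^T).
Proof.
move=> n0 ndp psdA; set N := (p + p)%N; set t := moment A 1%:M.
have E1 : \tr (v *m A *m v^T) = moment A v 1 by rewrite /moment mxpow1.
have E0 : \tr (v *m v^T) = moment A v 0 by rewrite /moment mulmx1.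
rewrite E1 E0; set s := moment A v.
have s_ge0 k : 0 <= s k by exact: moment_ge0.
have t_ge0 k : 0 <= t k by exact: moment_ge0.
have s_lc k : s k.+1 ^+ 2 <= s k * s k.+2 by exact: moment_log_convex.
have t_lc k : t k.+1 ^+ 2 <= t k * t k.+2 by exact: moment_log_convex.
have n0' : 0 < n%:R :> R by rewrite ltr0n.
set b := 1 + n%:R^-1; have b0 : 0 < b by rewrite ltr_wpDr ?invr_ge0.
have [s00|s0] := eqVneq (s 0%N) 0.
  rewrite s00 mulr0; have := s_lc 0%N; rewrite s00 mul0r => h.
  have /eqP : s 1%N ^+ 2 = 0 by apply/eqP; rewrite eq_le h sqr_ge0.
  by rewrite sqrf_eq0 => /eqP ->.
have s0p : 0 < s 0%N by rewrite lt_def s0 s_ge0.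
(* With [N = 2 p] this is [|v A^p|^2 <= |v|^2 |A^p|^2] for the Frobenius norm, and
   [|A^p|^2 = tr (A^N)]. *)
have sN : s N <= s 0%N * t N.
  rewrite /s /t !moment_even//.
  have -> : moment A v 0 = \sum_k v ord0 k ^+ 2.
    by rewrite -E0 mxtrace_mul_trmx big_ord1.
  rewrite big_ord1 (exchange_big _ _ _ _ _ (fun r j => (1%:M *m mxpow A p) r j ^+ 2)) mulr_sumr.
  apply: ler_sum => j _; rewrite mul1mx mxE; exact: cauchy_schwarz.
have sl := le_trans (log_convex_lower s_ge0 s_lc N s0p) sN.
rewrite ler_pM2l// in sl.
rewrite -ler_pdivrMr//.
have q0 : 0 <= s 1%N / s 0%N by rewrite divr_ge0.
have [tN0|tN] := eqVneq (t N) 0.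
  rewrite tN0 invr0 mulr0 mul0r; move: sl; rewrite tN0 => h.
  have /eqP : (s 1%N / s 0%N) ^+ N = 0 by apply/eqP; rewrite eq_le h exprn_ge0.
  by rewrite expf_eq0 => /andP[_ /eqP ->].
have tNp : 0 < t N by rewrite lt_def tN t_ge0.
have := le_trans sl (log_convex_upper t_ge0 t_lc tNp).
have -> : t 0%N = d%:R by rewrite /t /moment !mul1mx trmx1 mxtrace1.
set r := t N.+1 / t N => h.
have r0 : 0 <= r by rewrite divr_ge0.
have bern : d%:R <= b ^+ N.
  have bernoulli k : 1 + k%:R * n%:R^-1 <= b ^+ k.
    elim: k => [|k IH]; first by rewrite mul0r addr0 expr0.
    rewrite exprS; apply: le_trans (ler_wpM2l (ltW b0) IH).
    rewrite /b -natr1 mulrDl mul1r.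
    have : 0 <= n%:R^-1 * (k%:R * n%:R^-1) :> R by rewrite !mulr_ge0 ?invr_ge0.
    lra.
  apply: le_trans (bernoulli N).
  have : d%:R <= N%:R * n%:R^-1 :> R.
    by rewrite ler_pdivlMr// -natrM ler_nat /N; lia.
  lra.
have {}h : (s 1%N / s 0%N) ^+ N <= (r * b) ^+ N.
  by apply: le_trans h _; rewrite [leRHS]exprMn [leRHS]mulrC ler_wpM2r ?exprn_ge0.
have N0 : (0 < N)%N by rewrite /N; lia.
by move: h; rewrite ler_pXn2r// nnegrE mulr_ge0// ltW.
Qed.

(** * The filter on a stable sample *)

Section statistics.
Variables (R : realType) (n d : nat) (y : 'I_n -> 'I_d -> R).
Implicit Types (w : 'I_n -> R) (v : 'I_d -> R).

Definition centroid j := n%:R^-1 * \sum_i y i j.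
Definition wsum w := \sum_i w i.
Definition wmean w j := (\sum_i w i * y i j) / wsum w.
Definition weighting w := forall i, 0 <= w i <= n%:R^-1.

Definition wcov w : 'M[R]_d :=
  \matrix_(j, k) \sum_i w i * (y i j - wmean w j) * (y i k - wmean w k).

Definition cov_power w := mxpow (wcov w) (n * d).+1.

Definition score w i :=
  \sum_r dot (fun k => cov_power w r k) (fun k => y i k - wmean w k) ^+ 2.

(* An estimate of the top eigenvalue of [wcov w]. *)
Definition spread w := (\sum_i w i * score w i) / \sum_r \sum_k cov_power w r k ^+ 2.

(** The rank of [i] counts all points scoring at least as much, ties included, so that at most
    [2 eta n] points are outlying whatever the ties. *)
Definition outlying (eta : R) w i :=
  \sum_k ((score w i <= score w k)%R : nat)%:R <= 2 * eta * n%:R.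

Definition trimmed_score eta w i := if outlying eta w i then score w i else 0.

(** [P] is the largest trimmed score among the points of positive weight. If it is 0, division by
    zero yields 0 and the weights do not change. *)
Definition reweighted eta w w' := exists P,
  [/\ forall i, 0 < w i -> trimmed_score eta w i <= P,
      P = 0 \/ exists2 i, 0 < w i & P = trimmed_score eta w i
    & forall i, w' i = w i - w i * trimmed_score eta w i / P].

Lemma score_ge0 w i : 0 <= score w i.
Proof. by apply: sumr_ge0 => r _; exact: sqr_ge0. Qed.

Lemma trimmed_score_ge0 eta w i : 0 <= trimmed_score eta w i.
Proof. by rewrite /trimmed_score; case: ifP => // _; exact: score_ge0. Qed.

Lemma reweighted_bounds eta w w' : weighting w -> reweighted eta w w' ->
  forall i, 0 <= w' i <= w i.
Proof.
move=> hw [P [Pmax P0 w'E]] i; have /andP[wi0 _] := hw i; rewrite w'E.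
have [->|wi] := eqVneq (w i) 0; first by rewrite !mul0r subrr lexx.
have wip : 0 < w i by rewrite lt_def wi.
have fP := Pmax i wip; have f0 := trimmed_score_ge0 eta w i.
have P0' : 0 <= P := le_trans f0 fP.
rewrite gerBl subr_ge0 -mulrA; apply/andP; split; last by rewrite mulr_ge0// divr_ge0.
have [->|Pn0] := eqVneq P 0; first by rewrite invr0 !mulr0.
by rewrite ler_piMr// ler_pdivrMr ?mul1r// lt_def Pn0.
Qed.

Lemma reweighted_weighting eta w w' : weighting w -> reweighted eta w w' -> weighting w'.
Proof.
move=> hw hr i; have /andP[-> h] := reweighted_bounds hw hr i.
by have /andP[_] := hw i; exact: le_trans.
Qed.

Lemma mxtrace_wcov w p (X : 'M[R]_(p, d)) : \tr (X *m wcov w *m X^T) =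
  \sum_i w i * \sum_r dot (fun k => X r k) (fun k => y i k - wmean w k) ^+ 2.
Proof.
under [RHS]eq_bigr => i _ do rewrite mulr_sumr.
rewrite exchange_big/=; apply: eq_bigr => r _; rewrite mxE.
transitivity (\sum_k \sum_j \sum_i w i *
   (X r j * (y i j - wmean w j) * (X r k * (y i k - wmean w k)))).
  apply: eq_bigr => k _; rewrite !mxE mulr_suml; apply: eq_bigr => j _.
  by rewrite mxE mulr_sumr mulr_suml; apply: eq_bigr => i _; ring.
under [LHS]eq_bigr => k _ do rewrite exchange_big/=.
rewrite exchange_big/=; apply: eq_bigr => i _.
rewrite expr2 /dot mulr_suml exchange_big/=.
rewrite mulr_sumr; apply: eq_bigr => j _; rewrite -mulrA !mulr_sumr.
by apply: eq_bigr => k _; ring.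
Qed.

Lemma psd_wcov w : weighting w -> psd (wcov w).
Proof.
move=> hw; split.
  apply/matrixP => j k; rewrite !mxE; apply: eq_bigr => i _; ring.
move=> p X; rewrite mxtrace_wcov; apply: sumr_ge0 => i _; apply: mulr_ge0.
  by have /andP[] := hw i.
by apply: sumr_ge0 => r _; exact: sqr_ge0.
Qed.

Lemma wcov_le_spread w v : (0 < n)%N -> weighting w ->
  \sum_i w i * dot v (fun k => y i k - wmean w k) ^+ 2 <=
  spread w * (1 + n%:R^-1) * sqnorm v.
Proof.
move=> n0 hw; have psdA := psd_wcov hw.
have := rayleigh_le_trace_ratio (\row_j v j) n0 (ltnSn (n * d)) psdA.
rewrite mxtrace_wcov mxtrace_mul_trmx big_ord1.
have -> : \sum_i w i * (\sum_r dot (fun k => (\row_j v j : 'rV_d) r k) (fun k => y i k - wmean w k) ^+ 2) =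
   \sum_i w i * dot v (fun k => y i k - wmean w k) ^+ 2.
  apply: eq_bigr => i _; rewrite big_ord1; congr (_ * _ ^+ 2).
  by apply: eq_bigr => k _; rewrite mxE.
have -> : \sum_j (\row_j v j : 'rV_d) ord0 j ^+ 2 = sqnorm v.
  by apply: eq_bigr => k _; rewrite mxE.
(* Squares of the entries of [cov_power] double its exponent: the ratio is
   [tr (A^(2p+1)) / tr (A^(2p))] with [p = n d + 1]. *)
have -> // : moment (wcov w) 1%:M ((n * d).+1 + (n * d).+1).+1 /
   moment (wcov w) 1%:M ((n * d).+1 + (n * d).+1) = spread w.
congr (_ / _).
  rewrite -[RHS](mxtrace_wcov w (cov_power w)) /moment trmx1 mulmx1 mul1mx.
  rewrite /cov_power trmx_mxpow ?psdA.1//.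
  by rewrite (_ : (_.+1 + _.+1).+1 = ((n * d).+1 + 1 + (n * d).+1)%N) ?mxpowD ?mxpow1//; lia.
by rewrite moment_even// mul1mx.
Qed.

End statistics.

Section filter.
Variables (R : realType) (n d : nat) (x y : 'I_n -> 'I_d -> R) (eta kappa : R).
Implicit Types (w u : 'I_n -> R) (v e : 'I_d -> R).

Let c i j := x i j - centroid x j.

(** The mass [3 eta] allows for the corrupted points, of mass [eta], and for the [2 eta] that the
    filter may remove. *)
Record stable := Stable {
  stable_upper : forall v, n%:R^-1 * \sum_i dot v (c i) ^+ 2 <= (1 + kappa) * sqnorm v;
  stable_lower : forall v, (1 - kappa) * sqnorm v <= n%:R^-1 * \sum_i dot v (c i) ^+ 2;
  stable_tail : forall u, (forall i, 0 <= u i <= n%:R^-1) -> \sum_i u i <= 3 * eta ->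
    forall v, \sum_i u i * dot v (c i) ^+ 2 <= kappa * sqnorm v }.

Variable bad : {set 'I_n}.
Hypothesis n_gt0 : (0 < n)%N.
Hypothesis eta_gt0 : 0 < eta.
Hypothesis eta_small : eta <= 1 / 1000.
Hypothesis kappa_ge : n%:R^-1 <= kappa.
Hypothesis stable_x : stable.
Hypothesis xy : forall i, i \notin bad -> y i = x i.
Hypothesis card_bad : #|bad|%:R <= eta * n%:R.

Let kappa_ge0 : 0 <= kappa.
Proof. by apply: le_trans kappa_ge; rewrite invr_ge0. Qed.

Let n_gt0' : 0 < n%:R :> R.
Proof. by rewrite ltr0n. Qed.

Local Notation wmean := (wmean y).

Let sum_bad_const (k : R) : 0 <= k -> \sum_(i in bad) n%:R^-1 * k <= eta * k.
Proof.
move=> k0; rewrite sumr_const -[X in X <= _]mulr_natl mulrA ler_wpM2r//.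
by rewrite ler_pdivrMr.
Qed.

Let sum_bad w : weighting w -> \sum_(i in bad) w i <= eta.
Proof.
move=> hw; apply: (@le_trans _ _ (\sum_(i in bad) n%:R^-1 * 1)).
  by apply: ler_sum => i _; rewrite mulr1; have /andP[] := hw i.
by rewrite -[leRHS]mulr1; exact: sum_bad_const.
Qed.

Let sum_c v : \sum_i dot v (c i) = 0.
Proof.
rewrite /dot exchange_big/= big1// => j _; rewrite -mulr_sumr sumrB sumr_const card_ord.
by rewrite /centroid -[_ *+ n]mulr_natl mulrA divff ?mul1r ?subrr ?mulr0// gt_eqF.
Qed.

Let dotB v (a b : 'I_d -> R) : dot v (fun j => a j - b j) = dot v a - dot v b.
Proof. by rewrite /dot -sumrB; apply: eq_bigr => j _; rewrite mulrBr. Qed.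

Let e w j := wmean w j - centroid x j.

Let removed w i := n%:R^-1 - (if i \in bad then 0 else w i).

Let removed_weighting w : weighting w -> weighting (removed w).
Proof.
move=> hw i; have /andP[w0 w1] := hw i; have := n_gt0'; rewrite -invr_gt0 => h.
rewrite /removed; case: ifP => _; apply/andP; split; lra.
Qed.

Let sum_removed w : weighting w -> 1 - 2 * eta <= wsum w -> \sum_i removed w i <= 3 * eta.
Proof.
move=> hw W; rewrite sumrB sumr_const card_ord -[_ *+ n]mulr_natl divff ?gt_eqF//.
rewrite (bigID (mem bad))/= big1 ?add0r; last by move=> i ->.
rewrite (eq_bigr w); last by move=> i /negbTE ->.
have := sum_bad hw; move: W; rewrite /wsum (bigID (mem bad))/=; lra.
Qed.

(* The points of [bad] left aside, the weights of [w] differ from the uniform ones by weights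
   of total mass [3 eta], to which [stable_tail] applies. *)
Let good_linear w v : weighting w -> 1 - 2 * eta <= wsum w ->
  (\sum_(i | i \notin bad) w i * dot v (c i)) ^+ 2 <= 3 * eta * kappa * sqnorm v.
Proof.
move=> hw W; have hr := removed_weighting hw; have sr := sum_removed hw W.
have -> : \sum_(i | i \notin bad) w i * dot v (c i) = - \sum_i removed w i * 1 * dot v (c i).
  under [in RHS]eq_bigr => i _ do rewrite mulr1 /removed mulrBl.
  rewrite sumrB -mulr_sumr sum_c mulr0 sub0r opprK [RHS](bigID (mem bad))/=.
  rewrite [X in _ = X + _]big1 ?add0r; last by move=> i ->; rewrite mul0r.
  by apply: eq_bigr => i /negbTE ->.
rewrite sqrrN; apply: le_trans (weighted_cauchy_schwarz _ _ _) _.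
  by move=> i; have /andP[] := hr i.
under eq_bigr => i _ do rewrite expr1n mulr1.
rewrite -[leRHS]mulrA; apply: ler_pM => //; last exact: stable_tail.
  by apply: sumr_ge0 => i _; have /andP[] := hr i.
by apply: sumr_ge0 => i _; rewrite mulr_ge0 ?sqr_ge0//; have /andP[] := hr i.
Qed.

Let good_square w v : weighting w -> 1 - 2 * eta <= wsum w ->
  (1 - 2 * kappa) * sqnorm v <= \sum_(i | i \notin bad) w i * dot v (c i) ^+ 2.
Proof.
move=> hw W; have hr := removed_weighting hw; have sr := sum_removed hw W.
have := stable_tail stable_x hr sr v; have := stable_lower stable_x v.
have -> : \sum_(i | i \notin bad) w i * dot v (c i) ^+ 2 =
    n%:R^-1 * \sum_i dot v (c i) ^+ 2 - \sum_i removed w i * dot v (c i) ^+ 2.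
  under [X in _ = _ - X]eq_bigr => i _ do rewrite /removed mulrBl.
  rewrite sumrB -mulr_sumr opprB addrCA subrr addr0.
  rewrite [RHS](bigID (mem bad))/= [X in _ = X + _]big1 ?add0r; last by move=> i ->; rewrite mul0r.
  by apply: eq_bigr => i /negbTE ->.
lra.
Qed.

(** The shift [wsum w * ep] is split into a clean part [G1], with [G1^2 = O(eta kappa S)] by
    stability, and a corrupted part with [B1^2 <= eta * B2]. Since clean points already use
    [1 - 2 kappa] of the variance, [B2 <= (l + 2 kappa) S + ep^2]. The term [ep^2] comes from
    recentring at the clean centroid; multiplied by [eta], it is absorbed on the left. *)
Lemma mean_error w (l : R) v : weighting w -> 1 - 2 * eta <= wsum w -> 0 <= l ->
  \sum_i w i * dot v (fun j => y i j - wmean w j) ^+ 2 <= (1 + l) * sqnorm v ->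
  dot v (e w) ^+ 2 <= 11 * eta * (kappa + l) * sqnorm v.
Proof.
move=> hw W l0 hA; set S := sqnorm v in hA *; have S0 : 0 <= S by exact: sqnorm_ge0.
set ep := dot v (e w); pose b i := dot v (fun j => y i j - centroid x j).
have W0 : 0 < wsum w by have := eta_small; lra.
have W1 : wsum w <= 1.
  apply: (@le_trans _ _ (\sum_(i < n) n%:R^-1)).
    by apply: ler_sum => i _; have /andP[] := hw i.
  by rewrite sumr_const card_ord -[leLHS]mulr_natl divff// gt_eqF.
have bc i : i \notin bad -> b i = dot v (c i) by move=> ib; rewrite /b /c xy.
have sum_wb : \sum_i w i * b i = wsum w * ep.
  rewrite /ep /e dotB mulrBr.
  have -> : wsum w * dot v (wmean w) = \sum_i w i * dot v (y i).
    rewrite /dot mulr_sumr; under [in RHS]eq_bigr => i _ do rewrite mulr_sumr.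
    rewrite exchange_big/=; apply: eq_bigr => j _; rewrite /wmean.
    rewrite mulrCA [wsum w * _]mulrC divfK ?gt_eqF// mulr_sumr.
    by apply: eq_bigr => i _; rewrite mulrCA.
  rewrite /wsum mulr_suml -sumrB; apply: eq_bigr => i _; rewrite /b dotB; ring.
have sum_wb2 : \sum_i w i * b i ^+ 2 = wsum w * ep ^+ 2 +
    \sum_i w i * dot v (fun j => y i j - wmean w j) ^+ 2.
  have E i : w i * dot v (fun j => y i j - wmean w j) ^+ 2 =
      w i * b i ^+ 2 - 2 * ep * (w i * b i) + ep ^+ 2 * w i.
    have -> : dot v (fun j => y i j - wmean w j) = b i - ep.
      by rewrite /b /ep /e !dotB; ring.
    ring.
  under [in RHS]eq_bigr => i _ do rewrite E.
  rewrite big_split/= sumrB -!mulr_sumr sum_wb -/(wsum w); ring.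
have GL := good_linear v hw W; have GS := good_square v hw W; rewrite -/S in GL GS.
have GLb : \sum_(i | i \notin bad) w i * b i = \sum_(i | i \notin bad) w i * dot v (c i).
  by apply: eq_bigr => i /bc ->.
have GSb : \sum_(i | i \notin bad) w i * b i ^+ 2 = \sum_(i | i \notin bad) w i * dot v (c i) ^+ 2.
  by apply: eq_bigr => i /bc ->.
set G1 := \sum_(i | i \notin bad) w i * dot v (c i) in GL GLb.
set G2 := \sum_(i | i \notin bad) w i * dot v (c i) ^+ 2 in GS GSb.
pose wb i := if i \in bad then w i else 0.
have wb0 i : 0 <= wb i by rewrite /wb; case: ifP => // _; have /andP[] := hw i.
have wbE (f : 'I_n -> R) : \sum_i wb i * f i = \sum_(i in bad) w i * f i.
  rewrite (bigID (mem bad))/= [X in _ + X]big1 ?addr0.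
    by apply: eq_bigr => i; rewrite /wb => ->.
  by move=> i /negbTE; rewrite /wb => ->; rewrite mul0r.
have CS : (\sum_(i in bad) w i * b i) ^+ 2 <= eta * \sum_(i in bad) w i * b i ^+ 2.
  have := weighted_cauchy_schwarz (fun _ => 1) b wb0.
  under eq_bigr => i _ do rewrite mulr1.
  under [X in _ <= X * _]eq_bigr => i _ do rewrite expr1n.
  rewrite !wbE => h; apply: le_trans h _; apply: ler_wpM2r.
    by apply: sumr_ge0 => i _; rewrite mulr_ge0 ?sqr_ge0//; have /andP[] := hw i.
  by under eq_bigr => i _ do rewrite mulr1; exact: sum_bad.
move: sum_wb sum_wb2; rewrite !(bigID (mem bad) xpredT (fun i => w i * b i))/=.
rewrite !(bigID (mem bad) xpredT (fun i => w i * b i ^+ 2))/= GLb GSb.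
set B1 := \sum_(i in bad) _ in CS *; set B2 := \sum_(i in bad) _ in CS *.
move=> sum_wb sum_wb2.
have ep0 : 0 <= ep ^+ 2 by exact: sqr_ge0.
have hB2 : B2 <= (l + 2 * kappa) * S + ep ^+ 2.
  have : wsum w * ep ^+ 2 <= ep ^+ 2 by rewrite ler_piMl.
  lra.
have hB1 : B1 ^+ 2 <= eta * ((l + 2 * kappa) * S + ep ^+ 2).
  by apply: le_trans CS _; rewrite ler_wpM2l// ltW.
have hW : (wsum w * ep) ^+ 2 <= 2 * B1 ^+ 2 + 2 * G1 ^+ 2.
  by rewrite -sum_wb; have := sqr_ge0 (B1 - G1); lra.
have W98 : 98 / 100 <= wsum w by have := eta_small; lra.
have W96 : 96 / 100 * ep ^+ 2 <= (wsum w * ep) ^+ 2.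
  by rewrite exprMn; apply: ler_wpM2r => //; nra.
have e1 : eta * ep ^+ 2 <= 1 / 1000 * ep ^+ 2 by rewrite ler_wpM2r.
have kS : 0 <= eta * kappa * S by rewrite !mulr_ge0// ltW.
have lS : 0 <= eta * l * S by rewrite !mulr_ge0// ltW.
lra.
Qed.

Lemma mean_error_norm w (l : R) : weighting w -> 1 - 2 * eta <= wsum w -> 0 <= l ->
  (forall v, \sum_i w i * dot v (fun j => y i j - wmean w j) ^+ 2 <= (1 + l) * sqnorm v) ->
  sqnorm (fun j => wmean w j - centroid x j) <= 11 * eta * (kappa + l).
Proof.
move=> hw W l0 hA; rewrite -/(e w).
have := mean_error hw W l0 (hA (e w)).
have -> : dot (e w) (e w) = sqnorm (e w) by apply: eq_bigr => j _; rewrite expr2.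
have [->|S0] := eqVneq (sqnorm (e w)) 0.
  by move=> _; rewrite !mulr_ge0 ?addr_ge0// ltW.
by rewrite expr2 ler_pM2r// lt_def S0 sqnorm_ge0.
Qed.

Let sum_score (q : 'I_n -> R) w (D : {pred 'I_n}) :
  \sum_(i in D) q i * score y w i = \sum_r \sum_(i in D) q i *
     dot (fun k => cov_power y w r k) (fun k => y i k - wmean w k) ^+ 2.
Proof.
by rewrite exchange_big/=; apply: eq_bigr => i _; rewrite mulr_sumr.
Qed.

Let frob w : R := \sum_r \sum_k cov_power y w r k ^+ 2.

Let frob_ge0 w : 0 <= frob w.
Proof. by apply: sumr_ge0 => r _; exact: sqnorm_ge0. Qed.

Let dot_good v w i : i \notin bad ->
  dot v (fun k => y i k - wmean w k) = dot v (c i) - dot v (e w).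
Proof. by move=> ib; rewrite /c /e !dotB xy//; ring. Qed.

Let sum_dot_e w : \sum_r dot (fun k => cov_power y w r k) (e w) ^+ 2 <= frob w * sqnorm (e w).
Proof.
by rewrite mulr_suml; apply: ler_sum => r _; exact: dot_sqr_le.
Qed.

(** A score is a sum of squared projections on the rows of [cov_power]; [stable_tail] applies row by
    row, and recentring from the weighted mean to the clean centroid costs the term in [e w]. *)
Let good_score_tail w u : (forall i, 0 <= u i <= n%:R^-1) -> \sum_i u i <= 2 * eta ->
  (forall i, i \in bad -> u i = 0) ->
  \sum_i u i * score y w i <= (2 * kappa + 4 * eta * sqnorm (e w)) * frob w.
Proof.
move=> hu su ub.
have -> : \sum_i u i * score y w i = \sum_(i in ~: bad) u i * score y w i.
  rewrite (bigID (mem bad))/= big1 ?add0r => [|i /ub ->]; last by rewrite mul0r.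
  by apply: eq_bigl => i; rewrite inE.
rewrite sum_score.
apply: (@le_trans _ _ (\sum_r (2 * kappa * \sum_k cov_power y w r k ^+ 2 +
     4 * eta * dot (fun k => cov_power y w r k) (e w) ^+ 2))).
  apply: ler_sum => r _; set v : 'I_d -> R := (fun k => cov_power y w r k).
  have su3 : \sum_i u i <= 3 * eta by have := eta_gt0; lra.
  have tail := stable_tail stable_x hu su3 v.
  apply: (@le_trans _ _ (\sum_(i in ~: bad) (2 * (u i * dot v (c i) ^+ 2) +
       2 * u i * dot v (e w) ^+ 2))).
    apply: ler_sum => i; rewrite inE => ib; rewrite (dot_good _ _ ib).
    have /andP[ui _] := hu i; have := sqr_ge0 (dot v (c i) + dot v (e w)).
    move/(mulr_ge0 ui); lra.
  rewrite big_split/= -mulr_sumr -mulr_suml -mulr_sumr.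
  have le_all (f : 'I_n -> R) : (forall i, 0 <= f i) -> \sum_(i in ~: bad) f i <= \sum_i f i.
    by move=> f0; rewrite [leRHS](bigID (mem (~: bad)))/= lerDl sumr_ge0.
  have h1 := le_trans (le_all (fun i => u i * dot v (c i) ^+ 2) _) tail.
  have {}h1 : \sum_(i in ~: bad) u i * dot v (c i) ^+ 2 <= kappa * sqnorm v.
    by apply: h1 => i; rewrite mulr_ge0 ?sqr_ge0//; have /andP[] := hu i.
  have h2 : \sum_(i in ~: bad) u i <= 2 * eta.
    by apply: le_trans su; apply: le_all => i; have /andP[] := hu i.
  have := sqr_ge0 (dot v (e w)) => /(ler_wpM2r) /(_ _ _ h2).
  rewrite -/(sqnorm v); lra.
rewrite big_split/= -!mulr_sumr -/(frob w).
have := sum_dot_e w; have := eta_gt0.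
move=> h /(ler_wpM2l (ltW h)); lra.
Qed.

Let card_outlying w : \sum_(i | outlying y eta w i) 1 <= 2 * eta * n%:R :> R.
Proof.
have [/existsP[i0 i0P]|/existsPn none] := boolP [exists i, outlying y eta w i]; last first.
  rewrite big1 => [|i]; first by rewrite !mulr_ge0// ltW.
  by rewrite (negbTE (none i)).
(* Every outlying point is counted in the rank of the one with the least score. *)
have [i iP imin] := arg_minP (score y w) i0P.
apply: le_trans iP; rewrite big_mkcond/=; apply: ler_sum => k _.
case: ifP => [kP|_]; last by rewrite ler0n.
by rewrite (imin k kP).
Qed.

(** In units of [frob w] the total score is [1 + l] with [l > 20 kappa]. The clean points take at
    most [1 + 2 kappa + 2 |e|^2]; both the trimmed score of the clean points and what trimming
    spares the corrupted ones are at most [2 kappa + 4 eta |e|^2]. As [|e|^2 <= l / 40], these three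
    add up to less than the total. *)
Lemma filter_step w : weighting w -> 1 - 2 * eta <= wsum w -> 1 + 20 * kappa < spread y w ->
  \sum_(i | i \notin bad) w i * trimmed_score y eta w i <
  \sum_(i in bad) w i * trimmed_score y eta w i.
Proof.
move=> hw W hspread.
have F0 : 0 < frob w.
  rewrite lt_def frob_ge0 andbT; apply/eqP => F0; move: hspread.
  by rewrite /spread -/(frob w) F0 invr0 mulr0; have := kappa_ge0; lra.
pose l := spread y w - 1.
have ninv : n%:R^-1 <= 1 :> R by rewrite invf_le1// ler1n.
have ninv0 : 0 < n%:R^-1 :> R by rewrite invr_gt0.
have E0 := sqnorm_ge0 (e w).
(* The spread bounds all directional variances by [1 + 2 l + kappa], so [|e|^2] is at most [11 eta]
   times a multiple of [l]. It is the smallness of [eta], not of [l], that gives 1/40. *)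
have hE : sqnorm (e w) <= l / 40.
  have l' : 0 <= 2 * l + kappa by rewrite /l; have := kappa_ge0; lra.
  have := mean_error_norm hw W l'.
  have -> : sqnorm (fun j => wmean w j - centroid x j) = sqnorm (e w) by [].
  move=> h; apply: le_trans (h _) _.
    move=> v; apply: le_trans (wcov_le_spread y v n_gt0 hw) _.
    apply: ler_wpM2r; first exact: sqnorm_ge0.
    have -> : spread y w = 1 + l by rewrite /l; ring.
    have : l * n%:R^-1 <= l by rewrite ler_piMr// /l; have := kappa_ge0; lra.
    have := kappa_ge; lra.
  have h1 : kappa + (2 * l + kappa) <= 21 / 10 * l by rewrite /l; lra.
  have h2 : eta * (kappa + (2 * l + kappa)) <= 1 / 1000 * (21 / 10 * l).
    apply: ler_pM => //; [exact: ltW|have := kappa_ge0; lra].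
  rewrite -mulrA; have : 0 <= l by rewrite /l; have := kappa_ge0; lra.
  lra.
have w0 i : 0 <= w i by have /andP[] := hw i.
have w1 i : w i <= n%:R^-1 by have /andP[] := hw i.
have eta0 := ltW eta_gt0.
have total : \sum_i w i * score y w i = (1 + l) * frob w.
  have -> : 1 + l = spread y w by rewrite /l; ring.
  by rewrite /spread divfK// gt_eqF.
have good_trimmed : \sum_(i | i \notin bad) w i * trimmed_score y eta w i <=
    (2 * kappa + 4 * eta * sqnorm (e w)) * frob w.
  pose u i := if (i \notin bad) && outlying y eta w i then w i else 0.
  have -> : \sum_(i | i \notin bad) w i * trimmed_score y eta w i = \sum_i u i * score y w i.
    rewrite [RHS](bigID (mem bad))/= [X in _ = X + _]big1 ?add0r.
      apply: eq_bigr => i ib; rewrite /u ib /trimmed_score/=.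
      by case: ifP; rewrite ?mul0r ?mulr0.
    by move=> i ib; rewrite /u ib mul0r.
  apply: good_score_tail.
  - by move=> i; rewrite /u; case: ifP => _; rewrite ?hw// lexx ltW.
  - apply: (@le_trans _ _ (\sum_(i | outlying y eta w i) n%:R^-1 * 1)).
      rewrite [leRHS]big_mkcond/=; apply: ler_sum => i _; rewrite /u mulr1.
      by case: (i \notin bad); case: (outlying y eta w i) => //=; rewrite ltW.
    rewrite -mulr_sumr mulrC ler_pdivrMr//; exact: card_outlying.
  - by move=> i ib; rewrite /u ib.
have good_all : \sum_(i | i \notin bad) w i * score y w i <=
    (1 + 2 * kappa + 2 * sqnorm (e w)) * frob w.
  rewrite (eq_bigl (fun i => i \in ~: bad)); last by move=> i; rewrite inE.
  rewrite sum_score.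
  apply: (@le_trans _ _ (\sum_r ((1 + 2 * kappa) * \sum_k cov_power y w r k ^+ 2 +
     2 * dot (fun k => cov_power y w r k) (e w) ^+ 2))).
    apply: ler_sum => r _; set v : 'I_d -> R := (fun k => cov_power y w r k).
    rewrite (eq_bigl (fun i => i \notin bad)); last by move=> i; rewrite inE.
    rewrite -/(sqnorm v); pose ep := dot v (e w).
    have epE : dot v (e w) = ep by [].
    rewrite epE; clearbody ep.
    have G1 := good_linear v hw W; set g1 := \sum_(i | _) _ in G1.
    have G2 : \sum_(i | i \notin bad) w i * dot v (c i) ^+ 2 <= (1 + kappa) * sqnorm v.
      apply: le_trans (stable_upper stable_x v); rewrite mulr_sumr.
      rewrite [leRHS](bigID (mem bad))/= ler_wpDl//.
        by apply: sumr_ge0 => i _; rewrite mulr_ge0 ?sqr_ge0// ltW.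
      by apply: ler_sum => i _; rewrite ler_wpM2r ?sqr_ge0.
    have G3 : \sum_(i | i \notin bad) w i <= 1.
      apply: (@le_trans _ _ (\sum_(i < n) n%:R^-1)).
        rewrite [leRHS](bigID (mem bad))/= ler_wpDl//.
          by apply: sumr_ge0 => i _; rewrite ltW.
        exact: ler_sum.
      by rewrite sumr_const card_ord -[leLHS]mulr_natl divff// gt_eqF.
    have -> : \sum_(i | i \notin bad) w i * dot v (fun k => y i k - wmean w k) ^+ 2 =
        \sum_(i | i \notin bad) w i * dot v (c i) ^+ 2 - 2 * ep * g1 +
        ep ^+ 2 * \sum_(i | i \notin bad) w i.
      rewrite /g1 !mulr_sumr -sumrB -big_split/=; apply: eq_bigr => i ib.
      by rewrite (dot_good _ _ ib) epE; ring.
    have := sqr_ge0 ep => /ler_wpM2l /(_ _ _ G3).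
    have := sqr_ge0 (ep + g1).
    have : eta * (kappa * sqnorm v) <= 1 / 1000 * (kappa * sqnorm v).
      by rewrite ler_wpM2r// mulr_ge0// sqnorm_ge0.
    have : 0 <= kappa * sqnorm v by rewrite mulr_ge0// sqnorm_ge0.
    lra.
  rewrite big_split/= -!mulr_sumr -/(frob w); have := sum_dot_e w; lra.
have bad_untrimmed : \sum_(i in bad) w i * (score y w i - trimmed_score y eta w i) <=
    (2 * kappa + 4 * eta * sqnorm (e w)) * frob w.
  set K := (2 * kappa + _) * _.
  have K0 : 0 <= K by rewrite !(mulr_ge0, addr_ge0).
  (* If [i] is not outlying, more than [2 eta n] points score at least as much, and more than
     [eta n] of them are clean. Mass [eta] spread evenly over these gives at most [1 / n] to each,
     so [good_score_tail] bounds [eta * score y w i]. *)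
  have nontrimmed i : eta * (score y w i - trimmed_score y eta w i) <= K.
    rewrite /trimmed_score; case: ifPn => [_|out]; first by rewrite subrr mulr0.
    rewrite subr0; rewrite /outlying -ltNge in out.
    pose T := [set k : 'I_n | (k \notin bad) && (score y w i <= score y w k)]%SET.
    have cT : eta * n%:R < #|T|%:R.
      have : \sum_k ((score y w i <= score y w k)%R : nat)%:R <= #|bad|%:R + #|T|%:R :> R.
        rewrite -natr_sum -natrD ler_nat -!sum1_card.
        rewrite [X in (X + _)%N]big_mkcond [X in (_ + X)%N]big_mkcond -big_split/=.
        apply: leq_sum => k _; rewrite inE; by case: (k \in bad); case: (score y w i <= _).
      move: out card_bad; lra.
    have T0 : 0 < #|T|%:R :> R by apply: le_lt_trans cT; rewrite mulr_ge0.
    pose u k := if k \in T then eta / #|T|%:R else 0.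
    have uS : \sum_k u k = eta.
      by rewrite /u -big_mkcond/= sumr_const -[LHS]mulr_natl mulrCA divff ?mulr1// gt_eqF.
    have u0 k : 0 <= u k by rewrite /u; case: ifP => // _; rewrite divr_ge0.
    apply: (@le_trans _ _ (\sum_k u k * score y w k)).
      rewrite -[X in X * _]uS mulr_suml; apply: ler_sum => k _; rewrite /u.
      case: ifP => [|_]; last by rewrite !mul0r.
      by rewrite inE => /andP[_ h]; rewrite ler_wpM2l// divr_ge0.
    apply: good_score_tail.
    - move=> k; rewrite u0/= /u; case: ifP => _; last exact: ltW.
      by rewrite ler_pdivrMr// mulrC ler_pdivlMr// ltW.
    - by rewrite uS; lra.
    - by move=> k kb; rewrite /u inE kb.
  apply: (@le_trans _ _ (\sum_(i in bad) n%:R^-1 * (K / eta))).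
    apply: ler_sum => i _.
    have h : score y w i - trimmed_score y eta w i <= K / eta.
      by rewrite ler_pdivlMr// mulrC.
    apply: le_trans (ler_wpM2l (w0 i) h) _; apply: ler_wpM2r => //.
    by rewrite divr_ge0.
  apply: le_trans (sum_bad_const _) _; first by rewrite divr_ge0.
  by rewrite mulrCA divff ?mulr1// gt_eqF.
move: total; rewrite (bigID (mem bad))/=.
have -> : \sum_(i in bad) w i * score y w i =
    \sum_(i in bad) w i * trimmed_score y eta w i +
    \sum_(i in bad) w i * (score y w i - trimmed_score y eta w i).
  by rewrite -big_split; apply: eq_bigr => i _ /=; ring.
move=> total.
suff : (2 * kappa + 4 * eta * sqnorm (e w)) * frob w + (1 + 2 * kappa + 2 * sqnorm (e w)) * frob w
   + (2 * kappa + 4 * eta * sqnorm (e w)) * frob w < (1 + l) * frob w by lra.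
rewrite -!mulrDl ltr_pM2r//.
have : eta * sqnorm (e w) <= 1 / 1000 * sqnorm (e w) by rewrite ler_wpM2r.
have : 20 * kappa < l by rewrite /l; lra.
lra.
Qed.

(** Mass lost since the uniform weights. The corrupted points can lose [eta] in all, so
    [deficit_good <= deficit_bad] keeps the total above [1 - 2 eta]. *)
Let deficit_bad w := \sum_(i in bad) (n%:R^-1 - w i).
Let deficit_good w := \sum_(i | i \notin bad) (n%:R^-1 - w i).

Let wsum_ge w : weighting w -> deficit_good w <= deficit_bad w -> 1 - 2 * eta <= wsum w.
Proof.
move=> hw inv.
have B : deficit_bad w <= eta.
  apply: (@le_trans _ _ (\sum_(i in bad) n%:R^-1 * 1)).
    by apply: ler_sum => i _; rewrite mulr1 gerBl; have /andP[] := hw i.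
  by rewrite -[leRHS]mulr1; exact: sum_bad_const.
have : deficit_bad w + deficit_good w = 1 - wsum w.
  rewrite /deficit_bad /deficit_good -(bigID (mem bad) xpredT (fun i => n%:R^-1 - w i))/=.
  by rewrite sumrB sumr_const card_ord -[_ *+ n]mulr_natl divff// gt_eqF.
lra.
Qed.

Let zeros w := #|[set i : 'I_n | w i == 0]%SET|.

(* Each reweighting sets the weight of a point of maximal trimmed score to zero, so that the
   loop cannot go on for more than [n] rounds. *)
Lemma reweighted_progress w w' : weighting w -> deficit_good w <= deficit_bad w ->
  1 + 20 * kappa < spread y w -> reweighted y eta w w' ->
  deficit_good w' <= deficit_bad w' /\ (zeros w < zeros w')%N.
Proof.
move=> hw inv hspread hr; have bounds := reweighted_bounds hw hr.
have step := filter_step hw (wsum_ge hw inv) hspread.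
case: hr => P [Pmax P0 w'E].
have [i wi fi] : exists2 i, 0 < w i & 0 < trimmed_score y eta w i.
  have good0 : 0 <= \sum_(i | i \notin bad) w i * trimmed_score y eta w i.
    apply: sumr_ge0 => i _; rewrite mulr_ge0 ?trimmed_score_ge0//.
    by have /andP[] := hw i.
  have [/existsP[i /andP[h1 h2]]|/existsPn none] :=
    boolP [exists i, (0 < w i) && (0 < trimmed_score y eta w i)]; first by exists i.
  move: (le_lt_trans good0 step); rewrite big1 ?ltxx// => i _.
  have := none i; rewrite negb_and -!leNgt => /orP[] h.
    by have /andP[h' _] := hw i; rewrite (@le_anti _ _ (w i) 0) ?mul0r// h h'.
  by rewrite (@le_anti _ _ (trimmed_score y eta w i) 0) ?mulr0// h trimmed_score_ge0.
have Pgt0 : 0 < P := lt_le_trans fi (Pmax i wi).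
split.
  have E (D : pred 'I_n) : \sum_(i | D i) (n%:R^-1 - w' i) = \sum_(i | D i) (n%:R^-1 - w i) +
      (\sum_(i | D i) w i * trimmed_score y eta w i) / P.
    by rewrite mulr_suml -big_split/=; apply: eq_bigr => k _; rewrite w'E; ring.
  rewrite /deficit_good /deficit_bad !E.
  apply: lerD => //; rewrite ler_pM2r ?invr_gt0//; exact: ltW.
case: P0 => [P0|[i0 wi0 PE]]; first by rewrite P0 ltxx in Pgt0.
apply: proper_card; apply/properP; split.
  apply/fintype.subsetP => k; rewrite !inE => /eqP wk; have := bounds k.
  by rewrite wk => h; rewrite eq_le andbC.
exists i0; rewrite !inE; last by rewrite gt_eqF.
by rewrite w'E PE mulfK ?subrr// -PE gt_eqF.
Qed.

Lemma filter_succeeds (ws : nat -> 'I_n -> R) : (forall i, ws 0%N i = n%:R^-1) ->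
  (forall t, (t < n)%N -> reweighted y eta (ws t) (ws t.+1)) ->
  exists2 t, (t <= n)%N & 1 - 2 * eta <= wsum (ws t) /\ spread y (ws t) <= 1 + 20 * kappa.
Proof.
move=> ws0 step; apply: contrapT => none.
have h0 : weighting (ws 0%N) by move=> i; rewrite ws0 lexx invr_ge0 ler0n.
have inv t : (t <= n)%N -> [/\ weighting (ws t), deficit_good (ws t) <= deficit_bad (ws t)
    & (t <= zeros (ws t))%N].
  elim: t => [_|t IH tn].
    split=> //; rewrite /deficit_good /deficit_bad.
    by rewrite !big1// => i _; rewrite ws0 subrr.
  have [hw hd hz] := IH (ltnW tn).
  have hs : 1 + 20 * kappa < spread y (ws t).
    rewrite ltNge; apply/negP => h; apply: none; exists t; first exact: ltnW.
    by split => //; exact: wsum_ge.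
  have [hd' hz'] := reweighted_progress hw hd hs (step t tn).
  split => //; first exact: reweighted_weighting hw (step t tn).
  exact: leq_ltn_trans hz hz'.
have [hw hd hz] := inv n (leqnn n).
have : wsum (ws n) = 0.
  rewrite /wsum big1// => i _; apply/eqP.
  have : [set i : 'I_n | ws n i == 0]%SET == [set: 'I_n]%SET.
    by rewrite eqEcard finset.subsetT cardsT card_ord.
  by move=> /eqP/finset.setP /(_ i); rewrite !inE.
have := wsum_ge hw hd; have := eta_small; lra.
Qed.

(** The mass and the spread are visible to the program, unlike the invariant on deficits. The
    selected round may thus come after the invariant has been lost. *)
Lemma filter_accuracy w : weighting w -> 1 - 2 * eta <= wsum w ->
  spread y w <= 1 + 20 * kappa ->
  sqnorm (fun j => wmean w j - centroid x j) <= 462 * eta * kappa.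
Proof.
move=> hw W hs; have k0 := kappa_ge0.
(* From [1 / n <= kappa] and [kappa / n <= kappa], the product of [1 + 20 kappa] and [1 + 1 / n] is
   at most [1 + 41 kappa]; then [11 * 42 = 462]. *)
have k41 : 0 <= 41 * kappa by lra.
apply: le_trans (mean_error_norm hw W k41 _) _; last lra.
move=> v; apply: le_trans (wcov_le_spread y v n_gt0 hw) _.
apply: ler_wpM2r; first exact: sqnorm_ge0.
have ninv : n%:R^-1 <= 1 :> R by rewrite invf_le1// ler1n.
have ninv0 : 0 < n%:R^-1 :> R by rewrite invr_gt0.
apply: (@le_trans _ _ ((1 + 20 * kappa) * (1 + n%:R^-1))).
  by rewrite ler_wpM2r//; lra.
have := kappa_ge; have : kappa * n%:R^-1 <= kappa by rewrite ler_piMr.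
lra.
Qed.

End filter.

(** * Bounded loops on the real RAM *)

(* A language of loops over the coordinates [0 <= x < n] (limit register 0) and [0 <= x < d]
   (limit register 1) that only assigns real cells.  Its loop counters are scoped, so that
   [run] acts on the memory alone and every program of it runs in polynomial time. *)
Inductive loop_cmd : Type :=
| LSkip
| LSet of nat & nexp & nexp & rexp
| LSeq of loop_cmd & loop_cmd
| LIf of test & loop_cmd & loop_cmd
| LFor of nat & bool & loop_cmd.

Definition limit_reg (b : bool) : nat := if b then 1%N else 0%N.

Fixpoint compile (c : loop_cmd) : cmd :=
  match c with
  | LSkip => Skip
  | LSet a i j e => RSet a i j e
  | LSeq c1 c2 => Seq (compile c1) (compile c2)
  | LIf b c1 c2 => If b (compile c1) (compile c2)
  | LFor x b c =>
      Seq (NSet x (NLit 0)) (While (NLe (NAdd (NVar x) (NLit 1)) (NVar (limit_reg b)))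
        (Seq (compile c) (NSet x (NAdd (NVar x) (NLit 1)))))
  end.

Definition memory (R : realType) := nat -> nat -> nat -> R.

Definition upd (rho : nat -> nat) (x v : nat) : nat -> nat :=
  fun y => if y == x then v else rho y.

Fixpoint run (R : realType) (c : loop_cmd) (rho : nat -> nat) (M : memory R) : memory R :=
  match c with
  | LSkip => M
  | LSet a i j e => let s := State rho M in
      rmem (rset s a (neval s i) (neval s j) (reval s e))
  | LSeq c1 c2 => run c2 rho (run c1 rho M)
  | LIf b c1 c2 => if teval (State rho M) b then run c1 rho M else run c2 rho M
  | LFor x b c => iteri (rho (limit_reg b)) (fun k => run c (upd rho x k)) M
  end.

Fixpoint nscoped (l : seq nat) (e : nexp) : bool :=
  match e with
  | NLit _ => true
  | NVar x => x \in l
  | NAdd e1 e2 | NSub e1 e2 => nscoped l e1 && nscoped l e2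
  end.

Fixpoint rscoped (l : seq nat) (e : rexp) : bool :=
  match e with
  | RGet _ i j => nscoped l i && nscoped l j
  | RNat k => nscoped l k
  | RAdd e1 e2 | RSub e1 e2 | RMul e1 e2 | RDiv e1 e2 => rscoped l e1 && rscoped l e2
  end.

Fixpoint tscoped (l : seq nat) (b : test) : bool :=
  match b with
  | NLe e1 e2 => nscoped l e1 && nscoped l e2
  | RLe e1 e2 => rscoped l e1 && rscoped l e2
  | TNot b1 => tscoped l b1
  end.

Fixpoint scoped (l : seq nat) (c : loop_cmd) : bool :=
  match c with
  | LSkip => true
  | LSet _ i j e => [&& nscoped l i, nscoped l j & rscoped l e]
  | LSeq c1 c2 => scoped l c1 && scoped l c2
  | LIf b c1 c2 => [&& tscoped l b, scoped l c1 & scoped l c2]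
  | LFor x b c => [&& x \notin l, limit_reg b \in l & scoped (x :: l) c]
  end.

(** Here [q] bounds both loop limits. Each pass adds a test and an increment, each loop an
    initialisation and a final test. *)
Fixpoint cost (q : nat) (c : loop_cmd) : nat :=
  match c with
  | LSkip => 1
  | LSet _ _ _ _ => 1
  | LSeq c1 c2 => cost q c1 + cost q c2
  | LIf _ c1 c2 => (cost q c1 + cost q c2).+1
  | LFor _ _ c => q * (cost q c).+2 + 2
  end.

Lemma iteri_shift (T : Type) (r : nat) (f : nat -> T -> T) (z : T) :
  iteri r.+1 f z = iteri r (fun i => f i.+1) (f 0%N z).
Proof. by elim: r => //= r <-. Qed.

Section run_correct.
Variable R : realType.
Implicit Types (M : memory R) (l : seq nat) (rho : nat -> nat).

Let agree l rho rho' := forall x, x \in l -> rho x = rho' x.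

Lemma nscopedP l e rho rho' M : nscoped l e -> agree l rho rho' ->
  neval (State rho M) e = neval (State rho' M) e.
Proof.
move=> + h; elim: e => //= [e1 IH1 e2 IH2|e1 IH1 e2 IH2].
  by move=> /andP[/IH1 -> /IH2 ->].
by move=> /andP[/IH1 -> /IH2 ->].
Qed.

Lemma rscopedP l e rho rho' M : rscoped l e -> agree l rho rho' ->
  reval (State rho M) e = reval (State rho' M) e.
Proof.
move=> + h; elim: e => //= [a i j|k|e1 IH1 e2 IH2|e1 IH1 e2 IH2|e1 IH1 e2 IH2|e1 IH1 e2 IH2];
  try by move=> /andP[/IH1 -> /IH2 ->].
  by move=> /andP[hi hj]; rewrite (nscopedP M hi h) (nscopedP M hj h).
by move=> hk; rewrite (nscopedP M hk h).
Qed.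

Lemma tscopedP l b rho rho' M : tscoped l b -> agree l rho rho' ->
  teval (State rho M) b = teval (State rho' M) b.
Proof.
move=> + h; elim: b => //= [e1 e2|e1 e2|b IH]; last by move=> /IH ->.
  by move=> /andP[h1 h2]; rewrite (nscopedP M h1 h) (nscopedP M h2 h).
by move=> /andP[h1 h2]; rewrite (rscopedP M h1 h) (rscopedP M h2 h).
Qed.

(** Compiled loops leave values in their counters, while [run] forgets them: register files are
    compared on the scope [l] only, which no counter of [c] meets. *)
Lemma exec_compile l c rho (s : state R) (q : nat) : scoped l c ->
  0%N \in l -> 1%N \in l -> agree l rho (nreg s) ->
  (rho 0 <= q)%N -> (rho 1 <= q)%N ->
  exists (t : nat) (s' : state R), [/\ exec (compile c) s t s', (t <= cost q c)%N,
    rmem s' = run c rho (rmem s) & agree l rho (nreg s')].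
Proof.
elim: c l rho s => [|a i j e|c1 IH1 c2 IH2|b c1 IH1 c2 IH2|x b c IH] l rho s /= sc l0 l1 ag q0 q1.
- by exists 1%N, s; split => //; exact: exec_skip.
- have /and3P[si sj se] := sc; case: s ag => reg M /= ag.
  exists 1%N, (rset (State reg M) a (neval (State reg M) i) (neval (State reg M) j)
    (reval (State reg M) e)); split => //; first exact: exec_rset.
  by rewrite /= (nscopedP M si ag) (nscopedP M sj ag) (rscopedP M se ag).
- have /andP[s1 s2] := sc.
  have [t1 [s' [e1 h1 m1 a1]]] := IH1 l rho s s1 l0 l1 ag q0 q1.
  have [t2 [s'' [e2 h2 m2 a2]]] := IH2 l rho s' s2 l0 l1 a1 q0 q1.
  exists (t1 + t2)%N, s''; split => //; [exact: exec_seq e1 e2|exact: leq_add|by rewrite m2 m1].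
- have /and3P[sb s1 s2] := sc.
  have tE : teval s b = teval (State rho (rmem s)) b.
    by case: s ag => reg M /= ag; rewrite (tscopedP M sb ag).
  case E: (teval (State rho (rmem s)) b).
    have [t1 [s' [e1 h1 m1 a1]]] := IH1 l rho s s1 l0 l1 ag q0 q1.
    exists t1.+1, s'; split => //; first by apply: exec_if; rewrite tE E.
    by rewrite ltnS (leq_trans h1)// leq_addr.
  have [t1 [s' [e1 h1 m1 a1]]] := IH2 l rho s s2 l0 l1 ag q0 q1.
  exists t1.+1, s'; split => //; first by apply: exec_if; rewrite tE E.
  by rewrite ltnS (leq_trans h1)// leq_addl.
have /and3P[xl bl sc'] := sc; set m := rho (limit_reg b).
have mq : (m <= q)%N by rewrite /m; case: (b).
set W := While _ _.
pose body k := run c (upd rho x k) : memory R -> memory R.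
have loop r k (s1 : state R) : (k + r)%N = m -> nreg s1 x = k -> agree l rho (nreg s1) ->
  exists t s', [/\ exec W s1 t s', (t <= r * (cost q c).+2 + 1)%N,
    rmem s' = iteri r (fun i => body (k + i)%N) (rmem s1) & agree l rho (nreg s')].
  elim: r k s1 => [|r IHr] k s1 km kx ags.
    exists 1%N, s1; split => //; apply: exec_while_stop.
    rewrite /= kx -(ags _ bl) -/m -ltnNge; lia.
  have xneq y : y \in l -> (y == x) = false by move=> yl; apply: contraNF xl => /eqP <-.
  have agk : agree (x :: l) (upd rho x k) (nreg s1).
    move=> z; rewrite inE /upd; case: eqVneq => [-> _|_ /= zl]; [exact/esym|exact: ags].
  have [t1 [s2 [e1 h1 m1 a1]]] := IH (x :: l) (upd rho x k) s1 sc' (mem_behead (s := x :: l) l0)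
     (mem_behead (s := x :: l) l1) agk (ltac:(by rewrite /upd xneq)) (ltac:(by rewrite /upd xneq)).
  pose s3 := nset s2 x (neval s2 (NAdd (NVar x) (NLit 1))).
  have s3x : nreg s3 x = k.+1.
    by rewrite /= eqxx -a1 ?inE ?eqxx// /upd eqxx addn1.
  have ag3 : agree l rho (nreg s3).
    by move=> z zl /=; rewrite xneq// -a1 ?inE ?zl ?orbT// /upd xneq.
  have [t2 [s4 [e2 h2 m2 a2]]] := IHr k.+1 s3 (ltac:(lia)) s3x ag3.
  exists ((t1 + 1) + t2).+1, s4; split => //.
  - apply: exec_while_loop e2.
      by rewrite /= kx -(ags _ bl) -/m; lia.
    by apply: exec_seq e1 _; exact: exec_nset.
  - by rewrite mulSn; move: h1 h2; set C := cost q c; set D := (r * _)%N; lia.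
  - rewrite m2 iteri_shift addn0 /= m1.
    by congr iteri; apply/funext => i; rewrite addSnnS.
have ag0 : agree l rho (nreg (nset s x 0)).
  by move=> z zl /=; case: eqVneq => [zx|_]; [rewrite -zx zl in xl|exact: ag].
have [t [s' [e1 h1 m1 a1]]] := loop m 0%N (nset s x 0) (add0n m) (ltac:(by rewrite /= eqxx)) ag0.
exists (1 + t)%N, s'; split => //.
- by apply: exec_seq e1; exact: exec_nset.
- rewrite add1n addn2 ltnS; apply: leq_trans h1 _.
  by rewrite addn1 ltnS leq_mul2r mq orbT.
Qed.

End run_correct.

Lemma cost_polynomial c : exists k, forall q, (cost q c <= k * q ^ k + k)%N.
Proof.
have mono k k' q : (k <= k')%N -> (k * q ^ k <= k' * q ^ k')%N.
  case: q => [|q] kk; last by rewrite leq_mul// leq_pexp2l.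
  by case: k kk => // k _; rewrite exp0n ?muln0.
elim: c => [|a i j e|c1 [k1 h1] c2 [k2 h2]|b c1 [k1 h1] c2 [k2 h2]|x b c [k h]] /=.
- by exists 1%N => q; lia.
- by exists 1%N => q; lia.
- exists (k1 + k2 + (k1 + k2))%N => q; have := h1 q; have := h2 q.
  have := mono k1 (k1 + k2)%N q (leq_addr _ _); have := mono k2 (k1 + k2)%N q (leq_addl _ _).
  have := mono (k1 + k2)%N (k1 + k2 + (k1 + k2))%N q (leq_addr _ _).
  have : (2 * ((k1 + k2) * q ^ (k1 + k2)) <= (k1 + k2 + (k1 + k2)) * q ^ (k1 + k2 + (k1 + k2)))%N.
    case: (q) => [|q']; last by rewrite mulnA mul2n -addnn leq_mul// leq_pexp2l// leq_addr.
    by case: (k1 + k2)%N => [|k]; rewrite ?muln0// exp0n// !muln0.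
  lia.
- exists (k1 + k2 + (k1 + k2) + 1)%N => q; have := h1 q; have := h2 q.
  have := mono k1 (k1 + k2)%N q (leq_addr _ _); have := mono k2 (k1 + k2)%N q (leq_addl _ _).
  have := mono (k1 + k2 + (k1 + k2))%N (k1 + k2 + (k1 + k2) + 1)%N q (leq_addr _ _).
  have : (2 * ((k1 + k2) * q ^ (k1 + k2)) <= (k1 + k2 + (k1 + k2)) * q ^ (k1 + k2 + (k1 + k2)))%N.
    case: (q) => [|q']; last by rewrite mulnA mul2n -addnn leq_mul// leq_pexp2l// leq_addr.
    by case: (k1 + k2)%N => [|k]; rewrite ?muln0// exp0n// !muln0.
  lia.
exists (2 * k + 4)%N => q; case: q => [|q]; first by rewrite mul0n; lia.
have hq := h q.+1.
have h1 : (q.+1 * q.+1 ^ k <= q.+1 ^ (2 * k + 4))%N by rewrite -expnS leq_pexp2l//; lia.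
have h2 : (q.+1 <= q.+1 ^ (2 * k + 4))%N by rewrite -[leqLHS]expn1 leq_pexp2l//; lia.
have h3 : (q.+1 * (cost q.+1 c).+2 <= q.+1 * (k * q.+1 ^ k + k + 2))%N by rewrite leq_mul2l; lia.
apply: (@leq_trans (q.+1 * (k * q.+1 ^ k + k + 2) + 2)%N); first by rewrite leq_add2r.
rewrite mulnDr mulnDr mulnCA.
have h4 := leq_mul (leqnn k) h1; have h5 := leq_mul (leqnn (k + 2)%N) h2.
move: h4 h5; rewrite -!(mulnC q.+1) !mulnDl.
set A := (q.+1 ^ (2 * k + 4))%N; set B := (q.+1 * q.+1 ^ k)%N.
lia.
Qed.

Definition program_estimator (R : realType) (c : loop_cmd) : estimator R :=
  fun n d eta Y => \row_j run c (nreg (init eta Y)) (rmem (init eta Y)) 2 0 j.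

Lemma program_estimator_polynomial_time (R : realType) (c : loop_cmd) :
  scoped [:: 0; 1]%N c -> polynomial_time (@program_estimator R c).
Proof.
move=> sc; have [k hk] := cost_polynomial c; exists (compile c), k => n d eta Y.
have [t [s [e h m _]]] := @exec_compile R [:: 0; 1]%N c (nreg (init eta Y)) (init eta Y) (n + d)%N
  sc isT isT (fun _ _ => erefl) (leq_addr d n) (leq_addl n d).
exists t, s; split => //; first exact: leq_trans h (hk _).
by move=> j; rewrite mxE m.
Qed.

(** * The filter as a program *)

Definition setcell (R : realType) (M : memory R) (a i j : nat) (v : R) : memory R :=
  fun a' i' j' => if [&& a' == a, i' == i & j' == j] then v else M a' i' j'.

Definition setmat (R : realType) (M : memory R) (a m m' : nat) (F : nat -> nat -> R) : memory R :=
  fun a' i j => if [&& a' == a, (i < m)%N & (j < m')%N] then F i j else M a' i j.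

(** Frame condition: a loop filling array [a] only meets memories that differ from the initial one
    in [a], so an expression reading other arrays can be evaluated in the initial memory. *)
Definition agree_off (R : realType) (a : nat) (M M' : memory R) :=
  forall a' i j, a' != a -> M' a' i j = M a' i j.

Definition fold_cell (a : nat) (i j : nexp) (e0 : rexp) (x : nat) (b : bool) (c : loop_cmd) :=
  LSeq (LSet a i j e0) (LFor x b c).

Definition sum_cell (a : nat) (i j : nexp) (x : nat) (b : bool) (e : rexp) :=
  fold_cell a i j (RNat (NLit 0)) x b (LSet a i j (RAdd (RGet a i j) e)).

Definition for_mat (x : nat) (b : bool) (x' : nat) (b' : bool) (c : loop_cmd) :=
  LFor x b (LFor x' b' c).

(** * Effect of the loop patterns on the memory *)

Section run_blocks.
Variable R : realType.
Implicit Types (M : memory R) (rho : nat -> nat).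

Lemma memory_ext M M' : (forall a i j, M a i j = M' a i j) -> M = M'.
Proof. by move=> h; do 3 apply/funext => ?. Qed.

Lemma run_seq c1 c2 rho M : run (LSeq c1 c2) rho M = run c2 rho (run c1 rho M).
Proof. by []. Qed.

Lemma run_for x b c rho M :
  run (LFor x b c) rho M = iteri (rho (limit_reg b)) (fun k => run c (upd rho x k)) M.
Proof. by []. Qed.

Lemma setcell_id M a i j : setcell M a i j (M a i j) = M.
Proof.
by apply: memory_ext => a' i' j'; rewrite /setcell; case: ifP => // /and3P[/eqP-> /eqP-> /eqP->].
Qed.

Lemma setcell_same M a i j v : setcell M a i j v a i j = v.
Proof. by rewrite /setcell !eqxx. Qed.

Lemma setcell_setcell M a i j v v' : setcell (setcell M a i j v) a i j v' = setcell M a i j v'.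
Proof. by apply: memory_ext => a' i' j'; rewrite /setcell; case: [&& _, _ & _]. Qed.

Lemma agree_off_setcell a i j v M : agree_off a M (setcell M a i j v).
Proof. by move=> a' i' j' /negbTE aa; rewrite /setcell aa. Qed.

Lemma run_fold_cell a i j e0 x b c rho M (I J m : nat) (v0 : R) (G : nat -> R -> R) :
  rho (limit_reg b) = m ->
  neval (State rho M) i = I -> neval (State rho M) j = J ->
  reval (State rho M) e0 = v0 ->
  (forall k M', agree_off a M M' ->
    run c (upd rho x k) M' = setcell M' a I J (G k (M' a I J))) ->
  run (fold_cell a i j e0 x b c) rho M = setcell M a I J (iteri m G v0).
Proof.
move=> rb iE jE eE hc /=; rewrite {}rb iE jE eE -/(setcell M a I J v0).
elim: m => //= r ->.
rewrite hc; last exact: agree_off_setcell.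
by rewrite setcell_setcell setcell_same.
Qed.

Lemma iteri_sum (F : nat -> R) m : iteri m (fun k acc => acc + F k) 0 = \sum_(k < m) F k.
Proof. by elim: m => [|m /= ->]; rewrite ?big_ord0 ?big_ord_recr. Qed.

Lemma run_sum_cell a i j x b e rho M (I J m : nat) (F : nat -> R) :
  rho (limit_reg b) = m ->
  (forall M', neval (State rho M') i = I) -> (forall M', neval (State rho M') j = J) ->
  (forall k M', neval (State (upd rho x k) M') i = I) ->
  (forall k M', neval (State (upd rho x k) M') j = J) ->
  (forall k M', agree_off a M M' -> reval (State (upd rho x k) M') e = F k) ->
  run (sum_cell a i j x b e) rho M = setcell M a I J (\sum_(k < m) F k).
Proof.
move=> <- iE jE iE' jE' eE.
rewrite (@run_fold_cell _ _ _ _ _ _ _ _ _ I J (rho (limit_reg b)) 0 (fun k acc => acc + F k))//; first by rewrite iteri_sum.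
by move=> k M' ag /=; rewrite iE' jE' eE.
Qed.

Lemma run_for_mat a x b x' b' c rho M (m m' : nat) (F : nat -> nat -> R) :
  limit_reg b' != x -> rho (limit_reg b) = m -> rho (limit_reg b') = m' ->
  (forall i j M', agree_off a M M' ->
    run c (upd (upd rho x i) x' j) M' = setcell M' a i j (F i j)) ->
  run (for_mat x b x' b' c) rho M = setmat M a m m' F.
Proof.
move=> /negbTE bx rb rb' hc /=; rewrite {}rb.
elim: m => [|m /= ->].
  by apply: memory_ext => a' i j; rewrite /setmat ltn0 andbF.
set M1 := setmat _ _ _ _ _; rewrite {1}/upd bx rb'.
have ag1 : agree_off a M M1.
  by move=> a' i j /negbTE aa; rewrite /M1 /setmat aa.
have inner r : iteri r (fun j => run c (upd (upd rho x m) x' j)) M1 =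
    (fun a' i j => if [&& a' == a, i == m & (j < r)%N] then F i j else M1 a' i j).
  elim: r => [|r /= ->].
    by apply: memory_ext => a' i j; rewrite ltn0 !andbF.
  rewrite hc; last by move=> a' i j aa; rewrite (negbTE aa)/=; exact: ag1.
  apply: memory_ext => a' i j; rewrite /setcell.
  have -> : (j < r.+1)%N = (j == r) || (j < r)%N by rewrite ltnS leq_eqVlt.
  by case: (a' == a); case: eqVneq => //= ->; case: eqVneq => //= ->.
rewrite inner; apply: memory_ext => a' i j; rewrite /M1 /setmat.
have -> : (i < m.+1)%N = (i == m) || (i < m)%N by rewrite ltnS leq_eqVlt.
by case: (a' == a) => //=; case: eqVneq => //= ->; rewrite ltnn/=; case: ifP.
Qed.

Lemma run_for_vec a x b c rho M (m : nat) (F : nat -> R) :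
  rho (limit_reg b) = m ->
  (forall i M', agree_off a M M' -> run c (upd rho x i) M' = setcell M' a i 0 (F i)) ->
  run (LFor x b c) rho M = setmat M a m 1 (fun i _ => F i).
Proof.
move=> rb hc /=; rewrite {}rb; elim: m => [|m /= ->].
  by apply: memory_ext => a' i j; rewrite /setmat ltn0 andbF.
rewrite hc; last by move=> a' i j /negbTE aa; rewrite /setmat aa.
apply: memory_ext => a' i j; rewrite /setcell /setmat.
have -> : (i < m.+1)%N = (i == m) || (i < m)%N by rewrite ltnS leq_eqVlt.
have -> : (j < 1)%N = (j == 0%N) by rewrite ltnS leqn0.
by case: (a' == a) => //=; case: eqVneq => //= ->; rewrite ltnn; case: (j == 0%N).
Qed.

End run_blocks.


(* Arrays: 0 dataset, 1 corruption level, 2 output, 3 weights, 4 total weight, 5 weighted mean,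
   6 weighted covariance, 7 its power, 9 and 10 scores, 13 spread, 14 best spread so far,
   15 ranks, 16 trimmed scores, 17 their maximum; 8, 11, 12, 18, 19 are temporary. *)
Definition centered (i j : nexp) := RSub (RGet 0 i j) (RGet 5 j (NLit 0)).

Definition mean_cmd :=
  LSeq (sum_cell 4 (NLit 0) (NLit 0) 2 false (RGet 3 (NVar 2) (NLit 0)))
       (LFor 3 true (sum_cell 5 (NVar 3) (NLit 0) 2 false
          (RDiv (RMul (RGet 3 (NVar 2) (NLit 0)) (RGet 0 (NVar 2) (NVar 3))) (RGet 4 (NLit 0) (NLit 0))))).

(** Array 7 starts as the covariance, and nested loops over [n] and [d] multiply it [n d] times by
    array 6: the exponent is [n d + 1] without any integer product. Array 8 buffers each matrix
    product. *)
Definition power_cmd :=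
  LSeq (for_mat 3 true 4 true (sum_cell 6 (NVar 3) (NVar 4) 2 false
          (RMul (RMul (RGet 3 (NVar 2) (NLit 0)) (centered (NVar 2) (NVar 3))) (centered (NVar 2) (NVar 4)))))
 (LSeq (for_mat 3 true 4 true (LSet 7 (NVar 3) (NVar 4) (RGet 6 (NVar 3) (NVar 4))))
       (LFor 5 false (LFor 6 true
          (LSeq (for_mat 3 true 4 true (sum_cell 8 (NVar 3) (NVar 4) 2 true
                   (RMul (RGet 7 (NVar 3) (NVar 2)) (RGet 6 (NVar 2) (NVar 4)))))
                (for_mat 3 true 4 true (LSet 7 (NVar 3) (NVar 4) (RGet 8 (NVar 3) (NVar 4)))))))).

Definition score_cmd :=
  LSeq (for_mat 2 false 3 true (sum_cell 9 (NVar 2) (NVar 3) 4 true (RMul (RGet 7 (NVar 3) (NVar 4)) (centered (NVar 2) (NVar 4)))))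
       (LFor 2 false (sum_cell 10 (NVar 2) (NLit 0) 3 true (RMul (RGet 9 (NVar 2) (NVar 3)) (RGet 9 (NVar 2) (NVar 3))))).

Definition spread_cmd :=
  LSeq (sum_cell 11 (NLit 0) (NLit 0) 2 false (RMul (RGet 3 (NVar 2) (NLit 0)) (RGet 10 (NVar 2) (NLit 0))))
 (LSeq (LFor 3 true (sum_cell 12 (NVar 3) (NLit 0) 4 true (RMul (RGet 7 (NVar 3) (NVar 4)) (RGet 7 (NVar 3) (NVar 4)))))
 (LSeq (sum_cell 18 (NLit 0) (NLit 0) 3 true (RGet 12 (NVar 3) (NLit 0)))
       (LSet 13 (NLit 0) (NLit 0) (RDiv (RGet 11 (NLit 0) (NLit 0)) (RGet 18 (NLit 0) (NLit 0)))))).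

Definition stats_cmd := LSeq mean_cmd (LSeq power_cmd (LSeq score_cmd spread_cmd)).

Definition trim_cmd :=
  LSeq (LFor 2 false (fold_cell 15 (NVar 2) (NLit 0) (RNat (NLit 0)) 3 false
          (LIf (RLe (RGet 10 (NVar 2) (NLit 0)) (RGet 10 (NVar 3) (NLit 0)))
               (LSet 15 (NVar 2) (NLit 0) (RAdd (RGet 15 (NVar 2) (NLit 0)) (RNat (NLit 1)))) LSkip)))
       (LFor 2 false
          (LIf (RLe (RGet 15 (NVar 2) (NLit 0)) (RMul (RMul (RNat (NLit 2)) (RGet 1 (NLit 0) (NLit 0))) (RNat (NVar 0))))
               (LSet 16 (NVar 2) (NLit 0) (RGet 10 (NVar 2) (NLit 0))) (LSet 16 (NVar 2) (NLit 0) (RNat (NLit 0))))).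

(** The new weights go through array 19, so that neither of the two weight loops reads the array it
    writes. *)
Definition reweight_cmd :=
  LSeq (fold_cell 17 (NLit 0) (NLit 0) (RNat (NLit 0)) 2 false
          (LIf (RLe (RGet 3 (NVar 2) (NLit 0)) (RNat (NLit 0))) LSkip
               (LIf (RLe (RGet 17 (NLit 0) (NLit 0)) (RGet 16 (NVar 2) (NLit 0))) (LSet 17 (NLit 0) (NLit 0) (RGet 16 (NVar 2) (NLit 0))) LSkip)))
 (LSeq (LFor 2 false (LSet 19 (NVar 2) (NLit 0) (RSub (RGet 3 (NVar 2) (NLit 0))
          (RDiv (RMul (RGet 3 (NVar 2) (NLit 0)) (RGet 16 (NVar 2) (NLit 0))) (RGet 17 (NLit 0) (NLit 0))))))
       (LFor 2 false (LSet 3 (NVar 2) (NLit 0) (RGet 19 (NVar 2) (NLit 0))))).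

(** The mean is copied to all [n] rows of array 2, the output being row 0. *)
Definition save_cmd :=
  LSeq (LSet 14 (NLit 0) (NLit 0) (RGet 13 (NLit 0) (NLit 0))) (for_mat 2 false 3 true (LSet 2 (NVar 2) (NVar 3) (RGet 5 (NVar 3) (NLit 0)))).

(** The uniform weights, of mass 1, are saved without the mass test; later rounds replace the saved
    one only if they pass it. Hence the alternative [s = 0] in the loop invariant. *)
Definition filter_cmd :=
  LSeq (LFor 2 false (LSet 3 (NVar 2) (NLit 0) (RDiv (RNat (NLit 1)) (RNat (NVar 0)))))
 (LSeq stats_cmd (LSeq save_cmd
   (LFor 7 false (LSeq trim_cmd (LSeq reweight_cmd (LSeq stats_cmd
     (LIf (RLe (RSub (RNat (NLit 1)) (RMul (RNat (NLit 2)) (RGet 1 (NLit 0) (NLit 0)))) (RGet 4 (NLit 0) (NLit 0)))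
       (LIf (RLe (RGet 13 (NLit 0) (NLit 0)) (RGet 14 (NLit 0) (NLit 0))) save_cmd LSkip) LSkip))))))).

Lemma scoped_filter_cmd : scoped [:: 0; 1]%N filter_cmd.
Proof. by []. Qed.

(** * Correctness of the blocks and of the whole filter *)

Section program_correct.
Variables (R : realType) (n d : nat).
Implicit Types (M : memory R) (rho : nat -> nat).

Definition keeps (l : seq nat) M M' := forall a i j, a \notin l -> M' a i j = M a i j.

Lemma keeps_trans l1 l2 M M' M'' : keeps l1 M M' -> keeps l2 M' M'' -> keeps (l1 ++ l2) M M''.
Proof.
by move=> h1 h2 a i j; rewrite mem_cat negb_or => /andP[a1 a2]; rewrite h2// h1.
Qed.

Definition data M (i : 'I_n) (j : 'I_d) : R := M 0 i j.
Definition weights M (i : 'I_n) : R := M 3 i 0.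

Lemma run_mean rho M : rho 0 = n -> rho 1 = d ->
  let M' := run mean_cmd rho M in
  [/\ keeps [:: 4; 5] M M', M' 4 0 0 = wsum (weights M) &
      forall j : 'I_d, M' 5 j 0 = wmean (data M) (weights M) j].
Proof.
move=> rn rd M'; pose W := \sum_(k < n) M 3 k 0.
have -> : M' = setmat (setcell M 4 0 0 W) 5 d 1 (fun j _ => \sum_(k < n) M 3 k 0 * M 0 k j / W).
  rewrite /M' /mean_cmd run_seq.
  rewrite (@run_sum_cell _ _ _ _ _ _ _ _ _ 0 0 n (fun k => M 3 k 0)) => [||||||k M1 ag];
    [|by []..|by rewrite /= ag].
  rewrite -/W; set M1 := setcell _ _ _ _ _.
  rewrite (@run_for_vec _ 5 _ _ _ _ _ d (fun j => \sum_(k < n) M 3 k 0 * M 0 k j / W))// => j M2 ag2.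
  rewrite (@run_sum_cell _ _ _ _ _ _ _ _ _ j 0 n (fun k => M 3 k 0 * M 0 k j / W)) => [||||||k M3 ag3];
    [by []..|].
  by rewrite /= !ag3// !ag2.
split.
- by move=> a i j; rewrite !inE negb_or => /andP[/negbTE a4 /negbTE a5]; rewrite /setmat /setcell a4 a5.
- by [].
- by move=> j; rewrite /setmat /= ltn_ord -mulr_suml.
Qed.

(** The index advances by [s] per pass, so that the lemma nests: with [s = 1] inside and [s = d]
    outside, it counts matrix products. *)
Lemma iteri_invariant (T : Type) (Q : nat -> T -> Prop) (s m : nat) (f : nat -> T -> T) q z :
  (forall k z' q', Q q' z' -> Q (q' + s)%N (f k z')) -> Q q z -> Q (q + m * s)%N (iteri m f z).
Proof.
move=> step Qz; elim: m => [|m IH]; first by rewrite mul0n addn0.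
by rewrite mulSn (addnC s) addnA; exact: step.
Qed.

Lemma run_power rho M (A : 'M[R]_d) : rho 0 = n -> rho 1 = d ->
  (forall j k : 'I_d, A j k =
     \sum_(i < n) M 3 i 0 * (M 0 i j - M 5 j 0) * (M 0 i k - M 5 k 0)) ->
  let M' := run power_cmd rho M in
  keeps [:: 6; 7; 8] M M' /\ forall r k : 'I_d, M' 7 r k = mxpow A (n * d).+1 r k.
Proof.
move=> rn rd AE M'.
pose F j k := \sum_(i < n) M 3 i 0 * (M 0 i j - M 5 j 0) * (M 0 i k - M 5 k 0).
have E1 : run (for_mat 3 true 4 true (sum_cell 6 (NVar 3) (NVar 4) 2 false
          (RMul (RMul (RGet 3 (NVar 2) (NLit 0)) (centered (NVar 2) (NVar 3))) (centered (NVar 2) (NVar 4)))))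
    rho M = setmat M 6 d d F.
  rewrite (@run_for_mat _ 6 _ _ _ _ _ _ _ d d F)// => j k M1 ag1.
  rewrite (@run_sum_cell _ _ _ _ _ _ _ _ _ j k n
    (fun i => M 3 i 0 * (M 0 i j - M 5 j 0) * (M 0 i k - M 5 k 0))) => [||||||i M2 ag2];
    [by []..|].
  by rewrite /= !ag2// !ag1.
have copy rho' M1 src : rho' 1 = d -> src != 7 ->
  run (for_mat 3 true 4 true (LSet 7 (NVar 3) (NVar 4) (RGet src (NVar 3) (NVar 4)))) rho' M1 =
  setmat M1 7 d d (fun j k => M1 src j k).
  move=> rd' src7.
  by rewrite (@run_for_mat _ 7 _ _ _ _ _ _ _ d d (fun j k => M1 src j k))// => j k M2 ag /=;
    rewrite ag.
pose Q q M1 := [/\ keeps [:: 6; 7; 8] M M1, forall j k : 'I_d, M1 6 j k = A j k &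
  forall j k : 'I_d, M1 7 j k = mxpow A q.+1 j k].
have Q0 : Q 0%N (setmat (setmat M 6 d d F) 7 d d (fun j k => setmat M 6 d d F 6 j k)).
  split.
  - move=> a i j; rewrite !inE !negb_or => /and3P[/negbTE a6 /negbTE a7 _].
    by rewrite /setmat a6 a7.
  - by move=> j k; rewrite /setmat /= !ltn_ord AE.
  - by move=> j k; rewrite /setmat /= !ltn_ord mul1mx AE.
have mul rho' M1 q : rho' 0 = n -> rho' 1 = d -> Q q M1 ->
  Q (q + 1)%N (run (LSeq (for_mat 3 true 4 true (sum_cell 8 (NVar 3) (NVar 4) 2 true
                   (RMul (RGet 7 (NVar 3) (NVar 2)) (RGet 6 (NVar 2) (NVar 4)))))
                (for_mat 3 true 4 true (LSet 7 (NVar 3) (NVar 4) (RGet 8 (NVar 3) (NVar 4))))) rho' M1).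
  move=> rn' rd' [hk h6 h7]; rewrite run_seq.
  pose G j k := \sum_(l < d) M1 7 j l * M1 6 l k.
  rewrite [X in run _ _ X](_ : _ = setmat M1 8 d d G); last first.
    rewrite (@run_for_mat _ 8 _ _ _ _ _ _ _ d d G)// => j k M2 ag2.
    rewrite (@run_sum_cell _ _ _ _ _ _ _ _ _ j k d (fun l => M1 7 j l * M1 6 l k)) => [||||||l M3 ag3];
      [by []..|].
    by rewrite /= !ag3// !ag2.
  rewrite copy//; split.
  - move=> a i j al; have := al; rewrite !inE !negb_or => /and3P[/negbTE a6 /negbTE a7 /negbTE a8].
    by rewrite /setmat a7 a8 /=; exact: hk.
  - by move=> j k; rewrite /setmat /= h6.
  - move=> j k; rewrite addn1 /setmat /= !ltn_ord /= mxE; apply: eq_bigr => l _.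
    by rewrite h6 h7.
have [hk _ h7] : Q (0 + n * (d * 1))%N M'.
  rewrite /M' /power_cmd; set body := LSeq _ (for_mat _ _ _ _ (LSet 7 _ _ (RGet 8 _ _))).
  rewrite !run_seq E1 copy// run_for rn.
  apply: iteri_invariant => // k M1 q hq; rewrite run_for {1}/upd/= rd.
  apply: iteri_invariant => // k' M2 q' hq'.
  by apply: mul => //; rewrite /upd/=.
by split => // r k; rewrite h7 add0n muln1.
Qed.

Lemma run_score rho M : rho 0 = n -> rho 1 = d ->
  let M' := run score_cmd rho M in
  keeps [:: 9; 10] M M' /\ forall i : 'I_n, M' 10 i 0 =
    \sum_(r < d) (\sum_(k < d) M 7 r k * (M 0 i k - M 5 k 0)) ^+ 2.
Proof.
move=> rn rd M'; pose F i r := \sum_(k < d) M 7 r k * (M 0 i k - M 5 k 0).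
have -> : M' = setmat (setmat M 9 n d F) 10 n 1 (fun i _ => \sum_(r < d) F i r * F i r).
  rewrite /M' /score_cmd run_seq.
  rewrite (@run_for_mat _ 9 _ _ _ _ _ _ _ n d F)// => [|i r M1 ag1]; last first.
    rewrite (@run_sum_cell _ _ _ _ _ _ _ _ _ i r d
      (fun k => M 7 r k * (M 0 i k - M 5 k 0))) => [||||||k M2 ag2]; [by []..|].
    by rewrite /= !ag2// !ag1.
  set M1 := setmat _ _ _ _ _.
  rewrite (@run_for_vec _ 10 _ _ _ _ _ n (fun i => \sum_(r < d) M1 9 i r * M1 9 i r))//.
    apply: memory_ext => a i j; rewrite /setmat; case: ifP => // /and3P[_ ii _].
    by apply: eq_bigr => r _; rewrite /M1 /setmat /= ii ltn_ord.
  move=> i M2 ag2.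
  rewrite (@run_sum_cell _ _ _ _ _ _ _ _ _ i 0 d (fun r => M1 9 i r * M1 9 i r)) => [||||||k M3 ag3];
    [by []..|].
  by rewrite /= !ag3// !ag2.
split.
  by move=> a i j; rewrite !inE negb_or => /andP[/negbTE a4 /negbTE a5]; rewrite /setmat a4 a5.
by move=> i; rewrite /setmat /= ltn_ord; apply: eq_bigr => r _; rewrite expr2.
Qed.

Lemma run_spread rho M : rho 0 = n -> rho 1 = d ->
  let M' := run spread_cmd rho M in
  keeps [:: 11; 12; 18; 13] M M' /\ M' 13 0 0 =
    (\sum_(i < n) M 3 i 0 * M 10 i 0) / (\sum_(r < d) \sum_(k < d) M 7 r k ^+ 2).
Proof.
move=> rn rd M'.
pose S1 := \sum_(i < n) M 3 i 0 * M 10 i 0.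
pose S2 := \sum_(r < d) \sum_(k < d) M 7 r k * M 7 r k.
have -> : M' = setcell (setcell (setmat (setcell M 11 0 0 S1) 12 d 1
    (fun r _ => \sum_(k < d) M 7 r k * M 7 r k)) 18 0 0 S2) 13 0 0 (S1 / S2).
  rewrite /M' /spread_cmd 3!run_seq.
  rewrite (@run_sum_cell _ 11 _ _ _ _ _ _ _ 0 0 n (fun i => M 3 i 0 * M 10 i 0))//; last first.
    by move=> i M1 ag1; rewrite /= !ag1.
  rewrite -/S1; set M1 := setcell _ _ _ _ _.
  rewrite (@run_for_vec _ 12 _ _ _ _ _ d (fun r => \sum_(k < d) M 7 r k * M 7 r k))//; last first.
    move=> r M2 ag2.
    rewrite (@run_sum_cell _ _ _ _ _ _ _ _ _ r 0 d (fun k => M 7 r k * M 7 r k)) => [||||||k M3 ag3];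
      [by []..|].
    by rewrite /= !ag3// !ag2.
  set M2 := setmat _ _ _ _ _.
  rewrite (@run_sum_cell _ 18 _ _ _ _ _ _ _ 0 0 d (fun r => M2 12 r 0))//; last first.
    by move=> r M3 ag3; rewrite /= !ag3.
  have -> // : \sum_(r < d) M2 12 r 0 = S2.
  by apply: eq_bigr => r _; rewrite /M2 /setmat /= ltn_ord.
split; last by rewrite setcell_same /S2; congr (_ / _); apply: eq_bigr => r _; apply: eq_bigr.
move=> a i j; rewrite !inE !negb_or => /and4P[/negbTE a1 /negbTE a2 /negbTE a3 /negbTE a4].
by rewrite /setcell /setmat a1 a2 a3 a4.
Qed.

Definition stats_arrays := [:: 4; 5; 6; 7; 8; 9; 10; 11; 12; 18; 13]%N.

Lemma run_stats rho M : rho 0 = n -> rho 1 = d ->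
  let M' := run stats_cmd rho M in
  [/\ keeps stats_arrays M M', M' 4 0 0 = wsum (weights M),
      forall j : 'I_d, M' 5 j 0 = wmean (data M) (weights M) j,
      forall i : 'I_n, M' 10 i 0 = score (data M) (weights M) i &
      M' 13 0 0 = spread (data M) (weights M)].
Proof.
move=> rn rd M'; rewrite /M' /stats_cmd 3!run_seq.
have [k1 hW hm] := @run_mean rho M rn rd; set M1 := run mean_cmd rho M in k1 hW hm *.
have AE (j k : 'I_d) : wcov (data M) (weights M) j k =
     \sum_(i < n) M1 3 i 0 * (M1 0 i j - M1 5 j 0) * (M1 0 i k - M1 5 k 0).
  by rewrite mxE; apply: eq_bigr => i _; rewrite !(k1 3%N)// !(k1 0%N)// !hm.
have [k2 hB] := @run_power rho M1 _ rn rd AE; set M2 := run power_cmd rho M1 in k2 hB *.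
have [k3 hs] := @run_score rho M2 rn rd; set M3 := run score_cmd rho M2 in k3 hs *.
have [k4 hp] := @run_spread rho M3 rn rd; set M4 := run spread_cmd rho M3 in k4 hp *.
have score3 (i : 'I_n) : M3 10 i 0 = score (data M) (weights M) i.
  rewrite hs; apply: eq_bigr => r _; congr (_ ^+ 2); apply: eq_bigr => k _.
  by rewrite hB !k2// k1// hm.
have kk := keeps_trans (keeps_trans (keeps_trans k1 k2) k3) k4.
split.
- by move=> a i j al; rewrite kk.
- by rewrite k4// k3// k2.
- by move=> j; rewrite k4// k3// k2.
- by move=> i; rewrite k4.
- rewrite hp; congr (_ / _).
    by apply: eq_bigr => i _; rewrite score3 k3// k2// k1.
  by apply: eq_bigr => r _; apply: eq_bigr => k _; rewrite k3// hB.
Qed.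

Lemma run_trim rho M : rho 0 = n ->
  let M' := run trim_cmd rho M in
  keeps [:: 15; 16] M M' /\ forall i : 'I_n, M' 16 i 0 =
    if \sum_(k < n) ((M 10 i 0 <= M 10 k 0)%R : nat)%:R <= 2 * M 1 0 0 * n%:R
    then M 10 i 0 else 0.
Proof.
move=> rn M'; pose F i := \sum_(k < n) ((M 10 i 0 <= M 10 k 0)%R : nat)%:R : R.
have -> : M' = setmat (setmat M 15 n 1 (fun i _ => F i)) 16 n 1
    (fun i _ => if setmat M 15 n 1 (fun i _ => F i) 15 i 0 <= 2 * M 1 0 0 * n%:R
       then M 10 i 0 else 0).
  rewrite /M' /trim_cmd run_seq.
  rewrite [run (LFor _ _ (fold_cell _ _ _ _ _ _ _)) _ _](@run_for_vec _ 15 _ _ _ _ _ n F)//; last first.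
    move=> i M1 ag1; rewrite (@run_fold_cell _ 15 _ _ _ _ _ _ _ _ i 0 n 0
      (fun k acc => acc + ((M 10 i 0 <= M 10 k 0)%R : nat)%:R))//; first by rewrite iteri_sum.
    move=> k M2 ag2; rewrite /= !(ag2 10%N)// !(ag1 10%N)//.
    by case: (_ <= _); rewrite // addr0 setcell_id.
  set M1 := setmat _ _ _ _ _.
  rewrite (@run_for_vec _ 16 _ _ _ _ _ n
    (fun i => if M1 15 i 0 <= 2 * M 1 0 0 * n%:R then M 10 i 0 else 0))//.
  move=> i M2 ag2; rewrite /= /upd/= !ag2// rn; by case: ifP => //= _; rewrite ag2.
split.
  by move=> a i j; rewrite !inE negb_or => /andP[/negbTE a4 /negbTE a5]; rewrite /setmat a4 a5.
by move=> i; rewrite /setmat /= ltn_ord.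
Qed.

Lemma run_reweight rho M : rho 0 = n ->
  let M' := run reweight_cmd rho M in
  keeps [:: 17; 19; 3] M M' /\ exists P,
   [/\ forall i : 'I_n, 0 < M 3 i 0 -> M 16 i 0 <= P,
      P = 0 \/ exists2 i : 'I_n, 0 < M 3 i 0 & P = M 16 i 0
    & forall i : 'I_n, M' 3 i 0 = M 3 i 0 - M 3 i 0 * M 16 i 0 / P].
Proof.
move=> rn M'.
pose G k acc := if M 3 k 0 <= 0 then acc else if acc <= M 16 k 0 then M 16 k 0 else acc.
pose P := iteri n G 0.
pose F i := M 3 i 0 - M 3 i 0 * M 16 i 0 / P.
have -> : M' = setmat (setmat (setcell M 17 0 0 P) 19 n 1 (fun i _ => F i)) 3 n 1
    (fun i _ => setmat (setcell M 17 0 0 P) 19 n 1 (fun i _ => F i) 19 i 0).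
  rewrite /M' /reweight_cmd 2!run_seq.
  rewrite (@run_fold_cell _ 17 _ _ _ _ _ _ _ _ 0 0 n 0 G)//; last first.
    move=> k M1 ag1; rewrite /= !(ag1 3%N)// !(ag1 16%N)// /G.
    case: ifP => _; first by rewrite setcell_id.
    by case: ifP => _ /=; rewrite ?(ag1 16%N)// setcell_id.
  set M1 := setcell _ _ _ _ _.
  rewrite [run (LFor _ _ (LSet 19 _ _ _)) _ _](@run_for_vec _ 19 _ _ _ _ _ n F)//; last first.
    by move=> i M2 ag2; rewrite /= !ag2.
  set M2 := setmat _ _ _ _ _.
  rewrite (@run_for_vec _ 3 _ _ _ _ _ n (fun i => M2 19 i 0))//.
  by move=> i M3 ag3; rewrite /= ag3.
split.
  move=> a i j; rewrite !inE !negb_or => /and3P[/negbTE a4 /negbTE a5 /negbTE a6].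
  by rewrite /setmat /setcell a4 a5 a6.
exists P.
have spec m : (forall i, (i < m)%N -> 0 < M 3 i 0 -> M 16 i 0 <= iteri m G 0) /\
    (iteri m G 0 = 0 \/ exists2 i, (i < m)%N & 0 < M 3 i 0 /\ iteri m G 0 = M 16 i 0).
  elim: m => [|m [IH1 IH2]]; first by split => //; left.
  rewrite /=; move: IH1 IH2; set z := iteri m G 0 => IH1 IH2; rewrite /G.
  case: ifPn => [w0|]; last rewrite -ltNge => w0.
    split; first move=> i; first rewrite ltnS leq_eqVlt => /predU1P[->|/IH1//].
      by rewrite ltNge w0.
    case: IH2 => [->|[i im h]]; first by left.
    by right; exists i => //; exact: ltnW.
  case: ifPn => [le|]; last rewrite -ltNge => lt.
    split; last by right; exists m.
    move=> i; rewrite ltnS leq_eqVlt => /predU1P[->//|im] wi.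
    exact: le_trans (IH1 i im wi) le.
  split.
    move=> i; rewrite ltnS leq_eqVlt => /predU1P[->|im] wi; [exact: ltW|exact: IH1].
  case: IH2 => [->|[i im h]]; first by left.
  by right; exists i => //; exact: ltnW.
have [s1 s2] := spec n; split.
- by move=> i; exact: s1.
- case: s2 => [|[i im [h1 h2]]]; [by left|right].
  by exists (Ordinal im).
- by move=> i; rewrite /setmat /= ltn_ord.
Qed.

Lemma run_save rho M : rho 0 = n -> rho 1 = d -> (0 < n)%N ->
  let M' := run save_cmd rho M in
  [/\ keeps [:: 14; 2] M M', M' 14 0 0 = M 13 0 0 & forall j : 'I_d, M' 2 0 j = M 5 j 0].
Proof.
move=> rn rd n0 M'.
have -> : M' = setmat (setcell M 14 0 0 (M 13 0 0)) 2 n d (fun _ j => M 5 j 0).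
  rewrite /M' /save_cmd run_seq.
  rewrite (@run_for_mat _ 2 _ _ _ _ _ _ _ n d (fun _ j => M 5 j 0))// => i j M1 ag1.
  by rewrite /= ag1.
split => //; last by move=> j; rewrite /setmat /= n0 ltn_ord.
by move=> a i j; rewrite !inE negb_or => /andP[/negbTE a4 /negbTE a5]; rewrite /setmat /setcell a4 a5.
Qed.

Variables (eta : R) (Y : 'M[R]_(n, d)).
Let y (i : 'I_n) (j : 'I_d) := Y i j.

(* The loop invariant after [t] rounds: [ws u] are the weights after [u] rounds, and [s] is the
   round that is currently saved. *)
Let invariant (t : nat) M := exists (ws : nat -> 'I_n -> R) (s : nat),
  [/\ data M = y /\ M 1 0 0 = eta,
      (forall i, ws 0%N i = n%:R^-1) /\
        (forall u, (u < t)%N -> reweighted y eta (ws u) (ws u.+1)),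
      weights M = ws t /\ (forall i : 'I_n, M 10 i 0 = score y (ws t) i),
      [/\ (s <= t)%N, s = 0%N \/ 1 - 2 * eta <= wsum (ws s), M 14 0 0 = spread y (ws s) &
          forall j : 'I_d, M 2 0 j = wmean y (ws s) j]
    & forall u, (u <= t)%N -> u = 0%N \/ 1 - 2 * eta <= wsum (ws u) ->
        spread y (ws s) <= spread y (ws u)].

Let round := LSeq trim_cmd (LSeq reweight_cmd (LSeq stats_cmd
     (LIf (RLe (RSub (RNat (NLit 1)) (RMul (RNat (NLit 2)) (RGet 1 (NLit 0) (NLit 0)))) (RGet 4 (NLit 0) (NLit 0)))
       (LIf (RLe (RGet 13 (NLit 0) (NLit 0)) (RGet 14 (NLit 0) (NLit 0))) save_cmd LSkip) LSkip))).

Let run_round rho M t : rho 0 = n -> rho 1 = d -> (0 < n)%N ->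
  invariant t M -> invariant t.+1 (run round rho M).
Proof.
move=> rn rd n0 [ws [s [[hy he] [ws0 hws] [hw hsc] [st hs hsp hout] hbest]]].
rewrite /round 3!run_seq.
have [k1 ht] := @run_trim rho M rn; set M1 := run trim_cmd rho M in k1 ht *.
have [k2 [P [P1 P2 P3]]] := @run_reweight rho M1 rn.
set M2 := run reweight_cmd rho M1 in k2 P3 *.
have [k3 hW hm hsc3 hsp3] := @run_stats rho M2 rn rd.
set M3 := run stats_cmd rho M2 in k3 hW hm hsc3 hsp3 *.
have trimE (i : 'I_n) : M1 16 i 0 = trimmed_score y eta (ws t) i.
  rewrite ht he /trimmed_score /outlying hsc.
  by under eq_bigr => k _ do rewrite hsc.
have w1 (i : 'I_n) : M1 3 i 0 = ws t i by rewrite k1// -hw.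
have data2 : data M2 = y.
  by rewrite -hy; apply/funext => i; apply/funext => j; rewrite /data k2// k1.
have rew : reweighted y eta (ws t) (weights M2).
  exists P; split.
  - by move=> i; rewrite -w1 -trimE; exact: P1.
  - case: P2 => [->|[i h1 h2]]; [by left|right; exists i; first by rewrite -w1].
    by rewrite -trimE.
  - by move=> i; rewrite /weights P3 w1 trimE.
pose ws' u := if u == t.+1 then weights M2 else ws u.
have ws'E u : (u <= t)%N -> ws' u = ws u.
  by move=> ut; rewrite /ws' ifN// neq_ltn ltnS ut.
have ws't : ws' t.+1 = weights M2 by rewrite /ws' eqxx.
rewrite data2 in hm hsc3 hsp3.
have e3 : M3 1 0 0 = eta by rewrite k3// k2// k1.
have y3 : data M3 = y by rewrite -data2; apply/funext => i; apply/funext => j; rewrite /data k3.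
have w3 : weights M3 = weights M2 by apply/funext => i; rewrite /weights k3.
have sp14 : M3 14 0 0 = spread y (ws s) by rewrite k3// k2// k1.
have hws' u : (u < t.+1)%N -> reweighted y eta (ws' u) (ws' u.+1).
  rewrite ltnS leq_eqVlt => /predU1P[->|ut]; first by rewrite ws't ws'E.
  by rewrite !ws'E//; [exact: hws|exact: ltnW].
have ws'0 i : ws' 0%N i = n%:R^-1 by rewrite ws'E.
have keep_old : ~~ ((1 - 2 * eta <= wsum (weights M2)) && (spread y (weights M2) <= spread y (ws s)))
    -> invariant t.+1 M3.
  move=> hno; exists ws', s; split => //.
  - by rewrite ws't.
  - rewrite ws'E//; split => //; first exact: leqW.
    by move=> j; rewrite k3// k2// k1.
  - move=> u; rewrite leq_eqVlt ltnS => /predU1P[->|ut]; last by rewrite !ws'E//; exact: hbest.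
    rewrite ws't ws'E// => -[//|hu]; move: hno; rewrite hu/= -ltNge; exact: ltW.
have -> : run (LIf (RLe (RSub (RNat (NLit 1)) (RMul (RNat (NLit 2)) (RGet 1 (NLit 0) (NLit 0)))) (RGet 4 (NLit 0) (NLit 0)))
       (LIf (RLe (RGet 13 (NLit 0) (NLit 0)) (RGet 14 (NLit 0) (NLit 0))) save_cmd LSkip) LSkip) rho M3 =
    if (1 - 2 * eta <= wsum (weights M2)) && (spread y (weights M2) <= spread y (ws s))
    then run save_cmd rho M3 else M3.
  rewrite -hsp3 -sp14 -hW -e3; rewrite /= -/(run save_cmd _ _).
  by case: (1 - _ <= _).
case: ifPn => [/andP[hW' hle]|]; last exact: keep_old.
have [k4 h14 h2] := @run_save rho M3 rn rd n0; set M4 := run save_cmd rho M3 in k4 h14 h2 *.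
exists ws', t.+1; split => //.
- split; last by rewrite k4.
  by rewrite -y3; apply/funext => i; apply/funext => j; rewrite /data k4.
- rewrite ws't; split; last by move=> i; rewrite k4.
  by rewrite -w3; apply/funext => i; rewrite /weights k4.
- rewrite ws't; split => //; [by right|by rewrite h14|].
  by move=> j; rewrite h2 hm.
- move=> u; rewrite leq_eqVlt ltnS => /predU1P[->//|ut].
  rewrite ws't ws'E// => hu; apply: le_trans hle _; exact: hbest.
Qed.

Lemma program_estimator_filter : (0 < n)%N -> exists (ws : nat -> 'I_n -> R) (s : nat),
  [/\ (forall i, ws 0%N i = n%:R^-1) /\
        (forall u, (u < n)%N -> reweighted y eta (ws u) (ws u.+1)),
      (s <= n)%N, s = 0%N \/ 1 - 2 * eta <= wsum (ws s),
      forall j, program_estimator filter_cmd eta Y ord0 j = wmean y (ws s) j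
    & forall u, (u <= n)%N -> u = 0%N \/ 1 - 2 * eta <= wsum (ws u) ->
        spread y (ws s) <= spread y (ws u)].
Proof.
move=> n0; set rho := nreg (init eta Y); set M := rmem (init eta Y).
have rn : rho 0 = n by []. have rd : rho 1 = d by [].
have : invariant n (run filter_cmd rho M).
  rewrite /filter_cmd 3!run_seq.
  rewrite (@run_for_vec _ 3 2 false _ rho M n (fun _ => n%:R^-1))//; last first.
    by move=> i M1 _; rewrite /= div1r.
  set M0 := setmat _ _ _ _ _.
  have y0 : data M0 = y.
    apply/funext => i; apply/funext => j; rewrite /data /M0 /setmat /=.
    by rewrite /M /init /= /entry !valK.
  have w0 : weights M0 = (fun _ => n%:R^-1).
    by apply/funext => i; rewrite /weights /M0 /setmat /= ltn_ord.
  have [k1 hW hm hsc hsp] := @run_stats rho M0 rn rd.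
  set M1 := run stats_cmd rho M0 in k1 hW hm hsc hsp *.
  have [k2 h14 h2] := @run_save rho M1 rn rd n0; set M2 := run save_cmd rho M1 in k2 h14 h2 *.
  have inv0 : invariant 0 M2.
    exists (fun _ _ => n%:R^-1), 0%N; split => //.
    - split; last by rewrite k2// k1.
      by rewrite -y0; apply/funext => i; apply/funext => j; rewrite /data k2// k1.
    - split; first by rewrite -w0; apply/funext => i; rewrite /weights k2// k1.
      by move=> i; rewrite k2// hsc y0 w0.
    - by split => //; [left|rewrite h14 hsp y0 w0|move=> j; rewrite h2 hm y0 w0].
  rewrite run_for rn -[X in invariant X]add0n -[X in (0 + X)%N]muln1.
  apply: iteri_invariant inv0 => k M3 t; rewrite addn1.
  by apply: run_round; rewrite /upd.
move=> [ws [s [_ hws _ [hs h1 _ h2] h3]]]; exists ws, s; split => //.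
by move=> j; rewrite mxE -/rho -/M h2.
Qed.

End program_correct.

(** * The error rate *)

(** Recentring from [mu] to the centroid subtracts the mean projection, at most [a] on the unit
    ball. For the tail, [u i <= 1 / n] gives [u i * b^2 <= th * u i + max (0, b^2 - th) / n].
    Homogeneity extends the bounds to all [v]. *)
Lemma stable_of_unit_ball (R : realType) (n d : nat) (x : 'I_n -> 'I_d -> R) (mu : 'I_d -> R)
    (eta kappa q t a th : R) :
  (0 < n)%N -> 0 <= eta -> 0 <= th -> q + a ^+ 2 <= kappa ->
  2 * (3 * eta * th + t) + 6 * eta * a ^+ 2 <= kappa ->
  (forall v : 'I_d -> R, sqnorm v <= 1 -> let g i j := x i j - mu j in
    [/\ `|\sum_i dot v (g i) ^+ 2 - n%:R * sqnorm v| <= n%:R * q,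
        \sum_i Num.max 0 (dot v (g i) ^+ 2 - th) <= n%:R * t
      & dot v (fun j => \sum_i g i j) <= n%:R * a]) ->
  stable x eta kappa.
Proof.
move=> n0 eta0 th0 k1 k2 ball; pose g i j := x i j - mu j.
have n0' : 0 < n%:R :> R by rewrite ltr0n.
have nn : n%:R^-1 * n%:R = 1 :> R by rewrite mulVf// gt_eqF.
have ninv : 0 < n%:R^-1 :> R by rewrite invr_gt0.
pose c i j := x i j - centroid x j.
pose m v := n%:R^-1 * \sum_i dot v (g i).
have dotc v i : dot v (c i) = dot v (g i) - m v.
  have -> : m v = dot v (fun j => centroid x j - mu j).
    rewrite /m /dot exchange_big/= mulr_sumr; apply: eq_bigr => j _.
    rewrite -mulr_sumr mulrCA; congr (_ * _); rewrite /g /centroid sumrB sumr_const card_ord.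
    by rewrite mulrBr -[mu j *+ n]mulr_natl mulrA nn mul1r.
  rewrite /dot -sumrB; apply: eq_bigr => j _; rewrite /c /g; ring.
have sqm v : sqnorm v <= 1 -> m v ^+ 2 <= a ^+ 2.
  move=> v1; have v1' : sqnorm (fun j => -1 * v j) <= 1 by rewrite sqnormZ sqrrN expr1n mul1r.
  have sumE v' : dot v' (fun j => \sum_i g i j) = n%:R * m v'.
    rewrite /m [RHS]mulrA divff ?gt_eqF// mul1r /dot exchange_big/=.
    by apply: eq_bigr => j _; rewrite mulr_sumr.
  have [_ _] := ball v v1; have [_ _] := ball _ v1'.
  rewrite dotZ -/g !sumE [-1 * _]mulrCA !ler_pM2l// mulN1r => h1 h2.
  have : 0 <= (a - m v) * (a + m v) by apply: mulr_ge0; lra.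
  lra.
have secondE v : n%:R^-1 * \sum_i dot v (c i) ^+ 2 = n%:R^-1 * \sum_i dot v (g i) ^+ 2 - m v ^+ 2.
  have E i : dot v (c i) ^+ 2 = dot v (g i) ^+ 2 - 2 * m v * dot v (g i) + m v ^+ 2.
    by rewrite dotc; ring.
  under eq_bigr => i _ do rewrite E.
  rewrite big_split/= sumrB -mulr_sumr sumr_const card_ord -[m v ^+ 2 *+ n]mulr_natl.
  rewrite mulrDr mulrBr [n%:R^-1 * (n%:R * _)]mulrA nn mul1r.
  rewrite [n%:R^-1 * (_ * _)]mulrCA -/(m v); ring.
have unit (v : 'I_d -> R) : exists v' : 'I_d -> R, [/\ sqnorm v' <= 1, sqnorm v * sqnorm v' = sqnorm v &
    forall z, dot v z ^+ 2 = sqnorm v * dot v' z ^+ 2].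
  have S0 := sqnorm_ge0 v.
  have [S|Sn] := eqVneq (sqnorm v) 0.
    exists (fun _ => 0); rewrite S mul0r; split => //.
      by rewrite /sqnorm big1// => j _; rewrite expr0n.
    move=> z; apply/eqP; rewrite mul0r eq_le sqr_ge0 andbT.
    by have := dot_sqr_le v z; rewrite S mul0r.
  have r2 : Num.sqrt (sqnorm v) ^+ 2 = sqnorm v by rewrite sqr_sqrtr.
  exists (fun j => (Num.sqrt (sqnorm v))^-1 * v j); rewrite sqnormZ exprVn r2 mulVf//.
  by split => //; [rewrite mulr1|move=> z; rewrite dotZ exprMn exprVn r2 mulrA divff ?mul1r].
have second v : sqnorm v <= 1 -> sqnorm v - q <= n%:R^-1 * \sum_i dot v (g i) ^+ 2 <= sqnorm v + q.
  move=> v1; have [+ _ _] := ball v v1; rewrite -/g ler_norml => /andP[h1 h2].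
  rewrite -(ler_pM2l n0') -[X in _ && X](ler_pM2l n0') mulrA divff ?gt_eqF// mul1r.
  by apply/andP; split; lra.
split=> [v|v|u hu su v].
- have [v' [v1 vv vz]] := unit v; rewrite (eq_bigr (fun i => sqnorm v * dot v' (c i) ^+ 2)) => [|i _]; last exact: vz.
  rewrite -mulr_sumr mulrCA secondE; have /andP[_ h] := second v' v1.
  apply: (@le_trans _ _ (sqnorm v * (sqnorm v' + kappa))).
    rewrite ler_wpM2l ?sqnorm_ge0//; have := sqr_ge0 (m v'); have := sqr_ge0 a; lra.
  by rewrite mulrDr vv; lra.
- have [v' [v1 vv vz]] := unit v; rewrite (eq_bigr (fun i => sqnorm v * dot v' (c i) ^+ 2)) => [|i _]; last exact: vz.
  rewrite -mulr_sumr mulrCA secondE; have /andP[h _] := second v' v1.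
  apply: (@le_trans _ _ (sqnorm v * (sqnorm v' - kappa))); first by rewrite mulrBr vv; lra.
  by rewrite ler_wpM2l ?sqnorm_ge0//; have := sqm v' v1; lra.
- have [v' [v1 vv vz]] := unit v; under eq_bigr => i _ do rewrite vz mulrCA.
  rewrite -mulr_sumr mulrC ler_wpM2r ?sqnorm_ge0//.
  have [_ ht _] := ball v' v1; rewrite -/g in ht.
  apply: (@le_trans _ _ (\sum_i (2 * th * u i + 2 * (n%:R^-1 * Num.max 0 (dot v' (g i) ^+ 2 - th)) +
      2 * m v' ^+ 2 * u i))).
    apply: ler_sum => i _; have /andP[u0 u1] := hu i; rewrite -/(c i) dotc.
    set b := dot v' (g i); set mx := Num.max _ _.
    have mx0 : 0 <= mx by rewrite le_max lexx.
    have mx1 : b ^+ 2 - th <= mx by rewrite le_max lexx orbT.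
    have h1 : u i * mx <= n%:R^-1 * mx by rewrite ler_wpM2r.
    have h2 : u i * (b ^+ 2 - th) <= u i * mx by rewrite ler_wpM2l.
    have h3 : 0 <= u i * (b + m v') ^+ 2 by rewrite mulr_ge0 ?sqr_ge0.
    lra.
  rewrite !big_split/= -!mulr_sumr.
  have h1 : n%:R^-1 * \sum_i Num.max 0 (dot v' (g i) ^+ 2 - th) <= t.
    by rewrite -(ler_pM2l n0') mulrA divff ?gt_eqF// mul1r.
  have h2 : th * \sum_i u i <= th * (3 * eta) by rewrite ler_wpM2l.
  have u0 : 0 <= \sum_i u i by apply: sumr_ge0 => i _; have /andP[] := hu i.
  have h3 : m v' ^+ 2 * \sum_i u i <= a ^+ 2 * (3 * eta).
    by apply: ler_pM => //; [exact: sqr_ge0|exact: sqm].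
  lra.
Qed.

Lemma filter_estimator_error (R : realType) (n d : nat) (eta kappa : R) (X Y : 'M[R]_(n, d)) :
  (0 < n)%N -> 0 < eta -> eta <= 1 / 1000 -> n%:R^-1 <= kappa ->
  stable (fun i j => X i j) eta kappa -> corruption eta X Y ->
  l2norm (program_estimator filter_cmd eta Y - empirical_mean X) <= Num.sqrt (462 * eta * kappa).
Proof.
move=> n0 eta0 eta1 kn sX corr.
have [ws [s [[ws0 step] sn hs est best]]] := program_estimator_filter eta Y n0.
pose bad := [set i : 'I_n | row i X != row i Y]%SET.
have xy i : i \notin bad -> (fun j => Y i j) = (fun j => X i j).
  rewrite inE negbK => /eqP /rowP h; apply/funext => j.
  by have := h j; rewrite !mxE.
have [t tn [tW tS]] := filter_succeeds n0 eta0 eta1 kn sX xy corr ws0 step.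
have hw0 : weighting (ws 0%N) by move=> i; rewrite ws0 lexx invr_ge0 ler0n.
have hw u : (u <= n)%N -> weighting (ws u).
  elim: u => // u IH un.
  exact: reweighted_weighting (IH (ltnW un)) (step u un).
have sW : 1 - 2 * eta <= wsum (ws s).
  case: hs => [->|//]; rewrite /wsum.
  under eq_bigr => i _ do rewrite ws0.
  by rewrite sumr_const card_ord -[_ *+ n]mulr_natl divff ?gt_eqF ?ltr0n//; lra.
have sS := le_trans (best t tn (or_intror tW)) tS.
have := filter_accuracy n0 eta0 eta1 kn sX xy corr (hw s sn) sW sS.
rewrite /l2norm /sqnorm => h; rewrite ler_wsqrtr//; apply: le_trans h.
rewrite le_eqVlt; apply/orP; left; apply/eqP; apply: eq_bigr => j _; congr (_ ^+ 2).
rewrite mxE est [in LHS]mxE; congr (_ - _).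
by rewrite /empirical_mean mxE summxE; congr (_ * _); apply: eq_bigr => i _; rewrite mxE.
Qed.

Lemma expR1_ge2 (R : realType) : 2 <= expR (1 : R).
Proof. by have := expR_ge1Dx (1 : R); lra. Qed.

Lemma ln_inv_ge1 (R : realType) (eta : R) : 0 < eta -> eta <= 1 / 4 -> 1 <= ln eta^-1.
Proof.
move=> eta0 eta1; rewrite -[leLHS]expRK ler_ln ?posrE ?expR_gt0 ?invr_gt0//.
have : eta * expR 1 <= 1.
  have h : 1 / 4 <= expR (- 1 : R).
    have -> : - 1 = - (1 / 2) + - (1 / 2) :> R by field.
    by rewrite expRD; have := expR_ge1Dx (- (1 / 2) : R); nra.
  have E : expR (- 1) * expR 1 = 1 :> R by rewrite -expRD addNr expR0.
  by rewrite -[leRHS]E ler_wpM2r ?expR_ge0//; lra.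
by move=> h; rewrite -(ler_pM2l eta0) divff// gt_eqF.
Qed.

(** The constant is [260 = 258 + 2]: [exp (258 d)] pays for the net and [exp (2 d) >= 4] for the
    four families of events. *)
Lemma net_union_bound (R : realType) (d : nat) (l : R) : (0 < d)%N -> 0 <= l ->
  4 * (2 ^+ (258 * d) * expR (- (260 * (d%:R + l)))) <= expR (- l).
Proof.
move=> d0 l0; have d1 : 1 <= d%:R :> R by rewrite ler1n.
have e2 := expR1_ge2 R.
have h1 : 2 ^+ (258 * d) <= expR (258 * d%:R) :> R.
  rewrite -natrM -[X in expR X]mulr1 expRM_natl.
  by apply: lerXn2r => //; rewrite nnegrE ?expR_ge0.
have h2 : 4 <= expR (2 * d%:R) :> R.
  have -> : (4 : R) = 2 ^+ 2 by ring.
  apply: (@le_trans _ _ (expR 1 ^+ 2)).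
    by apply: lerXn2r => //; rewrite nnegrE ?expR_ge0.
  by rewrite -expRM_natl ler_expR mulr1 ler_peMr.
apply: (@le_trans _ _ (expR (2 * d%:R) * (expR (258 * d%:R) * expR (- (260 * (d%:R + l)))))).
  move: h1; set x := expR (- _); have x0 : 0 <= x := expR_ge0 _.
  have : 0 <= 2 ^+ (258 * d) :> R by apply: exprn_ge0.
  move: (2 ^+ (258 * d)) (expR (258 * d%:R)) => y z y0 yz.
  by apply: ler_pM => //; [exact: mulr_ge0|exact: ler_wpM2r].
by rewrite -!expRD ler_expR; lra.
Qed.

(** Here [l] is log(1/eta), [r] is rho and [rK] is the root of the bound K, used in the form
    [r^2 <= rK * r]. The number 279 exceeds [16 / 15 * 261], the constant of the linear forms; 9000
    covers [2 * 16 * 260] and the term in [eta * r^2]; 200 covers [96 + 64]. *)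
Lemma stability_constants (R : realType) (eta l r rK Cq : R) :
  0 < eta -> eta <= 1 / 1000 -> 1 <= l -> 0 < r -> r <= rK -> 0 < Cq ->
  let kappa := (Cq + 279 ^+ 2 * rK + 9000 * rK + 200) * (eta * l + r) in
  [/\ Cq * r + (279 * r) ^+ 2 <= kappa,
      2 * (3 * eta * (16 * l) + 16 * (2 * eta + 260 * r ^+ 2)) + 6 * eta * (279 * r) ^+ 2 <= kappa
    & r <= kappa].
Proof.
move=> eta0 eta1 l1 r0 rrK Cq0 kappa.
have rK0 : 0 < rK := lt_le_trans r0 rrK.
have eta_l : eta <= eta * l by rewrite ler_peMr// ltW.
have rr : r ^+ 2 <= rK * r by rewrite expr2 ler_pM2r.
have err : eta * r ^+ 2 <= 1 / 1000 * r ^+ 2 by rewrite ler_wpM2r ?sqr_ge0.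
have rKe : 0 < rK * (eta * l) by rewrite mulr_gt0//; lra.
have rKr : 0 < rK * r by rewrite mulr_gt0.
have Cqr : 0 < Cq * r by rewrite mulr_gt0.
have Cqe : 0 < Cq * (eta * l) by rewrite mulr_gt0//; lra.
rewrite /kappa; split; lra.
Qed.

Lemma ler_scaled_step (R : realType) (r rK : R) : 0 < r -> r <= rK ->
  (16 * (1 + rK))^-1 * r <= 1 / 16.
Proof.
move=> r0 rrK; rewrite mulrC ler_pdivrMr; last by lra.
lra.
Qed.

Theorem theorem5p6 (R : realType) :
  exists (eta0 : R) (est : estimator R),
    [/\ 0 < eta0,
        polynomial_time est
      & forall K : R, 0 < K ->
        exists2 C : R, 0 < C &
        forall (eta : R) (n d : nat) (beta : R),
          0 < eta < eta0 -> (0 < n)%N -> (0 < d)%N -> 0 < beta < 1 ->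
          d%:R + ln beta^-1 <= K * n%:R ->
        forall (mu : 'rV[R]_d) (disp : measure_display)
          (T : measurableType disp) (P : probability T R)
          (X : 'I_n -> T -> d.-tuple R) (Y : T -> 'M[R]_(n, d)),
          (forall i, normal_vector P mu (X i)) ->
          independent P X ->
          (forall w, corruption eta (dataset X w) (Y w)) ->
        prob_at_most P
          [set w | C * error_rate n d eta beta <
                   l2norm (est n d eta (Y w) - empirical_mean (dataset X w))]
          beta].
Proof.
exists (1 / 1000), (program_estimator filter_cmd); split; first lra.
  exact: program_estimator_polynomial_time scoped_filter_cmd.
move=> K K0; pose rK := Num.sqrt K; have rK0 : 0 <= rK by exact: sqrtr_ge0.
(* Chosen so that [s1 = c1 * r] is at most 1/16 for all [r <= rK]. As [L = 260 n r^2], a parameter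
   proportional to [r] makes both [1024 n s1] and [L / s1] multiples of [n r], whence [Cq]. *)
pose c1 : R := (16 * (1 + rK))^-1.
have c10 : 0 < c1 by rewrite invr_gt0; lra.
pose Cq : R := 2 * (1024 * c1 + 260 / c1).
have Cq0 : 0 < Cq by rewrite /Cq; have : 0 < c1^-1 by [rewrite invr_gt0]; lra.
pose C' : R := Cq + 279 ^+ 2 * rK + 9000 * rK + 200.
have C'0 : 0 < 462 * C' by rewrite /C'; lra.
exists (Num.sqrt (462 * C')); first by rewrite sqrtr_gt0.
move=> eta n d beta /andP[eta0 /ltW eta1] n0 d0 /andP[b0 b1] hK mu disp T P X Y gX iX corr.
have n0' : 0 < n%:R :> R by rewrite ltr0n.
have d1 : 1 <= d%:R :> R by rewrite ler1n.
set lb := ln beta^-1 in hK *; have lb0 : 0 < lb by rewrite ln_gt0// invf_gt1.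
pose r2 := (d%:R + lb) / n%:R; pose r := Num.sqrt r2.
have r21 : n%:R^-1 <= r2.
  by rewrite -[leLHS]mul1r ler_pM2r ?invr_gt0//; apply: le_trans d1 _; rewrite lerDl ltW.
have ninv : 0 < n%:R^-1 :> R by rewrite invr_gt0.
have r20 : 0 < r2 := lt_le_trans ninv r21.
have r0 : 0 < r by rewrite sqrtr_gt0.
have rr : r ^+ 2 = r2 by rewrite sqr_sqrtr// ltW.
have nr2 : n%:R * r ^+ 2 = d%:R + lb by rewrite rr /r2 mulrC divfK// gt_eqF.
have r_le : r <= rK by rewrite ler_wsqrtr// /r2 ler_pdivrMr.
set le := ln eta^-1.
have le1 : 1 <= le by apply: ln_inv_ge1 => //; apply: le_trans eta1 _; lra.
pose L := 260 * (d%:R + lb).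
have hL : 4 * (2 ^+ (258 * d) * expR (- L)) <= beta.
  have -> : beta = expR (- lb) by rewrite /lb lnV ?posrE// opprK lnK.
  exact: net_union_bound d0 (ltW lb0).
(* At this threshold [exp (- th / 16) = eta]. *)
pose s1 := c1 * r; pose th := 16 * le.
have hs1 : 0 < s1 <= 1 / 16 by rewrite mulr_gt0//=; exact: ler_scaled_step.
have [E [mE PE hE]] := gaussian_concentration th d0 gX iX hs1 r0 hL.
(* The event [E] depends on the clean samples alone, and outside of it every corruption is handled:
   this is how the adversary may look at the samples first. *)
exists E; split => // w /=; apply: contraPP => nE; apply/negP; rewrite -leNgt.
pose kappa := C' * (eta * le + r).
have [k1 k2 k3] := stability_constants eta0 eta1 le1 r0 r_le Cq0.
rewrite -/C' -/kappa in k1 k2 k3.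
have kn : n%:R^-1 <= kappa.
  apply: le_trans k3; rewrite -(@ler_pXn2r _ 2) ?nnegrE ?(ltW r0) ?(ltW ninv)// rr.
  by apply: le_trans r21; rewrite expr2 ler_piMr ?(ltW ninv)// invf_le1// ler1n.
have sX : stable (fun i j => dataset X w i j) eta kappa.
  have th0 : 0 <= th by rewrite mulr_ge0// (le_trans ler01).
  apply: (stable_of_unit_ball n0 (ltW eta0) th0 k1 k2 (mu := fun j => mu ord0 j)) => v v1.
  have [h1 h2 h3] := hE w nE v v1.
  have gE i : (fun j => dataset X w i j - mu ord0 j) = (fun j => tnth (X i w) j - mu ord0 j).
    by apply/funext => j; rewrite mxE.
  split.
  + under eq_bigr => i _ do rewrite gE.
    apply: le_trans h1 _; rewrite le_eqVlt; apply/orP; left; apply/eqP.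
    by rewrite /L -nr2 /Cq /s1; field; rewrite (gt_eqF r0) (gt_eqF c10).
  + under eq_bigr => i _ do rewrite gE.
    apply: le_trans h2 _; rewrite (_ : - (1 / 16 * th) = - le); last by rewrite /th; field.
    have -> : expR (- le) = eta by rewrite /le lnV ?posrE// opprK lnK.
    by rewrite le_eqVlt; apply/orP; left; apply/eqP; rewrite /L -nr2; ring.
  + rewrite (_ : (fun j => _) = (fun j => \sum_i (tnth (X i w) j - mu ord0 j))).
      apply: le_trans h3 _; rewrite /L -nr2.
      have -> : 16 / 15 * (n%:R * r + 260 * (n%:R * r ^+ 2) / r) = 16 / 15 * 261 * (n%:R * r).
        by field; rewrite gt_eqF.
      have -> : n%:R * (279 * r) = 279 * (n%:R * r) by ring.
      by rewrite ler_pM2r ?mulr_gt0//; lra.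
    by apply/funext => j; apply: eq_bigr => i _; rewrite mxE.
have := filter_estimator_error n0 eta0 eta1 kn sX (corr w).
move=> /le_trans; apply.
have -> : 462 * eta * kappa = 462 * C' * (eta ^+ 2 * le + eta * r) by rewrite /kappa; ring.
rewrite sqrtrM ?(ltW C'0)//.
rewrite ler_wpM2l ?sqrtr_ge0// /error_rate -/le -/r.
have le0 : 0 <= le := le_trans ler01 le1.
set a := eta * Num.sqrt le; set b := Num.sqrt (eta * _).
have a0 : 0 <= a by rewrite mulr_ge0 ?sqrtr_ge0// ltW.
have b0' : 0 <= b by exact: sqrtr_ge0.
have a2 : a ^+ 2 = eta ^+ 2 * le by rewrite exprMn sqr_sqrtr.
have b2 : b ^+ 2 = eta * r by rewrite sqr_sqrtr// mulr_ge0// ltW.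
rewrite -a2 -b2 -[leRHS]ger0_norm ?addr_ge0// -sqrtr_sqr ler_wsqrtr//.
by rewrite sqrrD -addrA lerD2l lerDr mulrn_wge0// mulr_ge0.
Qed.
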